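(* Let $d\ge1$ and $\gamma\in\mathbb{R}\setminus\{0\}$, and let $Z$ be the dyadic branching Brownian motion in $\mathbb{R}^d$ with unit time branching and self-interaction parameter $\gamma$, with center of mass $\overline{Z}$. The asymptotic behavior of $Z$ is that of a branching Ornstein-Uhlenbeck process, but with the origin shifted by a random, normally distributed vector. More precisely, the limit $N:=\lim_{t\to\infty}\overline{Z}_t$ exists almost surely and is normally distributed, and for almost all $x\in\mathbb{R}^d$ the following holds under the conditional law $P^x:=P(\cdot\mid N=x)$: for every $t\ge0$, $Z_t=\overline{Z}_t\oplus Y_t$, i.e. $Z_t^i=\overline{Z}_t+Y_t^i$ for $1\le i\le n_t$ with $\overline{Z}_t$ and $Y_t=(Y_t^1,\dots,Y_t^{n_t})$ independent, where $Y$ is the branching Ornstein-Uhlenbeck process described in the context.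
   Context: Model. Put $n_t:=2^{\lfloor t\rfloor}$. The process $Z_t=(Z_t^1,\dots,Z_t^{n_t})$, $Z_t^i\in\mathbb{R}^d$, is defined inductively. $Z_0$ is a single particle at the origin. At each integer time $m\ge1$ every particle is replaced by two offspring located at the parent's position (the offspring of particle $i$ are labeled $2i-1$ and $2i$). On $[m,m+1)$, $m=0,1,2,\dots$, the $2^m$ particles move according to $$Z_{m+\tau}^i=Z_m^i+B_0^i(\tau)+\frac{\gamma}{2^m}\int_0^\tau\sum_{j=1}^{2^m}\bigl(Z_{m+s}^j-Z_{m+s}^i\bigr)\,ds,\qquad \tau\in[0,1),\ 1\le i\le 2^m,$$ where $B_0^1,\dots,B_0^{2^m}$ (depending on $m$) are independent standard $d$-dimensional Brownian motions started at $0$, independent of the past up to time $m$, and $Z_m^i$ is the position of the parent at time $m-0$. The case $\gamma>0$ means attraction, $\gamma<0$ repulsion. The center of mass is $\overline{Z}_t:=\frac1{n_t}\sum_{i=1}^{n_t}Z_t^i$. The process $Y$. $Y_t^i:=Z_t^i-\overline{Z}_t$. $Y$ is the unit-time dyadic branching system, started from one particle at the origin (offspring start at the parent's position), in which on $[m,m+1)$, with $m=\lfloor t\rfloor$, $$Y_{m+\tau}^i=Y_m^i+\Bigl(B_0^i(\tau)-2^{-m}\sum_{j=1}^{2^m}B_0^j(\tau)\Bigr)-\gamma\int_0^\tau Y_{m+s}^i\,ds,\qquad 1\le i\le 2^m,$$ so that each particle moves on $[m,m+1)$ as an Ornstein-Uhlenbeck process with generator $\tfrac12(1-2^{-m})\Delta-\gamma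 x\cdot\nabla$, which tends to $\tfrac12\Delta-\gamma x\cdot\nabla$ as $m\to\infty$. This system is what is called the branching Ornstein-Uhlenbeck process. ''For almost all $x$'' is with respect to the law of $N$ (equivalently Lebesgue measure), and $\oplus$ denotes a sum of independent random vectors. *)

(* Defs.v *)
From HB Require Import structures.
From mathcomp Require Import all_boot all_order all_algebra.
From mathcomp Require Import all_classical all_reals all_analysis.
Set Implicit Arguments.
Unset Strict Implicit.
Unset Printing Implicit Defensive.
Import Order.TTheory GRing.Theory Num.Theory.
Import numFieldNormedType.Exports.
Local Open Scope classical_set_scope.
Local Open Scope ring_scope.

(* n_t = 2 ^ floor t, for 0 <= t. *)
Definition nb_particles {R : realType} (t : R) : nat := (2 ^ Num.truncn t)%N.

(* [z t i k] is the k-th coordinate of particle i at time t. Labels start at 0,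
   so the offspring of particle i are 2i and 2i+1, and the parent of i is i./2.
   Only the values at 0 <= t and i < n_t are meaningful; see [live]. *)
Definition trajectory (R : realType) (d : nat) : Type := R -> nat -> 'I_d -> R.

Definition live {R : realType} {d : nat} : set (R * nat * 'I_d) :=
  [set j | 0 <= j.1.1 /\ (j.1.2 < nb_particles j.1.1)%N].

Definition coord {R : realType} {d : nat} (j : R * nat * 'I_d)
    (z : trajectory R d) : R :=
  z j.1.1 j.1.2 j.2.

(* Particles branch at integer times only, hence s |-> z s i k makes sense on a
   right neighbourhood of any t such that i < n_t. *)
Definition right_continuous {R : realType} {d : nat} (z : trajectory R d) : Prop :=
  forall t i k, live (t, i, k) -> z s i k @[s --> t^'+] --> z t i k.

Definition center_of_mass {R : realType} {d : nat} (z : trajectory R d) (t : R)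
    (k : 'I_d) : R :=
  (\sum_(i < nb_particles t) z t i k) / (nb_particles t)%:R.

Definition fluct {R : realType} {d : nat} (z : trajectory R d) : trajectory R d :=
  fun t i k => z t i k - center_of_mass z t k.

Definition sigma_gen {R : realType} {T I : Type} (D : set I) (X : I -> T -> R) :
    set (set T) :=
  <<s \bigcup_(j in D) preimage_set_system setT (X j) measurable >>.

Definition indep2 {R : realType} {dT : measure_display} {T : measurableType dT}
    (P : {measure set T -> \bar R}) (F G : set (set T)) : Prop :=
  forall A B, F A -> G B -> P (A `&` B) = (P A * P B)%E.

Definition mutual_indep {R : realType} {dT : measure_display}
    {T : measurableType dT} (P : probability T R) {I : choiceType} (D : set I)
    (F : I -> set (set T)) : Prop :=
  forall (s : seq I) (A : I -> set T), uniq s ->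
    (forall j, j \in s -> D j /\ F j (A j)) ->
    P (\bigcap_(j in [set` s]) A j) = (\prod_(j <- s) P (A j))%E.

Definition standard_BM {R : realType} {dT : measure_display}
    {T : measurableType dT} (P : probability T R) (W : R -> T -> R) : Prop :=
  [/\ forall t, 0 <= t -> measurable_fun setT (W t),
      forall w, W 0 w = 0,
      forall w, {within `[0, +oo[, continuous (fun t => W t w)},
      forall s t, 0 <= s -> s < t -> forall A : set R, measurable A ->
        P [set w | A (W t w - W s w)] = normal_prob 0 (Num.sqrt (t - s)) A &
      forall s t, 0 <= s -> s < t ->
        indep2 P (sigma_gen [set u | 0 <= u <= s] W)
                 (sigma_gen [set: unit] (fun _ w => W t w - W s w))].

(* [W m i k] is the k-th coordinate of the Brownian motion of particle i on
   [m, m+1); a standard d-dimensional Brownian motion is a d-tuple of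
   independent standard one-dimensional ones. *)
Definition noise (R : realType) (d : nat) (T : Type) : Type :=
  nat -> nat -> 'I_d -> R -> T -> R.

Definition driving_noise {R : realType} {d : nat} {dT : measure_display}
    {T : measurableType dT} (P : probability T R) (W : noise R d T)
    (X : T -> trajectory R d) : Prop :=
  forall m : nat,
  [/\ forall i k, (i < 2 ^ m)%N -> standard_BM P (W m i k),
      mutual_indep P [set p : nat * 'I_d | (p.1 < 2 ^ m)%N]
        (fun p => sigma_gen [set s | 0 <= s] (W m p.1 p.2)) &
      indep2 P
        (sigma_gen [set j | live j /\ j.1.1 <= m%:R] (fun j w => coord j (X w)))
        (sigma_gen [set j | (j.1.2 < 2 ^ m)%N /\ 0 <= j.1.1]
           (fun j : R * nat * 'I_d => W m j.1.2 j.2 j.1.1))].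

Definition random_trajectory {R : realType} {d : nat} {dT : measure_display}
    {T : measurableType dT} (X : T -> trajectory R d) : Prop :=
  forall j, live j -> measurable_fun setT (fun w => coord j (X w)).

(* One particle at the origin; at each integer time m+1 every particle is
   replaced by two offspring at the position of the parent at time (m+1)-0. *)
Definition dyadic_branching {R : realType} {d : nat} (z : trajectory R d) : Prop :=
  (forall k, z 0 0%N k = 0) /\
  (forall (m i : nat) k, (i < 2 ^ m.+1)%N ->
     z (m%:R + u) i./2 k @[u --> 1^'-] --> z m.+1%:R i k).

Definition interacting_motion {R : realType} {d : nat} (gamma : R)
    (b : nat -> nat -> 'I_d -> R -> R) (z : trajectory R d) : Prop :=
  forall (m i : nat) k (tau : R), (i < 2 ^ m)%N -> 0 <= tau < 1 ->
    let F := fun s => \sum_(j < 2 ^ m) (z (m%:R + s) j k - z (m%:R + s) i k) in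
    lebesgue_measure.-integrable `[0, tau] (EFin \o F) /\
    z (m%:R + tau) i k = z m%:R i k + b m i k tau
      + gamma / (2 ^ m)%:R * (\int[lebesgue_measure]_(s in `[0, tau]) F s)%R.

Definition OU_motion {R : realType} {d : nat} (gamma : R)
    (b : nat -> nat -> 'I_d -> R -> R) (y : trajectory R d) : Prop :=
  forall (m i : nat) k (tau : R), (i < 2 ^ m)%N -> 0 <= tau < 1 ->
    let F := fun s => y (m%:R + s) i k in
    lebesgue_measure.-integrable `[0, tau] (EFin \o F) /\
    y (m%:R + tau) i k = y m%:R i k
      + (b m i k tau - (\sum_(j < 2 ^ m) b m j k tau) / (2 ^ m)%:R)
      - gamma * (\int[lebesgue_measure]_(s in `[0, tau]) F s)%R.

Definition interacting_BBM {R : realType} {d : nat} (gamma : R)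
    {dT : measure_display} {T : measurableType dT} (P : probability T R)
    (B : noise R d T) (Z : T -> trajectory R d) : Prop :=
  [/\ random_trajectory Z, driving_noise P B Z,
      forall w, dyadic_branching (Z w) &
      forall w, interacting_motion gamma (fun m i k s => B m i k s w) (Z w)].

Definition driven_branching_OU {R : realType} {d : nat} (gamma : R)
    {dT : measure_display} {T : measurableType dT} (P : probability T R)
    (W : noise R d T) (Y : T -> trajectory R d) : Prop :=
  [/\ random_trajectory Y, driving_noise P W Y,
      forall w, dyadic_branching (Y w) &
      forall w, OU_motion gamma (fun m i k s => W m i k s w) (Y w)].

Definition cylinder_sigma (R : realType) (d : nat) : set (set (trajectory R d)) :=
  sigma_gen live coord.

Definition same_law {R : realType} {d : nat}
    {dT : measure_display} {T : measurableType dT} (P : {measure set T -> \bar R})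
    (X : T -> trajectory R d)
    {dT' : measure_display} {T' : measurableType dT'} (P' : {measure set T' -> \bar R})
    (X' : T' -> trajectory R d) : Prop :=
  forall C, cylinder_sigma C -> P (X @^-1` C) = P' (X' @^-1` C).

(* "Y is the branching Ornstein-Uhlenbeck process under P", in the weak sense:
   the Brownian motions may live on another probability space. *)
Definition is_branching_OU {R : realType} {d : nat} (gamma : R)
    {dT : measure_display} {T : measurableType dT} (P : {measure set T -> \bar R})
    (Y : T -> trajectory R d) : Prop :=
  [/\ random_trajectory Y, forall w, right_continuous (Y w) &
      exists (dT' : measure_display) (T' : measurableType dT')
             (P' : probability T' R) (W : noise R d T') (Y' : T' -> trajectory R d),
        driven_branching_OU gamma P' W Y' /\ same_law P Y P' Y'].

(* Normal law on R^d through its one-dimensional projections; the covariance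
   is positive definite, so that the law is equivalent to Lebesgue measure. *)
Definition is_normal {R : realType} {d : nat} {dT : measure_display}
    {T : measurableType dT} (P : probability T R) (N : T -> d.-tuple R) : Prop :=
  exists (mu : 'rV[R]_d) (Sigma : 'M[R]_d),
  [/\ Sigma^T = Sigma,
      forall a : 'rV[R]_d, a != 0 -> 0 < (a *m Sigma *m a^T) 0 0 &
      forall a : 'rV[R]_d, a != 0 -> forall A : set R, measurable A ->
        P [set w | A (\sum_(k < d) a 0 k * tnth (N w) k)]
        = normal_prob (\sum_(k < d) a 0 k * mu 0 k)
            (Num.sqrt ((a *m Sigma *m a^T) 0 0)) A].

(* [Q x], together with the process Z' on T', is a version of P( . | N = x) for
   the process Z. The case T' = T, Z' = Z is that of a regular conditional
   probability of P given N. Such a kernel need not exist on an arbitrary T,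
   whence the freedom in the choice of the space carrying the conditioned
   process. The requirement that Z' be right-continuous, like Z, rules out
   modifications of Z' at uncountably many times; these would be compatible with
   the disintegration formula but could spoil statements that hold, for almost
   all x, at all times simultaneously. *)
Definition conditional_process {R : realType} {d : nat}
    {dT : measure_display} {T : measurableType dT} (P : probability T R)
    (Z : T -> trajectory R d) (N : {RV P >-> d.-tuple R})
    {dT' : measure_display} {T' : measurableType dT'}
    (Q : R.-pker (d.-tuple R) ~> T') (Z' : T' -> trajectory R d) : Prop :=
  [/\ random_trajectory Z', forall w, right_continuous (Z' w) &
      forall (C : set (trajectory R d)) (D : set (d.-tuple R)),
        cylinder_sigma C -> measurable D ->
        P (Z @^-1` C `&` N @^-1` D)
        = (\int[distribution P N]_(x in D) Q x (Z' @^-1` C))%E].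

(* Main.v *)
(* The center of mass is driven by the averages of the Brownian motions and
   Y = Z - center of mass by the deviations from these averages. Averages and
   deviations are independent, because for independent centred Gaussians X1 and
   X2 of variances a1 and a2 the sum S = X1 + X2 is independent of the residual
   X2 - a2 / (a1 + a2) S.
   Hence the center of mass is independent of Y, and its coordinates are
   independent Brownian motions run at rate 2^-m on [m, m + 1). Gaussian tails,
   chaining over dyadic times and Borel-Cantelli give the almost sure limit N,
   whose coordinates have variance 1 + 1/2 + 1/4 + ... = 2.

   If clock t denotes the variance of a coordinate at time t, then
   center of mass - (clock t / 2) N is a bridge independent of N; replacing N by
   x in Z = Y + bridge + (clock / 2) N therefore gives a process with the law
   P( . | N = x).

   Conversely, Y is independent of the pair (center of mass, N). Under any
   version of the conditional law this passes, for almost every x, to a countable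
   pi-system of events that involve finitely many dyadic times, and from there to
   all times by right-continuity. *)
Require Import Defs.
From HB Require Import structures.
From mathcomp Require Import all_boot all_order all_algebra.
From mathcomp Require Import all_classical all_reals all_analysis.
From mathcomp Require Import measurable_realfun ring lra.
(* Defs again, since MathComp-Analysis has another right_continuous. *)
Import Defs.
Set Implicit Arguments.
Unset Strict Implicit.
Unset Printing Implicit Defensive.
Import Order.TTheory GRing.Theory Num.Theory.
Import numFieldNormedType.Exports.
Local Open Scope classical_set_scope.
Local Open Scope ring_scope.

(** * Independence of finite families *)

(** Beyond the hypotheses on the noise, every independence statement about Gaussian quantities goes
    back to one computation with densities, the planar identity [normal_pdf_rotation]; the rest is
    regrouping of finite arrays of pi-systems. The sum-versus-residual fact, iterated in
    [gauss_sum_residual], is used twice: with equal variances it separates an average from its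
    deviations, and with the increments of [clock] as variances it separates the limit from the
    bridge. The motion of Y is an integral equation in Y itself. That Y depends only on the
    deviations, in a measurable way, is therefore drawn from an explicit solution, approximated by
    Riemann sums. Independence is propagated from one generation to the next for all coordinates at
    once, and extended to all times by limits along dyadic points. The conditioned Y is identified
    by comparison: under P the fluctuations of Z already form a branching Ornstein-Uhlenbeck process
    driven by [B], and conditioning on N leaves their law unchanged. *)

Lemma sigma_setT (U : pointedType) (G : set (set U)) : <<s G >> setT.
Proof. exact: (@measurableT _ (g_sigma_algebraType G)). Qed.

Lemma sigma_setI (U : pointedType) (G : set (set U)) : setI_closed <<s G >>.
Proof. by move=> A B; exact: (@measurableI _ (g_sigma_algebraType G)). Qed.

Lemma sigma_idem (U : Type) (G H : set (set U)) :
  G `<=` <<s H >> -> <<s G >> `<=` <<s H >>.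
Proof. by move=> GH; apply: smallest_sub => //; exact: smallest_sigma_algebra. Qed.

Section independence.
Context {R : realType} {d : measure_display} {T : measurableType d}.
Variable P : probability T R.

(** Only full intersections are tested. For families that contain [setT], such as the pi-systems
    below, this covers all subfamilies. *)
Definition mindep (I : finType) (F : I -> set (set T)) : Prop :=
  forall A : I -> set T, (forall i, F i (A i)) ->
    P (\bigcap_i A i) = (\prod_i P (A i))%E.

Definition pi_system (F : set (set T)) : Prop :=
  [/\ F `<=` measurable, setI_closed F & F setT].

Lemma mindepS (I : finType) (F G : I -> set (set T)) :
  (forall i, G i `<=` F i) -> mindep F -> mindep G.
Proof. by move=> GF iF A GA; apply: iF => i; exact: GF. Qed.

Lemma sigma_sub_measurable (G : set (set T)) :
  G `<=` measurable -> <<s G >> `<=` measurable.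
Proof. by move=> Gm; apply: smallest_sub => //; exact: sigma_algebra_measurable. Qed.

Lemma sigma_pi_system (G : set (set T)) : G `<=` measurable -> pi_system <<s G >>.
Proof.
by move=> Gm; split; [exact: sigma_sub_measurable|exact: sigma_setI|exact: sigma_setT].
Qed.

(** In [A], both sides are finite measures, the restriction of [P] to [C] and a multiple of [P];
    they agree on a generating pi-system. Taking [A = setT] forces [c = P C], which makes the factor
    finite. *)
Lemma pi_system_product (G : set (set T)) (C : set T) (c : \bar R) :
  pi_system G -> measurable C ->
  (forall A, G A -> P (A `&` C) = (P A * c)%E) ->
  forall A, <<s G >> A -> P (A `&` C) = (P A * c)%E.
Proof.
move=> [Gm GI GT] mC H A sA.
have cE : c = P C by have := H _ GT; rewrite setTI probability_setT mul1e.
have c0 : 0 <= fine (P C) by rewrite fine_ge0.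
pose c' := NngNum c0.
have sE B : mscale c' P B = (P B * c)%E.
  by rewrite /mscale /= fineK ?fin_num_measure// muleC cE.
have -> : P (A `&` C) = mrestr P mC A by [].
rewrite -sE.
apply: (@g_sigma_algebra_measure_unique _ _ _ G Gm (fun=> setT)) => //.
- by rewrite bigcup_const.
- by move=> B GB; rewrite [RHS]sE -H.
- move=> _; change (P (setT `&` C) < +oo)%E.
  by rewrite setTI -ge0_fin_numE// fin_num_measure.
Qed.

Lemma bigcapID (I : Type) (j : I) (A : I -> set T) :
  \bigcap_i A i = A j `&` \bigcap_(i in [set~ j]) A i.
Proof. by rewrite -bigcap_setU1 setUv. Qed.

(** The families are enlarged one index at a time: [s] lists the indices already enlarged, and
    [pi_system_product] treats the next one with [C] the intersection of all other events. *)
Lemma mindep_sigma (I : finType) (F : I -> set (set T)) :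
  (forall i, pi_system (F i)) -> mindep F -> mindep (fun i => <<s F i >>).
Proof.
move=> pF iF.
suff H : forall (s : seq I) (A : I -> set T),
    (forall i, i \in s -> <<s F i >> (A i)) ->
    (forall i, i \notin s -> F i (A i)) ->
    P (\bigcap_i A i) = (\prod_i P (A i))%E.
  by move=> A sA; apply: (H (enum I)) => // i; rewrite mem_enum.
elim=> [|j s IH] A sA FA; first by apply: iF => i; exact: FA.
have mA i : measurable (A i).
  have [/sA|/FA] := boolP (i \in j :: s); last by case: (pF i) => + _ _; apply.
  by apply: sigma_sub_measurable; case: (pF i).
have [js|js] := boolP (j \in s).
  apply: IH => i his; first by apply: sA; rewrite inE his orbT.
  by apply: FA; rewrite inE negb_or his andbT; apply: contraNneq his => ->.
rewrite (bigcapID j) (bigD1 j)//=.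
apply: (@pi_system_product (F j)) => //.
- exact: fin_bigcap_measurable.
- move=> B FB.
  pose A' i := if i == j then B else A i.
  have A'j : A' j = B by rewrite /A' eqxx.
  have A'i i : i != j -> A' i = A i by rewrite /A' => /negbTE ->.
  have := IH A'; rewrite (bigcapID j) (bigD1 j)//= A'j.
  have -> : \bigcap_(i in [set~ j]) A' i = \bigcap_(i in [set~ j]) A i.
    by apply: eq_bigcapr => i /= /eqP; exact: A'i.
  move=> ->.
  + by congr (_ * _)%E; apply: eq_bigr => i ij; rewrite A'i.
  + move=> i si; rewrite A'i; last by apply: contraNneq js => <-.
    by apply: sA; rewrite inE si orbT.
  + move=> i si; rewrite /A'; case: eqP => [->//|/eqP ij].
    by apply: FA; rewrite inE negb_or ij.
- by apply: sA; rewrite mem_head.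
Qed.

(** The product formula is applied over [i], where the hypothesis puts each inner intersection back
    into [F i], and again over [k] inside each factor. *)
Lemma mindep_split (I K : finType) (F : I -> set (set T))
    (G : I -> K -> set (set T)) :
  (forall i A, (forall k, G i k (A k)) -> F i (\bigcap_k A k)) ->
  mindep F -> (forall i, mindep (G i)) ->
  mindep (fun p : I * K => G p.1 p.2).
Proof.
move=> GF iF iG A GA.
have -> : \bigcap_p A p = \bigcap_i \bigcap_k A (i, k).
  apply/seteqP; split => x /=; first by move=> Ax i _ k _; exact: Ax.
  by move=> Ax [i k] _; exact: Ax.
rewrite iF; last by move=> i; apply: GF => k; exact: (GA (i, k)).
transitivity (\prod_i \prod_k P (A (i, k)))%E.
  by apply: eq_bigr => i _; rewrite (iG i (fun k => A (i, k)))// => k; exact: (GA (i, k)).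
by rewrite pair_bigA; apply: eq_bigr => -[].
Qed.

(** The events of a block are generated by the pi-system [Q j] of intersections that are trivial
    outside the fibre of [f] over [j], so that the product formula for [Q] is a rearrangement of the
    one for [F]. *)
Lemma mindep_regroup (I J : finType) (f : I -> J) (F : I -> set (set T)) :
  (forall i, pi_system (F i)) -> mindep F ->
  mindep (fun j => <<s \bigcup_(i in [set i | f i = j]) F i >>).
Proof.
move=> pF iF.
pose Q j : set (set T) := [set B | exists2 A : I -> set T,
  (forall i, F i (A i)) /\ (forall i, f i <> j -> A i = setT) &
  B = \bigcap_i A i].
apply: (@mindepS _ (fun j => <<s Q j >>)).
  move=> j; apply: sigma_idem => B [i /= fij FB]; apply: sub_sigma_algebra.
  exists (fun i' => if i' == i then B else setT).
    split=> i'; first by case: eqP => [->//|_]; case: (pF i').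
    by case: eqP => // -> /(_ fij).
  apply/seteqP; split => x /=; first by move=> Bx i' _; case: eqP.
  by move=> /(_ i Logic.I); rewrite eqxx.
apply: mindep_sigma.
  move=> j; split.
  - move=> _ [A [FA _] ->]; apply: fin_bigcap_measurable => //= i _.
    by case: (pF i) => + _ _; apply.
  - move=> _ _ [A [FA AT] ->] [B [FB BT] ->]; rewrite -bigcapI.
    exists (fun i => A i `&` B i) => //; split=> i.
      by case: (pF i) => _ + _; apply.
    by move=> fi; rewrite AT// BT// setTI.
  - exists (fun=> setT); last by apply/esym/seteqP; split.
    by split=> // i; case: (pF i).
move=> B QB.
have [j|A HA] := @choice _ _ (fun j (A : I -> set T) =>
    ((forall i, F i (A i)) /\ (forall i, f i <> j -> A i = setT)) /\
    B j = \bigcap_i A i).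
  by have [A HA BA] := QB j; exists A.
(* Diagonal choice: index [i] contributes the event chosen for its own block [f i]; in every other
   block its event is [setT]. *)
have -> : \bigcap_j B j = \bigcap_i A (f i) i.
  apply/seteqP; split => x /=.
    by move=> Bx i _; have := Bx (f i) Logic.I; rewrite (HA _).2; apply.
  move=> Ax j _; rewrite (HA _).2 => i _.
  by have [<-|fij] := pselect (f i = j); [exact: Ax|rewrite (HA j).1.2].
rewrite iF; last by move=> i; exact: (HA _).1.1.
rewrite (partition_big f xpredT)//=; apply: eq_bigr => j _.
rewrite (HA j).2 iF; last by move=> i; exact: (HA _).1.1.
rewrite [RHS](bigID (fun i => f i == j))/= [X in (_ * X)%E]big1 ?mule1.
  by apply: eq_bigr => i /eqP ->.
by move=> i /eqP fij; rewrite (HA j).1.2// probability_setT.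
Qed.

Lemma mindep2 (F G : set (set T)) :
  mindep (fun b : bool => if b then F else G) <-> indep2 P F G.
Proof.
split=> [iFG A B FA GB|iFG A FGA].
  have := iFG (fun b => if b then A else B).
  rewrite big_bool/= => <-; last by case.
  congr (P _); apply/seteqP; split => x /=; first by move=> [Ax Bx] [].
  by move=> ABx; split; [exact: (ABx true)|exact: (ABx false)].
rewrite big_bool/= -iFG; [|exact: (FGA true)|exact: (FGA false)].
congr (P _); apply/seteqP; split => x /=; last by move=> [Ax Bx] [].
by move=> ABx; split; [exact: (ABx true)|exact: (ABx false)].
Qed.

Lemma sigma_bigcap_fin (I : finType) (H : set (set T)) (A : I -> set T) :
  (forall i, <<s H >> (A i)) -> <<s H >> (\bigcap_i A i).
Proof.
move=> HA; apply: (@fin_bigcap_measurable _ (g_sigma_algebraType H)) => // i _; exact: HA.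
Qed.

(** Induction step in time: [F] is a family describing the past, [G] a family of new increments, and
    the past as a whole is independent of the increments as a whole. The array indexed by [bool * I]
    is regrouped along [I]. *)
Lemma mindep_join (I : finType) (F G : I -> set (set T)) (H K : set (set T)) :
  (forall i, pi_system (F i)) -> (forall i, pi_system (G i)) ->
  (forall i, F i `<=` <<s H >>) -> (forall i, G i `<=` <<s K >>) ->
  indep2 P <<s H >> <<s K >> -> mindep F -> mindep G ->
  mindep (fun i => <<s F i `|` G i >>).
Proof.
move=> pF pG FH GK /mindep2 iHK iF iG.
have : mindep (fun p : bool * I => if p.1 then F p.2 else G p.2).
  apply: (@mindep_split _ _ _ (fun b i => if b then F i else G i) _ iHK).
    by move=> [] A HA; apply: sigma_bigcap_fin => i; [exact: FH|exact: GK].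
  by case.
move=> /(@mindep_regroup _ _ snd); set Q := (X in (X -> _)).
move=> /(_ _)/mindepS; apply.
  move=> i; apply: sub_sigma_algebra2 => A [FA|GA].
    by exists (true, i).
  by exists (false, i).
by move=> p; case: ifP.
Qed.

(** The index set is finite, so any choice of events from the unions already lies in a common level,
    the maximum of the levels involved. *)
Lemma mindep_limit (I : finType) (F : nat -> I -> set (set T)) :
  (forall n i, pi_system (F n i)) ->
  (forall n i, F n i `<=` F n.+1 i) ->
  (forall n, mindep (F n)) ->
  mindep (fun i => <<s \bigcup_n F n i >>).
Proof.
move=> pF ndF iF.
have le_F n m i : (n <= m)%N -> F n i `<=` F m i.
  elim: m => [|m IH]; first by rewrite leqn0 => /eqP ->.
  rewrite leq_eqVlt => /predU1P[->//|/IH h]; apply: (subset_trans h).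
  exact: ndF.
apply: mindep_sigma => [i|A FA].
  split; last by exists 0%N => //; case: (pF 0%N i).
    by move=> A [n _]; case: (pF n i) => + _ _; apply.
  move=> A B [n _ FA] [m _ FB]; exists (maxn n m) => //.
  case: (pF (maxn n m) i) => _ + _; apply.
    by apply: le_F FA; exact: leq_maxl.
  by apply: le_F FB; exact: leq_maxr.
have [i|n Hn] := @choice _ _ (fun i n => F n i (A i)).
  by have [n _] := FA i; exists n.
apply: (iF (\max_i n i)%N) => i; apply: le_F (Hn i).
exact: leq_bigmax.
Qed.

Lemma indep2S (F G F' G' : set (set T)) :
  F `<=` F' -> G `<=` G' -> indep2 P F' G' -> indep2 P F G.
Proof. by move=> FF GG iFG A B FA GB; apply: iFG; [exact: FF|exact: GG]. Qed.

Lemma indep2C (F G : set (set T)) : indep2 P F G -> indep2 P G F.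
Proof. by move=> iFG A B GA FB; rewrite setIC muleC iFG. Qed.

(** The hypotheses make [F], [G], [K] mutually independent, which allows moving the bracket. This is
    the tool for adding one more independent increment to a past. *)
Lemma indep2_assoc (F G K : set (set T)) :
  pi_system F -> pi_system G -> pi_system K -> indep2 P F G ->
  indep2 P <<s F `|` G >> K -> indep2 P F <<s G `|` K >>.
Proof.
move=> pF pG pK iFG iFGK.
(* A two by two array with a trivial fourth cell, so that [mindep_split] and [mindep_regroup] apply;
   the cell of [F] is the one where both flags hold. *)
pose Q (p : bool * bool) : set (set T) :=
  if p.1 then if p.2 then F else G else if p.2 then K else [set setT].
have pT : pi_system [set setT].
  by split=> // [_ ->|_ _ -> ->]; rewrite ?setTI//; exact: measurableT.
have pQ p : pi_system (Q p) by rewrite /Q; case: ifP => _; case: ifP.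
have iQ : mindep Q.
  have /mindep2 iH := iFGK.
  apply: (@mindep_split _ _ _ (fun b k : bool => if b then if k then F else G
    else if k then K else [set setT]) _ iH).
    case=> A FA; last first.
      have -> : \bigcap_k A k = A true `&` A false.
        by apply/seteqP; split => x /=; [move=> Ax; split; exact: Ax|case=> ? ? []].
      by rewrite (FA false) setIT; exact: (FA true).
    apply: sigma_bigcap_fin => -[]; apply: sub_sigma_algebra.
      by left; exact: (FA true).
    by right; exact: (FA false).
  case; first exact/mindep2.
  apply/mindep2 => A _ _ ->; rewrite setIT -[LHS]mule1; congr (_ * _)%E.
  exact/esym/probability_setT.
have := @mindep_regroup _ _ (fun p : bool * bool => p.1 && p.2) _ pQ iQ.
move=> iR; apply/mindep2; apply: mindepS iR => -[].
  by move=> A FA; apply: sub_sigma_algebra; exists (true, true).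
apply: sub_sigma_algebra2 => A [GA|KA]; first by exists (true, false).
by exists (false, true).
Qed.

End independence.

(** * Measurability with respect to a generated sigma-algebra *)

Section measurability_wrt.
Context {R : realType} {T : pointedType}.

Definition gens {I : Type} (D : set I) (X : I -> T -> R) : set (set T) :=
  \bigcup_(j in D) preimage_set_system setT (X j) measurable.

(** Phrased as [measurable_fun] on the type carrying the generated sigma-algebra, so that the
    closure properties of measurable functions (sums, products, limits) apply directly. *)
Definition smeas (G : set (set T)) (f : T -> R) : Prop :=
  measurable_fun (setT : set (g_sigma_algebraType G)) f.

Lemma smeasP (G : set (set T)) (f : T -> R) :
  (forall A, measurable A -> <<s G >> (f @^-1` A)) -> smeas G f.
Proof. by move=> Gf _ A mA; rewrite setTI; exact: Gf. Qed.

Lemma smeas_preimage (G : set (set T)) (f : T -> R) A :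
  smeas G f -> measurable A -> <<s G >> (f @^-1` A).
Proof. by move=> Gf mA; rewrite -[_ @^-1` _]setTI; apply: Gf. Qed.

Lemma sigma_gen_sub {I : Type} (D : set I) (X : I -> T -> R) (G : set (set T)) :
  (forall j, D j -> smeas G (X j)) -> sigma_gen D X `<=` <<s G >>.
Proof.
move=> GX; apply: sigma_idem => _ [j Dj [A mA <-]].
by apply: GX => //; exact: measurableT.
Qed.

Lemma smeas_gen {I : Type} (D : set I) (X : I -> T -> R) j :
  D j -> smeas (gens D X) (X j).
Proof.
by move=> Dj; apply: smeasP => A mA; apply: sub_sigma_algebra; exists j => //;
  exists A => //; rewrite setTI.
Qed.

Lemma smeasS (G H : set (set T)) f : G `<=` <<s H >> -> smeas G f -> smeas H f.
Proof.
move=> GH Gf; apply: smeasP => A mA; apply: (sigma_idem GH).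
exact: smeas_preimage.
Qed.

Lemma smeas_cvg (G : set (set T)) (h : nat -> T -> R) (f : T -> R) :
  (forall n, smeas G (h n)) -> (forall w, h n w @[n --> \oo] --> f w) -> smeas G f.
Proof.
move=> Gh hf; apply: (@measurable_fun_cvg _ (g_sigma_algebraType G) R setT h f) => //.
Qed.

End measurability_wrt.

Section gens_measurable.
Context {R : realType} {d : measure_display} {T : measurableType d}.

Lemma gens_measurable {I : Type} (D : set I) (X : I -> T -> R) :
  (forall j, D j -> measurable_fun setT (X j)) -> gens D X `<=` measurable.
Proof.
by move=> mX _ [j Dj [A mA <-]]; apply: mX => //; exact: measurableT.
Qed.

Lemma sigma_gen_pi {I : Type} (D : set I) (X : I -> T -> R) :
  (forall j, D j -> measurable_fun setT (X j)) -> pi_system (sigma_gen D X).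
Proof. by move=> mX; apply/sigma_pi_system/gens_measurable. Qed.

Lemma smeas_measurable (G : set (set T)) (f : T -> R) :
  G `<=` measurable -> smeas G f -> measurable_fun setT f.
Proof.
move=> Gm Gf _ A mA; rewrite setTI; apply: (sigma_sub_measurable Gm).
exact: smeas_preimage.
Qed.

End gens_measurable.

Section image_measure.
Context {R : realType} {d d' : measure_display} {T : measurableType d}
  {T' : measurableType d'}.

Definition image_measure (m : {measure set T -> \bar R}) (f : T -> T')
    (mf : measurable_fun setT f) : {measure set T' -> \bar R} :=
  measure_function_pushforward__canonical__measure_function_Measure m mf.

Lemma image_measureE (m : {measure set T -> \bar R}) (f : T -> T')
    (mf : measurable_fun setT f) A : image_measure m mf A = m (f @^-1` A).
Proof. by []. Qed.

End image_measure.

(** * Translation invariance and the Gaussian density *)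

Section lebesgue_shift.
Context {R : realType}.

Lemma lebesgue_measure_shift (c : R) (A : set R) : measurable A ->
  lebesgue_measure ((fun x => x + c) @^-1` A) = lebesgue_measure A.
Proof.
move=> mA.
have mf : measurable_fun setT (fun x : measurableTypeR R => x + c : measurableTypeR R).
  by apply: measurable_funD.
rewrite [RHS](@lebesgue_measure_unique R (image_measure lebesgue_measure mf))//.
move=> _ [[a b] _ <-] /=.
rewrite /pushforward.
have -> : (fun x : R => x + c) @^-1` `]a, b] = `]a - c, b - c]%classic.
  by apply/seteqP; split => x /=; rewrite !in_itv/= ltrBlDr lerBrDr.
rewrite !lebesgue_measure_itv/= !lte_fin ltrD2r; case: ifP => // _.
by rewrite -!EFinB; congr EFin; ring.
Qed.

Lemma ge0_integral_shift (c : R) (f : R -> \bar R) :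
  measurable_fun setT f -> (forall x, (0 <= f x)%E) ->
  (\int[@lebesgue_measure R]_x f ((x : R) + c)%R = \int[@lebesgue_measure R]_x f x)%E.
Proof.
move=> mf f0.
have mc : measurable_fun setT (fun x : measurableTypeR R => x + c : measurableTypeR R).
  by apply: measurable_funD.
rewrite -[LHS](@ge0_integral_pushforward _ _ _ _ _ _ mc lebesgue_measure setT f)//.
by apply: eq_measure_integral => A mA _; exact: lebesgue_measure_shift.
Qed.

End lebesgue_shift.

Section normal_density.
Context {R : realType}.

Lemma normal_pdf_centered (v x : R) : 0 < v ->
  normal_pdf 0 (Num.sqrt v) x = (Num.sqrt (v * (pi *+ 2)))^-1 * expR (- (x ^+ 2 / (v *+ 2))).
Proof.
move=> v0; rewrite normal_pdfE ?gt_eqF ?sqrtr_gt0//.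
rewrite /normal_peak /normal_fun sqr_sqrtr ?ltW// subr0 mulNr.
by congr ((Num.sqrt _)^-1 * _); exact/esym/mulrnAr.
Qed.

(** With [s = x + y] and [z = y - b / (a + b) * s], one has [x ^ 2 / a + y ^ 2 / b = s ^ 2 / (a + b)
    + z ^ 2 * (a + b) / (a * b)]. The normalizing constants match because both pairs of variances
    have product [a * b]. *)
Lemma normal_pdf_rotation (a b x y : R) : 0 < a -> 0 < b ->
  normal_pdf 0 (Num.sqrt a) x * normal_pdf 0 (Num.sqrt b) y =
  normal_pdf 0 (Num.sqrt (a + b)) (x + y) *
  normal_pdf 0 (Num.sqrt (a * b / (a + b))) (y - b / (a + b) * (x + y)).
Proof.
move=> a0 b0; have ab0 : 0 < a + b by rewrite addr_gt0.
have c0 : 0 < a * b / (a + b) by rewrite !mulr_gt0 ?invr_gt0.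
have p0 : 0 <= pi *+ 2 :> R by rewrite mulrn_wge0 ?pi_ge0.
have E (p q e f : R) : (p^-1 * e) * (q^-1 * f) = (p * q)^-1 * (e * f).
  by rewrite invfM mulrACA.
rewrite !normal_pdf_centered// !E -!expRD.
congr (_ * _).
  congr (_^-1); rewrite -!sqrtrM ?mulr_ge0// ?ltW//; congr Num.sqrt.
  by field; rewrite gt_eqF.
by congr expR; field; rewrite !gt_eqF.
Qed.

End normal_density.

(** * Sums of independent centred Gaussians *)

Section density_measure.
Context {R : realType} {d : measure_display} {T : measurableType d}.
Variables (mu : {measure set T -> \bar R}) (f : T -> \bar R).
Hypotheses (mf : measurable_fun setT f) (f0 : forall x, (0 <= f x)%E).

(** The two proofs are arguments of the definition so that the measure structure can be attached to
    the term itself. *)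
Definition density_measure (_ : measurable_fun setT f)
  (_ : forall x, (0 <= f x)%E) (A : set T) : \bar R := (\int[mu]_(x in A) f x)%E.

Local Notation nu := (density_measure mf f0).

Let nu0 : nu set0 = 0%E. Proof. exact: integral_set0. Qed.

Let nu_ge0 A : (0 <= nu A)%E. Proof. exact: integral_ge0. Qed.

Let nu_sigma_additive : semi_sigma_additive nu.
Proof.
move=> F mF tF mUF; rewrite /density_measure ge0_integral_bigcup//=.
  by apply: is_cvg_ereal_nneg_natsum_cond => n _ _; exact: integral_ge0.
exact: measurable_funTS.
Qed.

HB.instance Definition _ := isMeasure.Build _ _ _ nu nu0 nu_ge0 nu_sigma_additive.

End density_measure.

Section gaussian.
Context {R : realType} {d : measure_display} {T : measurableType d}.
Variable P : probability T R.
Local Notation lam := (@lebesgue_measure R).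
Local Notation npdf v := (normal_pdf 0 (Num.sqrt v)).

Definition gauss (X : T -> R) (v : R) : Prop :=
  measurable_fun setT X /\
  forall A, measurable A -> P (X @^-1` A) = normal_prob 0 (Num.sqrt v) A.

Definition sig (X : T -> R) : set (set T) :=
  sigma_gen [set: unit] (fun=> X).

Lemma sigE (X : T -> R) A : measurable A -> sig X (X @^-1` A).
Proof.
by move=> mA; apply: sub_sigma_algebra; exists tt => //; exists A; rewrite ?setTI.
Qed.

Lemma measurable_npdf (v : R) : measurable_fun setT (fun x => (npdf v x)%:E).
Proof. by apply/measurable_EFinP; exact: measurable_normal_pdf. Qed.

Lemma integral_indic_normal (v : R) A : measurable A ->
  (\int[lam]_x ((\1_A x)%:E * (npdf v x)%:E) = normal_prob 0 (Num.sqrt v) A)%E.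
Proof.
move=> mA; rewrite /normal_prob [RHS]integral_mkcond.
by apply: eq_integral => x _; rewrite epatch_indic muleC.
Qed.

(** Uniqueness of the product measure is used twice: the law of the pair and the measure with the
    product density [J] both have the product values on rectangles. *)
Lemma gauss_joint_density (X Y : T -> R) (a b : R) (E : set (R * R)) :
  gauss X a -> gauss Y b -> indep2 P (sig X) (sig Y) -> measurable E ->
  P [set w | E (X w, Y w)] =
  (\int[lam]_y \int[lam]_x ((\1_E (x, y))%:E * ((npdf a x)%:E * (npdf b y)%:E)))%E.
Proof.
move=> [mX lX] [mY lY] iXY mE.
pose f (z : R * R) := ((npdf a z.1)%:E * (npdf b z.2)%:E)%E.
have mf : measurable_fun setT f.
  by apply: emeasurable_funM; apply: (measurableT_comp (@measurable_npdf _)).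
have f0 z : (0 <= f z)%E by rewrite mule_ge0// lee_fin normal_pdf_ge0.
pose J := @density_measure R _ _ (lam \x lam)%E f mf f0.
have mXY : measurable_fun setT
    (fun w => (X w, Y w) : measurableTypeR R * measurableTypeR R).
  exact: measurable_fun_pair.
have JE A : measurable A -> J A = (\int[lam]_y \int[lam]_x ((\1_A (x, y))%:E * f (x, y)))%E.
  move=> mA.
  rewrite /J /density_measure/= integral_mkcond.
  rewrite (@fubini_tonelli2 _ _ _ _ _ lam lam).
  - apply: eq_integral => y _; rewrite /fubini_G.
    by apply: eq_integral => x _; rewrite epatch_indic muleC.
  - exact/(measurable_restrictT _ _).1/measurable_funTS.
  - by move=> z; apply: erestrict_ge0.
have := @product_measure_unique _ _ _ _ _ (normal_prob 0 (Num.sqrt a)) (normal_prob 0 (Num.sqrt b)).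
move=> U.
transitivity (image_measure P mXY E); first by [].
transitivity ((normal_prob 0 (Num.sqrt a) \x normal_prob 0 (Num.sqrt b))%E E).
  apply/esym/(U (image_measure P mXY)) => //.
  move=> A B mA mB; transitivity (P (X @^-1` A) * P (Y @^-1` B))%E.
    by rewrite -iXY//; exact: sigE.
  by congr (_ * _)%E; [exact: lX|exact: lY].
rewrite (U J)//; first exact: JE.
move=> A B mA mB.
have JAB := JE _ (measurableX mA mB).
refine (eq_trans JAB _).
transitivity ((\int[lam]_x ((\1_A x)%:E * (npdf a x)%:E)) *
  (\int[lam]_x ((\1_B x)%:E * (npdf b x)%:E)))%E; last first.
  by rewrite !integral_indic_normal.
rewrite -ge0_integralZl//; last 3 first.
- apply: emeasurable_funM; last exact: measurable_npdf.
  by apply/measurable_EFinP; exact: measurable_indic.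
- by move=> x _; rewrite mule_ge0// lee_fin ?normal_pdf_ge0.
- by apply: integral_ge0 => x _; rewrite mule_ge0// lee_fin ?normal_pdf_ge0.
apply: eq_integral => y _.
transitivity (\int[lam]_x (((\1_A x)%:E * (npdf a x)%:E) *
                           ((\1_B y)%:E * (npdf b y)%:E)))%E.
  apply: eq_integral => x _; rewrite /f/=.
  have -> : \1_(A `*` B) (x, y) = \1_A x * \1_B y :> R.
    rewrite !indicE -natrM mulnb; congr (_%:R); congr nat_of_bool.
    by apply/idP/andP; rewrite !inE.
  by rewrite -!EFinM; congr EFin; ring.
rewrite ge0_integralZr//.
- apply: emeasurable_funM; last exact: measurable_npdf.
  by apply/measurable_EFinP; exact: measurable_indic.
- by move=> x _; rewrite mule_ge0// lee_fin ?normal_pdf_ge0.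
- by rewrite mule_ge0// lee_fin ?normal_pdf_ge0.
Qed.

(** The change of variables is split into two shears, each a translation in one variable:
    [s = x + y] for fixed [y], then, after Tonelli, [z = y - c * s] for fixed [s]. The density
    factorizes by [normal_pdf_rotation]. *)
Lemma gauss_rotation (X Y : T -> R) (a b : R) : 0 < a -> 0 < b ->
  gauss X a -> gauss Y b -> indep2 P (sig X) (sig Y) ->
  forall A B, measurable A -> measurable B ->
  P [set w | A (X w + Y w) /\ B (Y w - b / (a + b) * (X w + Y w))] =
  (normal_prob 0 (Num.sqrt (a + b)) A *
   normal_prob 0 (Num.sqrt (a * b / (a + b))) B)%E.
Proof.
move=> a0 b0 gX gY iXY A B mA mB.
set c := b / (a + b); set v := a * b / (a + b).
pose g (s z : R) : \bar R := ((\1_A s)%:E * (npdf (a + b) s)%:E * ((\1_B z)%:E * (npdf v z)%:E))%E.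
have g0 s z : (0 <= g s z)%E by rewrite !mule_ge0// lee_fin ?normal_pdf_ge0.
have m1 C w : measurable C -> measurable_fun setT (fun z : R => ((\1_C z)%:E * (npdf w z)%:E)%E).
  move=> mC; apply: emeasurable_funM; last exact: measurable_npdf.
  by apply/measurable_EFinP; exact: measurable_indic.
have mg : measurable_fun setT (fun p : R * R => g p.1 (p.2 - c * p.1)).
  apply: emeasurable_funM; first exact: (measurableT_comp (m1 _ _ mA)).
  apply: (measurableT_comp (m1 _ _ mB)).
  by apply: measurable_funB => //; apply: measurable_funM.
pose E : set (R * R) := [set p | A (p.1 + p.2) /\ B (p.2 - c * (p.1 + p.2))].
have mE : measurable E.
  have h1 : measurable_fun setT (fun p : R * R => p.1 + p.2) by exact: measurable_funD.
  have h2 : measurable_fun setT (fun p : R * R => p.2 - c * (p.1 + p.2)).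
    by apply: measurable_funB => //; apply: measurable_funM.
  have := measurableI _ _ (h1 measurableT _ mA) (h2 measurableT _ mB).
  by rewrite !setTI.
rewrite (gauss_joint_density gX gY iXY mE).
transitivity (\int[lam]_y \int[lam]_s g s ((y : R) - c * s)%R)%E.
  apply: eq_integral => y _.
  transitivity (\int[lam]_x g ((x : R) + y)%R (y - c * ((x : R) + y))%R)%E; last first.
    apply: (ge0_integral_shift y (f := fun s => g s (y - c * s))) => //.
    have mp : measurable_fun setT (fun s : R => (s, y : R)) by exact: measurable_fun_pair.
    exact: (measurableT_comp mg mp).
  apply: eq_integral => x _; rewrite /g -!EFinM; congr EFin.
  rewrite normal_pdf_rotation// -/c -/v.
  have -> : \1_E (x, y) = \1_A (x + y) * \1_B (y - c * (x + y)) :> R.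
    rewrite !indicE -natrM mulnb; congr (_%:R); congr nat_of_bool.
    by apply/idP/andP; rewrite !inE.
  by ring.
rewrite -(@fubini_tonelli _ _ _ _ _ lam lam (fun p : R * R => g p.1 (p.2 - c * p.1)))//=.
rewrite -integral_indic_normal// -integral_indic_normal//.
rewrite -ge0_integralZr//; last 3 first.
- exact: m1.
- by move=> x _; rewrite mule_ge0// lee_fin ?normal_pdf_ge0.
- by apply: integral_ge0 => x _; rewrite mule_ge0// lee_fin ?normal_pdf_ge0.
apply: eq_integral => s _.
transitivity (\int[lam]_z g s z)%E.
  apply: (ge0_integral_shift (- (c * s)) (f := g s)) => //.
  by rewrite /g; apply: emeasurable_funM => //; exact: m1.
rewrite /g ge0_integralZl//; first exact: m1.
- by move=> x _; rewrite mule_ge0// lee_fin ?normal_pdf_ge0.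
- by rewrite mule_ge0// lee_fin ?normal_pdf_ge0.
Qed.

Lemma gaussD (X Y : T -> R) (a b : R) : 0 < a -> 0 < b ->
  gauss X a -> gauss Y b -> indep2 P (sig X) (sig Y) ->
  gauss (fun w => X w + Y w) (a + b).
Proof.
move=> a0 b0 gX gY iXY; split; first by apply: measurable_funD; [exact: gX.1|exact: gY.1].
move=> A mA; have := gauss_rotation a0 b0 gX gY iXY mA measurableT.
rewrite probability_setT mule1 => <-; congr (P _).
by apply/seteqP; split => w /=; [split|case].
Qed.

Lemma gauss_indep_residual (X Y : T -> R) (a b : R) : 0 < a -> 0 < b ->
  gauss X a -> gauss Y b -> indep2 P (sig X) (sig Y) ->
  indep2 P (sig (fun w => X w + Y w))
           (sig (fun w => Y w - b / (a + b) * (X w + Y w))).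
Proof.
move=> a0 b0 gX gY iXY.
have K := gauss_rotation a0 b0 gX gY iXY.
set S := fun w => _; set D := fun w => _.
have mS : measurable_fun setT S by apply: measurable_funD; [exact: gX.1|exact: gY.1].
have mD : measurable_fun setT D.
  by apply: measurable_funB; [exact: gY.1|exact: measurable_funM].
have sub Z : measurable_fun setT Z -> preimage_set_system setT Z measurable `<=` @measurable _ T.
  by move=> mZ _ [A mA <-]; apply: mZ => //; exact: measurableT.
pose F Z := preimage_set_system setT (Z : T -> R) measurable.
have pF Z : measurable_fun setT Z -> pi_system (F Z).
  move=> mZ; split; first exact: sub.
  - move=> _ _ [A mA <-] [B mB <-]; exists (A `&` B); first exact: measurableI.
    by rewrite !setTI preimage_setI.
  - by exists setT; rewrite ?setTI.
have FE Z : sig Z = <<s F Z >>.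
  by rewrite /sig /sigma_gen bigcup_const//; exists tt.
rewrite !FE; apply/mindep2.
have : mindep P (fun b : bool => if b then F S else F D).
  apply/mindep2 => _ _ [A mA <-] [B mB <-]; rewrite !setTI.
  have -> : S @^-1` A `&` D @^-1` B = [set w | A (S w) /\ B (D w)] by [].
  rewrite [LHS]K//; congr (_ * _)%E.
    have := K _ _ mA measurableT; rewrite probability_setT mule1 => <-.
    by congr (P _); apply/seteqP; split => w /=; [case|split].
  have := K _ _ measurableT mB; rewrite probability_setT mul1e => <-.
  by congr (P _); apply/seteqP; split => w /=; [case|split].
move=> iF; apply: mindepS (mindep_sigma _ iF) => [[]//|c].
by case: c; exact: pF.
Qed.

End gaussian.

(** * Scaling, and sums of several independent Gaussians *)

Section lebesgue_scaling.
Context {R : realType}.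

Lemma lebesgue_measure_scale (c : R) (A : set R) : c != 0 -> measurable A ->
  (`|c|%:E * lebesgue_measure ((fun x => (c * x)%R) @^-1` A) = lebesgue_measure A)%E.
Proof.
move=> c0 mA.
have mf : measurable_fun setT (fun x : measurableTypeR R => c * x : measurableTypeR R).
  by apply: measurable_funM.
rewrite [RHS](@lebesgue_measure_unique R
  (mscale (`|c|%:nng) (image_measure lebesgue_measure mf)))//.
move=> _ [[a b] _ <-] /=.
rewrite /mscale/= /pushforward/=.
have [cp|cn] : 0 < c \/ c < 0 by apply/orP; rewrite -neq_lt eq_sym.
  have -> : (fun x : R => c * x) @^-1` `]a, b] = `]a / c, b / c]%classic.
    by apply/seteqP; split => x /=; rewrite !in_itv/= ltr_pdivrMr// ler_pdivlMr// mulrC.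
  rewrite !lebesgue_measure_itv/= !lte_fin ltr_pM2r ?invr_gt0//.
  case: ifP => _; last by rewrite mule0.
  by rewrite -!EFinB -EFinM gtr0_norm//; congr EFin; field.
have -> : (fun x : R => c * x) @^-1` `]a, b] = `[b / c, a / c[%classic.
  by apply/seteqP; split => x /=; rewrite !in_itv/= ltr_ndivlMr// ler_ndivrMr// mulrC andbC.
rewrite !lebesgue_measure_itv/= !lte_fin ltr_nM2r ?invr_lt0//.
case: ifP => _; last by rewrite mule0.
by rewrite -!EFinB -EFinM ltr0_norm//; congr EFin; field.
Qed.

Lemma ge0_integral_scale (c : R) (f : R -> \bar R) : c != 0 ->
  measurable_fun setT f -> (forall x, (0 <= f x)%E) ->
  (\int[@lebesgue_measure R]_x (`|c|%:E * f (c * (x : R))%R) =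
   \int[@lebesgue_measure R]_x f x)%E.
Proof.
move=> c0 mf f0.
have mc : measurable_fun setT (fun x : measurableTypeR R => c * x : measurableTypeR R).
  by apply: measurable_funM.
rewrite ge0_integralZl//; last exact: (measurableT_comp mf mc).
rewrite -[X in (_ * X)%E](@ge0_integral_pushforward _ _ _ _ _ _ mc lebesgue_measure setT f)//.
rewrite -[LHS](@ge0_integral_mscale _ _ _ (image_measure lebesgue_measure mc) setT measurableT (`|c|%:nng) f)//.
by apply: eq_measure_integral => A mA _; exact: lebesgue_measure_scale.
Qed.

End lebesgue_scaling.

Section gaussian_sums.
Context {R : realType} {d : measure_display} {T : measurableType d}.
Variable P : probability T R.
Local Notation lam := (@lebesgue_measure R).
Local Notation npdf v := (normal_pdf 0 (Num.sqrt v)).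

(** Change of variables [c * x]: the Jacobian [|c|] cancels the factor [Num.sqrt (c ^+ 2)] in the
    normalization of the density with variance [c ^+ 2 * v]. *)
Lemma gaussZ (X : T -> R) (c v : R) : c != 0 -> 0 < v ->
  gauss P X v -> gauss P (fun w => c * X w) (c ^+ 2 * v).
Proof.
move=> c0 v0 [mX lX]; split; first exact: measurable_funM.
have c2v : 0 < c ^+ 2 * v by rewrite mulr_gt0// exprn_even_gt0.
move=> A mA.
have mcA : measurable ((fun x : R => c * x) @^-1` A).
  have mc : measurable_fun setT (fun x : R => c * x) by exact: measurable_funM.
  by rewrite -[X in measurable X]setTI; apply: mc.
pose f (x : R) := ((\1_A x)%:E * (npdf (c ^+ 2 * v) x)%:E)%E.
transitivity (\int[lam]_x (`|c|%:E * f (c * (x : R))%R))%E; last first.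
  rewrite (ge0_integral_scale c0 (f := f)); first exact: integral_indic_normal.
    apply: emeasurable_funM; last exact: measurable_npdf.
    by apply/measurable_EFinP; exact: measurable_indic.
  by move=> x; rewrite mule_ge0// lee_fin ?normal_pdf_ge0.
apply: (eq_trans (lX _ mcA)); apply: (eq_trans (esym (integral_indic_normal v mcA))).
apply: eq_integral => x _; rewrite /f muleCA; congr (_ * _)%E.
rewrite !normal_pdf_centered// -EFinM; congr EFin.
rewrite -(mulrA (c ^+ 2)) (sqrtrM (v * (pi *+ 2)) (sqr_ge0 c)) sqrtr_sqr invfM.
rewrite mulrA mulrA mulfV ?normr_eq0// mul1r; congr (_ * expR _).
by field; rewrite c0 gt_eqF.
Qed.

Lemma sig_sub (X : T -> R) (G : set (set T)) : smeas G X -> sig X `<=` <<s G >>.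
Proof. by move=> GX; apply: sigma_gen_sub. Qed.

Lemma indep2_const (F : set (set T)) I (D : set I) (c : I -> R) :
  F `<=` measurable -> indep2 P F (sigma_gen D (fun j _ => c j)).
Proof.
move=> Fm; apply: indep2C => A B sA FB.
apply: (@pi_system_product _ _ _ P [set setT]) => //.
- by split=> // [_ ->|_ _ -> ->]; rewrite ?setTI//; exact: measurableT.
- exact: Fm.
- by move=> _ ->; rewrite setTI probability_setT mul1e.
- apply: sigma_gen_sub sA => j _; apply: smeasP => C mC.
  have [cC|cC] := pselect (C (c j)).
    by rewrite preimage_cst mem_set//; exact: sigma_setT.
  by rewrite preimage_cst memNset//; exact: sigma_algebra0.
Qed.

Lemma sig_pi (X : T -> R) : measurable_fun setT X -> pi_system (sig X).
Proof. by move=> mX; apply: sigma_gen_pi. Qed.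

(** Let [S'] be the previous sum, [R'] its residuals and [D] the residual of the new term. The new
    term is independent of [S'] and [R'] jointly, so [R'] is independent of [S'] and the new term,
    hence of [S] and [D]. As [S] and [D] are independent by the two-variable case, [S] is
    independent of [D] and [R'] together, and these determine all new residuals. *)
Lemma gauss_sum_residual (X : nat -> T -> R) (v : nat -> R) (n : nat) :
  (forall q, (q <= n)%N -> 0 < v q) ->
  (forall q, (q <= n)%N -> gauss P (X q) (v q)) ->
  (forall q, (q < n)%N ->
    indep2 P (sigma_gen [set j | (j <= q)%N] X) (sig (X q.+1))) ->
  let S w := \sum_(i < n.+1) X i w in
  let V := \sum_(i < n.+1) v i in
  [/\ 0 < V, gauss P S V &
  indep2 P (sig S)
    (sigma_gen [set j | (j <= n)%N] (fun j w => X j w - v j / V * S w))].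
Proof.
elim: n => [|n IH] v0 gX iX S V.
  have SE : S = X 0%N by apply/funext => w; rewrite /S big_ord1.
  have VE : V = v 0%N by rewrite /V big_ord1.
  have v00 := v0 0%N (leqnn _).
  rewrite SE VE; split; [exact: v00|exact: gX|].
  have mX0 := (gX 0%N (leqnn _)).1.
  (* With a single term the residual is [X 0 - X 0], a constant. *)
  apply: indep2S (@indep2_const (sig (X 0%N)) _ [set j | (j <= 0)%N] (fun=> 0) _) => //; last first.
    by case: (sig_pi mX0).
  apply: sigma_gen_sub => j /=; rewrite leqn0 => /eqP ->.
  rewrite divff ?gt_eqF//; under [X in smeas _ X]funext do rewrite mul1r subrr.
  by apply: (@smeas_gen _ _ _ [set j | (j <= 0)%N] (fun _ _ => 0) 0%N).
have [] := IH _ _ _.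
- by move=> q qn; apply: v0; exact: leqW.
- by move=> q qn; apply: gX; exact: leqW.
- by move=> q qn; apply: iX; exact: ltnW.
set S' := (fun w => \sum_(i < n.+1) X i w); set V' := \sum_(i < n.+1) v i.
move=> V'0 gS' iS'.
have SE : S = fun w => S' w + X n.+1 w by apply/funext => w; rewrite /S big_ord_recr.
have VE : V = V' + v n.+1 by rewrite /V big_ord_recr.
have vn0 : 0 < v n.+1 by exact: v0.
have V0 : 0 < V by rewrite VE addr_gt0.
have gXn : gauss P (X n.+1) (v n.+1) by exact: gX.
have iXn := iX n (ltnSn n).
set G := gens [set j | (j <= n)%N] X.
have sX j : (j <= n)%N -> smeas G (X j) by move=> jn; exact: (@smeas_gen _ _ _ [set j | (j <= n)%N]).
have sS' : smeas G S'.
  apply: measurable_sum => i; apply: sX; by rewrite -ltnS.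
set R' := (X in indep2 P _ (sigma_gen _ X)) in iS'.
have sR' j : (j <= n)%N -> smeas G (R' j).
  move=> jn; apply: measurable_funB; first exact: sX.
  exact: measurable_funM.
have Gm : G `<=` measurable.
  by apply: gens_measurable => j /= jn; apply: (gX _ _).1; exact: leqW.
have iS'X : indep2 P (sig S') (sig (X n.+1)) by apply: indep2S iXn => //; exact: sig_sub.
split; first exact: V0.
  by rewrite SE VE; exact: gaussD.
have := gauss_indep_residual V'0 vn0 gS' gXn iS'X.
rewrite -SE.
set D := (X in indep2 P _ (sig X)) => iSD.
have mS : measurable_fun setT S by rewrite SE; apply: measurable_funD; [exact: gS'.1|exact: gXn.1].
have DE : D = (fun w => X n.+1 w - v n.+1 / V * S w).
  by apply/funext => w; rewrite /D -VE SE.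
have mD : measurable_fun setT D.
  by rewrite DE; apply: measurable_funB; [exact: gXn.1|exact: measurable_funM].
have mR' j : (j <= n)%N -> measurable_fun setT (R' j).
  by move=> jn; apply: (smeas_measurable Gm); exact: sR'.
set R1 := sigma_gen _ R' in iS'.
have pR1 : pi_system R1 by apply: sigma_gen_pi => j /=; exact: mR'.
have iR1 : indep2 P R1 <<s sig S' `|` sig (X n.+1) >>.
  apply: indep2_assoc => //.
  - by apply: sig_pi; exact: gS'.1.
  - by apply: sig_pi; exact: gXn.1.
  - exact: indep2C.
  - apply: indep2S iXn => //; apply: sigma_idem => A [].
      by apply: sigma_gen_sub => j /=; exact: sR'.
    exact: sig_sub.
have sub1 : sig S `|` sig D `<=` <<s sig S' `|` sig (X n.+1) >>.
  have h1 : smeas (sig S' `|` sig (X n.+1)) S'.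
    by apply: smeasP => A mA; apply: sub_sigma_algebra; left; exact: sigE.
  have h2 : smeas (sig S' `|` sig (X n.+1)) (X n.+1).
    by apply: smeasP => A mA; apply: sub_sigma_algebra; right; exact: sigE.
  have h3 : smeas (sig S' `|` sig (X n.+1)) S by rewrite SE; exact: measurable_funD.
  move=> A [|]; apply: sig_sub => //.
  by rewrite DE; apply: measurable_funB => //; exact: measurable_funM.
have iS : indep2 P (sig S) <<s sig D `|` R1 >>.
  apply: indep2_assoc => //; [exact: sig_pi|exact: sig_pi|].
  by apply: indep2S (indep2C iR1) => //; exact: sigma_idem.
apply: indep2S iS => //; apply: sigma_gen_sub => j /= jn.
have hD : smeas (sig D `|` R1) D.
  by apply: smeasP => A mA; apply: sub_sigma_algebra; left; exact: sigE.
move: jn; rewrite leq_eqVlt => /predU1P[->|].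
  by rewrite -DE.
rewrite ltnS => jn.
have hR : smeas (sig D `|` R1) (R' j).
  apply: smeasS (smeas_gen (D := [set j | (j <= n)%N]) (X := R') jn) => A GA.
  by apply: sub_sigma_algebra; right; apply: sub_sigma_algebra.
(* Holds because [S' + D = V' / V * S]. *)
have -> : (fun w => X j w - v j / V * S w) = (fun w => R' j w - v j / V' * D w).
  apply/funext => w; rewrite DE SE VE /R' /S'.
  by field; rewrite !gt_eqF// -VE.
by apply: measurable_funB => //; exact: measurable_funM.
Qed.

End gaussian_sums.

(** * Gaussian tails and limits of Gaussian variables *)

Section gaussian_estimates.
Context {R : realType} {d : measure_display} {T : measurableType d}.
Variable P : probability T R.
Local Notation lam := (@lebesgue_measure R).
Local Notation npdf v := (normal_pdf 0 (Num.sqrt v)).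

Lemma expRN_le_sqr (u : R) : 0 < u -> expR (- u) <= 4 / u ^+ 2.
Proof.
move=> u0; rewrite expRN -[leLHS]mul1r ler_pdivrMr ?expR_gt0//.
have h : u / 2 <= expR (u / 2) by apply: le_trans (expR_ge1Dx _); lra.
have -> : expR u = expR (u / 2) ^+ 2.
  by rewrite -expRM_natl; congr expR; field.
have h2 : (u / 2) ^+ 2 <= expR (u / 2) ^+ 2.
  by rewrite lerXn2r// nnegrE ?expR_ge0// divr_ge0// ltW.
rewrite -(ler_pM2l (_ : 0 < u ^+ 2 / 4)); last by rewrite divr_gt0// exprn_gt0.
rewrite mulr1 mulrA (_ : u ^+ 2 / 4 * (4 / u ^+ 2) = 1) ?mul1r.
  by apply: le_trans h2; rewrite (_ : (u / 2) ^+ 2 = u ^+ 2 / 4)//; field.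
by field; rewrite gt_eqF.
Qed.

(** Half of the exponent is kept and gives the density of variance [2 v] up to [Num.sqrt 2]; the
    other half is bounded by [4 / u ^+ 2] with [u = x ^ 2 / (4 v)], that is by [64 v ^ 2 / x ^ 4].
    The remaining factor 2 in 128 absorbs [Num.sqrt 2]. *)
Lemma normal_pdf_tail (v a x : R) : 0 < v -> 0 < a -> a < `|x| ->
  npdf v x <= 128 * v ^+ 2 / a ^+ 4 * npdf (v *+ 2) x.
Proof.
move=> v0 a0 ax; have v20 : 0 < v *+ 2 by rewrite mulrn_wgt0.
have x0 : 0 < x ^+ 2 by rewrite -real_normK ?num_real// exprn_gt0// (lt_trans a0).
have xn : x != 0 by apply: contraTneq x0 => ->; rewrite expr0n/= ltxx.
have p0 : 0 <= v * (pi *+ 2) :> R by rewrite mulr_ge0 ?(ltW v0)// mulrn_wge0// pi_ge0.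
rewrite !normal_pdf_centered//.
have -> : v *+ 2 * (pi *+ 2) = 2 * (v * (pi *+ 2)) by rewrite mulrA mulr_natl.
rewrite (sqrtrM _ (ler0n _ 2)) (invfM (Num.sqrt 2)).
have -> : expR (- (x ^+ 2 / (v *+ 2))) = expR (- (x ^+ 2 / (v *+ 2 *+ 2))) * expR (- (x ^+ 2 / (v *+ 2 *+ 2))).
  by rewrite -expRD; congr expR; field; rewrite gt_eqF.
set q := Num.sqrt (v * (pi *+ 2)); set e := expR _.
have q0 : 0 <= q^-1 by rewrite invr_ge0 sqrtr_ge0.
have e0 : 0 <= e by exact: expR_ge0.
rewrite [leLHS]mulrA [leRHS](_ : _ = q^-1 * e * (128 * v ^+ 2 / a ^+ 4 / Num.sqrt 2)); last by ring.
apply: ler_wpM2l; first exact: mulr_ge0.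
have u0 : 0 < x ^+ 2 / (v *+ 2 *+ 2) by rewrite divr_gt0// !mulrn_wgt0.
apply: le_trans (expRN_le_sqr u0) _.
have s2 : 0 < Num.sqrt 2 :> R by rewrite sqrtr_gt0.
have s22 : Num.sqrt 2 <= 2 :> R.
  have : Num.sqrt 2 ^+ 2 = 2 :> R by rewrite sqr_sqrtr.
  by move=> h; nra.
have a2 : 0 < a ^+ 2 by rewrite exprn_gt0.
have ax2 : a ^+ 2 <= x ^+ 2 by rewrite -[x ^+ 2]real_normK ?num_real// lerXn2r ?nnegrE// ltW.
rewrite (_ : 4 / _ = 64 * v ^+ 2 * (x ^+ 2)^-1 ^+ 2); last by field; rewrite xn gt_eqF.
rewrite (_ : _ / Num.sqrt 2 = 64 * v ^+ 2 * ((a ^+ 2)^-1 ^+ 2 * (2 / Num.sqrt 2))); last first.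
  by field; rewrite !gt_eqF.
apply: ler_wpM2l; first by rewrite mulr_ge0// sqr_ge0.
have h1 : (x ^+ 2)^-1 ^+ 2 <= (a ^+ 2)^-1 ^+ 2.
  by rewrite lerXn2r// ?nnegrE ?invr_ge0 ?(ltW a2) ?(ltW x0)// lef_pV2 ?posrE.
apply: le_trans h1 _; rewrite ler_peMr ?sqr_ge0//.
by rewrite ler_pdivlMr// mul1r.
Qed.

(** Integrating the density comparison gives the order [v ^ 2 / a ^ 4] of a fourth-moment bound. The
    chaining argument relies on this order: the second-moment bound [v / a ^ 2] is not summable over
    [2 ^ r] cells of variance [2 ^- r] with decaying thresholds. *)
Lemma gauss_tail (X : T -> R) (v a : R) : 0 < v -> 0 < a -> gauss P X v ->
  (P [set w | (a < `|X w|)%R] <= (128 * v ^+ 2 / a ^+ 4)%:E)%E.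
Proof.
move=> v0 a0 [mX lX].
have v20 : 0 < v *+ 2 by rewrite mulrn_wgt0.
set K := 128 * v ^+ 2 / a ^+ 4.
have K0 : 0 <= K.
  by apply: divr_ge0; [apply: mulr_ge0 => //; exact: sqr_ge0|apply/exprn_ge0/ltW].
pose A := [set x : R | a < `|x|].
have mA : measurable A.
  have := @normr_measurable R setT measurableT `]a, +oo[%classic (measurable_itv _).
  rewrite setTI (_ : _ @^-1` _ = A)//.
  by apply/seteqP; split => x /=; rewrite in_itv/= andbT.
apply: (@le_trans _ _ (normal_prob 0 (Num.sqrt v) A)); first by rewrite -lX.
rewrite -integral_indic_normal//.
apply: (@le_trans _ _ (\int[lam]_x (K%:E * (npdf (v *+ 2) x)%:E))%E); last first.
  rewrite ge0_integralZl//=.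
  - by rewrite integral_normal_pdf mule1.
  - exact: measurable_npdf.
  - by move=> x _; rewrite lee_fin normal_pdf_ge0.
apply: ge0_le_integral => //=.
- by move=> x _; rewrite mule_ge0// lee_fin ?normal_pdf_ge0.
- apply: emeasurable_funM; last exact: measurable_npdf.
  by apply/measurable_EFinP; exact: measurable_indic.
- by apply: emeasurable_funM => //; exact: measurable_npdf.
- move=> x _; rewrite -!EFinM lee_fin indicE.
  have [|] := boolP (x \in A); rewrite ?inE => Ax; last by rewrite mul0r mulr_ge0// normal_pdf_ge0.
  by rewrite mul1r; exact: normal_pdf_tail.
Qed.

(** Fatou's lemma for sets: up to a null set, [E] lies in the increasing union of the [B n], and
    each [B n] is contained in [A n]. *)
Lemma eventually_le_prob (A : nat -> set T) (E : set T) (c : \bar R) :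
  (forall n, measurable (A n)) -> (forall n, (P (A n) <= c)%E) -> measurable E ->
  {ae P, forall w, E w -> \forall n \near \oo, A n w} -> (P E <= c)%E.
Proof.
move=> mA Ac mE [N [mN N0 EN]].
pose B n := \bigcap_(m in [set m | (n <= m)%N]) A m.
have mB n : measurable (B n) by apply: bigcap_measurableType => k _; exact: mA.
have mUB : measurable (\bigcup_n B n) by exact: bigcupT_measurable.
have EB : E `<=` N `|` \bigcup_n B n.
  move=> w Ew; have [|nN] := pselect (N w); [by left|right].
  have [n _ nA] : \forall n \near \oo, A n w.
    by apply: contrapT => h; apply: nN; apply: EN => /= /(_ Ew).
  by exists n => // m /= nm; exact: nA.
apply: (@le_trans _ _ (P (N `|` \bigcup_n B n))).
  by apply: le_measure; rewrite ?inE//; exact: measurableU.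
apply: (@le_trans _ _ (P (\bigcup_n B n))).
  apply: le_trans (measureU2 P mN mUB) _; rewrite -[leRHS]add0e; apply: leeD => //.
  by rewrite le_eqVlt; apply/orP; left; apply/eqP; exact: N0.
have ndB : nondecreasing_seq B.
  move=> n m nm; apply/subsetPset => w Bw k /= mk; apply: Bw => /=; exact: leq_trans mk.
have cvB := nondecreasing_cvg_mu (mu := P) mB mUB ndB.
rewrite -(cvg_lim _ cvB)//; apply: lime_le; first by apply/cvg_ex; eexists; exact: cvB.
apply: nearW => n /=; apply: le_trans (Ac n); apply: le_measure; rewrite ?inE//.
by move=> w; apply => /=.
Qed.

(** A portmanteau argument carried out inside an event [E] of [F], which yields the law of the limit
    and its independence of [F] together. Open sets get an upper bound by [eventually_le_prob]; on
    rays the bound for the opposite ray turns it into an equality, and rays determine a finite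
    measure. *)
Lemma gauss_limit (F : set (set T)) (X_ : nat -> T -> R) (X : T -> R)
    (v_ : nat -> R) (v : R) :
  0 < v -> (forall m, 0 < v_ m) -> v_ m @[m --> \oo] --> v ->
  (forall m, gauss P (X_ m) (v_ m)) ->
  F `<=` measurable -> F setT -> (forall m, indep2 P F (sig (X_ m))) ->
  measurable_fun setT X ->
  {ae P, forall w, X_ m w @[m --> \oo] --> X w} ->
  gauss P X v /\ indep2 P F (sig X).
Proof.
move=> v0 v_0 cv gX_ Fm FT iX mX cX.
(* Rescaling makes the law of [Y m] exactly [nu] for every [m]; since [r m] tends to 1, the almost
   sure limit is unchanged. *)
pose r m := Num.sqrt (v / v_ m).
have r0 m : 0 < r m by rewrite sqrtr_gt0 divr_gt0.
pose Y m w := r m * X_ m w.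
have vE m : r m ^+ 2 * v_ m = v.
  rewrite sqr_sqrtr; last by apply/ltW; rewrite divr_gt0.
  by rewrite divfK// gt_eqF.
have gY m : gauss P (Y m) v.
  by rewrite -[X in gauss _ _ X](vE m); exact: gaussZ (lt0r_neq0 (r0 m)) (v_0 m) (gX_ m).
have iY m : indep2 P F (sig (Y m)).
  apply: indep2S (iX m) => //; apply: sig_sub.
  apply: measurable_funM => //.
  exact: (@smeas_gen _ _ _ [set: unit] (fun=> X_ m) tt).
have cr : r m @[m --> \oo] --> (1 : R).
  have -> : (1 : R) = Num.sqrt (v / v) by rewrite divff ?gt_eqF// sqrtr1.
  apply: continuous_cvg; first exact: sqrt_continuous.
  by apply: cvgM; [exact: cvg_cst|apply: cvgV => //; rewrite gt_eqF].
have cY : {ae P, forall w, Y m w @[m --> \oo] --> X w}.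
  apply: filterS cX => w cw; rewrite -[X w]mul1r; exact: cvgM.
pose nu := normal_prob 0 (Num.sqrt v).
have PE (E : set T) (A : set R) m : F E -> measurable A ->
    P (E `&` Y m @^-1` A) = (P E * nu A)%E.
  move=> FE mA; rewrite (iY m E (Y m @^-1` A) FE (sigE mA)); congr (_ * _)%E.
  exact: (gY m).2.
have mXA (A : set R) : measurable A -> measurable (X @^-1` A).
  by move=> mA; rewrite -[X in measurable X]setTI; exact: mX.
have mYA m (A : set R) : measurable A -> measurable (Y m @^-1` A).
  by move=> mA; rewrite -[X in measurable X]setTI; apply: (gY m).1.
have upper E (U : set R) : F E -> measurable U -> open U ->
    (P (E `&` X @^-1` U) <= P E * nu U)%E.
  move=> FE mU oU.
  apply: (@eventually_le_prob (fun m => E `&` Y m @^-1` U)).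
  - by move=> n; apply: measurableI; [exact: Fm|exact: mYA].
  - by move=> n; rewrite PE.
  - by apply: measurableI; [exact: Fm|exact: mXA].
  - apply: filterS cY => w cw [Ew Uw].
    have : nbhs (X w) U by exact: open_nbhs_nbhs.
    by move=> /cw Yw; near=> m; split => //; near: m; exact: Yw.
pose lo (a : R) : set R := `]-oo, a[%classic.
pose hi (b : R) : set R := `]b, +oo[%classic.
have loE a x : lo a x = (x < a) by rewrite /lo/= in_itv.
have hiE a x : hi a x = (a < x) by rewrite /hi/= in_itv/= andbT.
have mlo a : measurable (lo a) by exact: measurable_itv.
have mhi b : measurable (hi b) by exact: measurable_itv.
have olo a : open (lo a) by exact: interval_open.
have ohi b : open (hi b) by exact: interval_open.
have ray E (a : R) : F E -> P (E `&` X @^-1` (lo a)) = (P E * nu (lo a))%E.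
  move=> FE; apply/eqP; rewrite eq_le (upper E (lo a) FE (mlo a) (olo a))/=.
  pose I n := `]-oo, (a - n.+1%:R^-1)]%classic : set R.
  have UI : \bigcup_n I n = lo a.
    apply/seteqP; split => x /=.
      move=> [n _]; rewrite /I/= in_itv/= loE => /le_lt_trans; apply.
      by rewrite gtrBl invr_gt0.
    rewrite loE -subr_gt0 => xa.
    have [n _ /(_ _ (leqnn n))/=] := near_infty_natSinv_lt (PosNum xa).
    by move=> h; exists n => //; rewrite /I/= in_itv/= lerBrDl -lerBrDr ltW.
  have cI : nu \o I @ \oo --> nu (lo a).
    rewrite -UI; apply: (@nondecreasing_cvg_mu _ _ _ nu I).
    - by move=> n; exact: measurable_itv.
    - by rewrite UI; exact: mlo.
    - move=> n m nm; apply/subsetPset => x; rewrite /I/= !in_itv/= => /le_trans; apply.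
      by rewrite lerB// lef_pV2 ?posrE// ler_nat ltnS.
  have fE : P E \is a fin_num by apply: fin_num_measure; exact: Fm.
  have cPI : (P E * (nu \o I) n)%E @[n --> \oo] --> (P E * nu (lo a))%E.
    by apply: cvgeZl.
  rewrite -(cvg_lim _ cPI)//; apply: lime_le; first by apply/cvg_ex; eexists; exact: cPI.
  apply: nearW => n /=.
  (* As [b < a], the open rays [lo a] and [hi b] cover the line. The upper bound for [hi b], whose
     complement is [I n], gives the lower bound [P E * nu (I n)] for [lo a]. *)
  pose b := a - n.+1%:R^-1; have ba : b < a by rewrite gtrBl invr_gt0.
  have h1 := upper E (hi b) FE (mhi b) (ohi b).
  have h2 : (P E <= P (E `&` X @^-1` (lo a)) + P (E `&` X @^-1` (hi b)))%E.
    have m1 : measurable (E `&` X @^-1` (lo a)) by apply: measurableI; [exact: Fm|exact: mXA].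
    have m2 : measurable (E `&` X @^-1` (hi b)) by apply: measurableI; [exact: Fm|exact: mXA].
    apply: le_trans (measureU2 P m1 m2).
    apply: le_measure; rewrite ?inE; [exact: Fm|exact: measurableU|].
    move=> w Ew; have [h|h] := ltP (X w) a.
      by left; split => //; rewrite /preimage/= loE.
    by right; split => //; rewrite /preimage/= hiE; exact: lt_le_trans h.
  have h3 : (nu (I n) + nu (hi b) = 1)%E.
    have hiC : hi b = ~` I n.
      by apply/predeqP => x; rewrite hiE /setC /I/= in_itv/= ltNge; split => /negP.
    rewrite -(@probability_setT _ _ _ nu) -measureU//.
    - by congr (nu _); rewrite hiC setUv.
    - exact: measurable_itv.
    - exact: mhi.
    - by rewrite hiC setICr.
  have fin (A : set R) : measurable A -> nu A \is a fin_num by move=> mA; exact: fin_num_measure.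
  have f1 : P (E `&` X @^-1` (lo a)) \is a fin_num.
    by apply: fin_num_measure; apply: measurableI; [exact: Fm|exact: mXA].
  move: h1 h2 h3.
  have f2 : P (E `&` X @^-1` (hi b)) \is a fin_num.
    by apply: fin_num_measure; apply: measurableI; [exact: Fm|exact: mXA].
  rewrite -(fineK fE) -(fineK f1) -(fineK f2).
  rewrite -(fineK (fin (I n) (measurable_itv _))) -(fineK (fin (hi b) (mhi b))).
  rewrite -!EFinM -!EFinD !lee_fin => h1 h2 [h3].
  have pE : 0 <= fine (P E) by exact: fine_ge0.
  nra.
have all E (A : set R) : F E -> measurable A -> P (E `&` X @^-1` A) = (P E * nu A)%E.
  move=> FE mA.
  have fE : P E \is a fin_num by apply: fin_num_measure; exact: Fm.
  have c0 : 0 <= fine (P E) by exact: fine_ge0.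
  have mE := Fm _ FE.
  have mX' : measurable_fun setT (X : T -> measurableTypeR R) by [].
  have -> : P (E `&` X @^-1` A) = image_measure (mrestr P mE) mX' A.
    by rewrite image_measureE /= setIC.
  have scE B : mscale (NngNum c0) nu B = (P E * nu B)%E by rewrite /mscale/= fineK.
  rewrite -scE.
  apply: (@g_sigma_algebra_measure_unique _ R (measurableTypeR R) (@RGenInftyO.G R) _
    (fun n => lo n%:R) _ _ (image_measure (mrestr P mE) mX') (mscale (NngNum c0) nu)).
  - by move=> _ [x ->]; exact: mlo.
  - by move=> n; eexists.
  - apply/seteqP; split => // x _.
    have [n xn] : exists n, x < n%:R by exists (Num.trunc `|x|).+1; rewrite (le_lt_trans (ler_norm _))// truncnS_gt.
    by exists n => //; rewrite loE.
  - move=> _ _ [x ->] [y ->]; exists (Num.min x y).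
    change (lo x `&` lo y = lo (Num.min x y)).
    by apply/predeqP => z; rewrite /setI/= !loE lt_min; split => /andP.
  - move=> _ [x ->]; rewrite [RHS]scE; change (P (X @^-1` (lo x) `&` E) = (P E * nu (lo x))%E).
    by rewrite setIC; exact: ray.
  - move=> k; change (P (X @^-1` (lo k%:R) `&` E) < +oo)%E.
    rewrite -ge0_fin_numE//; apply: fin_num_measure; apply: measurableI => //.
    exact: mXA.
  - by have := mA; rewrite [X in X A](RGenInftyO.measurableE R).
have lX (A : set R) : measurable A -> P (X @^-1` A) = nu A.
  by move=> mA; have := all _ _ FT mA; rewrite setTI probability_setT mul1e.
split; first by split.
have iG : forall E B, F E -> gens [set: unit] (fun=> X) B -> P (E `&` B) = (P E * P B)%E.
  by move=> E _ FE [_ _ [A mA <-]]; rewrite setTI all// lX.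
move=> E B FE sB; rewrite setIC muleC.
apply: (@pi_system_product _ _ _ P (gens [set: unit] (fun=> X))) => //.
- split.
  + exact: gens_measurable.
  + move=> _ _ [_ _ [A1 mA1 <-]] [_ _ [A2 mA2 <-]]; exists tt => //.
    by exists (A1 `&` A2); rewrite ?setTI ?preimage_setI//; exact: measurableI.
  + by exists tt => //; exists setT; rewrite ?setTI.
- exact: Fm.
- by move=> A GA; rewrite setIC muleC iG.
Unshelve. all: by end_near.
Qed.

End gaussian_estimates.

(** * Averages and deviations of the driving noise *)

Section dyadic_times.
Context {R : realType}.

Definition dyadic (r l : nat) : R := l%:R / 2 ^+ r.

Lemma pow2_gt0 (r : nat) : 0 < 2 ^+ r :> R.
Proof. by rewrite exprn_gt0. Qed.

Lemma dyadic_ge0 r l : 0 <= dyadic r l.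
Proof. by rewrite divr_ge0// ltW ?pow2_gt0. Qed.

Lemma dyadic_double r l : dyadic r.+1 l.*2 = dyadic r l.
Proof.
rewrite /dyadic exprS invfM mulrA -muln2 natrM mulfK//.
Qed.

Lemma dyadicS r l : dyadic r l.+1 - dyadic r l = (2 ^+ r)^-1.
Proof. by rewrite /dyadic -mulrBl -natr1 addrAC subrr add0r mul1r. Qed.

Lemma cvg_half_pow : (2 ^+ r)^-1 @[r --> \oo] --> (0 : R).
Proof.
under eq_fun do rewrite -exprVn.
by apply: cvg_expr; rewrite ger0_norm ?invr_ge0// invf_lt1// ltr1n.
Qed.

Definition dyadic_floor (r : nat) (s : R) : R := dyadic r (Num.truncn (s * 2 ^+ r)).

Lemma dyadic_floorP r s : 0 <= s -> dyadic_floor r s <= s < dyadic_floor r s + (2 ^+ r)^-1.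
Proof.
move=> s0; have s2 : 0 <= s * 2 ^+ r by rewrite mulr_ge0// ltW ?pow2_gt0.
have /andP[h1 h2] := truncn_itv s2; rewrite /dyadic_floor /dyadic.
rewrite ler_pdivrMr ?pow2_gt0// h1/=.
by rewrite -[X in _ + X]mul1r -mulrDl natr1 ltr_pdivlMr ?pow2_gt0.
Qed.

Lemma cvg_dyadic_floor s : 0 <= s -> dyadic_floor r s @[r --> \oo] --> s.
Proof.
move=> s0; apply: (@squeeze_cvgr _ _ _ _ (fun r => s - (2 ^+ r)^-1) (fun=> s)).
- apply: nearW => r; have /andP[-> h] := dyadic_floorP r s0; rewrite andbT.
  by rewrite lerBlDr ltW.
- by rewrite -[X in _ --> X]subr0; apply: cvgB; [exact: cvg_cst|exact: cvg_half_pow].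
- exact: cvg_cst.
Qed.

(** Strictly above [s], so that right-continuity applies along it; [dyadic_floor] is reserved for
    continuous paths, where it has the advantage of staying in [[0, 1]]. *)
Definition dyadic_next (r : nat) (s : R) : R := dyadic r (Num.truncn (s * 2 ^+ r)).+1.

Lemma dyadic_nextP r s : 0 <= s -> s < dyadic_next r s <= s + (2 ^+ r)^-1.
Proof.
move=> s0; have /andP[h1 h2] := dyadic_floorP r s0.
have -> : dyadic_next r s = dyadic_floor r s + (2 ^+ r)^-1.
  by rewrite -(dyadicS r (Num.truncn (s * 2 ^+ r))) addrC subrK.
by rewrite h2/= lerD2r.
Qed.

Lemma cvg_dyadic_next s : 0 <= s -> dyadic_next r s @[r --> \oo] --> s.
Proof.
move=> s0; apply: (@squeeze_cvgr _ _ _ _ (fun=> s) (fun r => s + (2 ^+ r)^-1)).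
- by apply: nearW => r; have /andP[h ->] := dyadic_nextP r s0; rewrite andbT ltW.
- exact: cvg_cst.
- by rewrite -[X in _ --> X]addr0; apply: cvgD; [exact: cvg_cst|exact: cvg_half_pow].
Qed.

Lemma cvg_seq_within (A : set R) (f : R -> R) (u : nat -> R) (x : R) :
  {within A, continuous f} -> A x -> (forall n, A (u n)) ->
  u n @[n --> \oo] --> x -> f (u n) @[n --> \oo] --> f x.
Proof.
move=> /subspace_continuousP cf Ax Au ux.
apply: cvg_comp (cf _ Ax) => B /= /ux [N _ NB].
by exists N => // n Nn; exact: NB.
Qed.

Lemma cvg_seq_at_right (f : R -> R) (u : nat -> R) (x l : R) :
  f s @[s --> x^'+] --> l -> (forall n, x < u n) ->
  u n @[n --> \oo] --> x -> f (u n) @[n --> \oo] --> l.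
Proof.
move=> fl xu ux; apply: cvg_comp fl => B /= /ux [N _ NB].
by exists N => // n Nn; apply: NB.
Qed.

End dyadic_times.

(** * One generation of Brownian motions *)

Section level.
Context {R : realType} {d : nat} {dT : measure_display} {T : measurableType dT}.
Variables (P : probability T R) (n : nat) (W : nat -> 'I_d -> R -> T -> R).
Hypothesis n0 : (0 < n)%N.
Hypothesis BM : forall i k, (i < n)%N -> standard_BM P (W i k).
Hypothesis iW : mutual_indep P [set p : nat * 'I_d | (p.1 < n)%N]
  (fun p => sigma_gen [set s | 0 <= s] (W p.1 p.2)).

Let I := ('I_n * 'I_d)%type.
Let WI (p : I) : R -> T -> R := W p.1 p.2.
Let full (p : I) : set (set T) := sigma_gen [set s | 0 <= s] (WI p).

Let mW (i : nat) k t : (i < n)%N -> 0 <= t -> measurable_fun setT (W i k t).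
Proof. by move=> /(BM k)[mW _ _ _ _]; exact: mW. Qed.

(** Passage from lists of labels to the finite type [I]; events are extended by [setT] to the labels
    outside the generation. *)
Lemma mindep_noise : mindep P full.
Proof.
move=> A FA.
pose B (p : nat * 'I_d) : set T := if insub p.1 is Some i then A (i, p.2) else setT.
have BE (p : I) : B (val p.1, p.2) = A p.
  by rewrite /B/= valK; case: p.
pose s := [seq (val p.1, p.2) | p : I].
have := iW (s := s) (A := B).
have us : uniq s.
  by rewrite map_inj_uniq ?enum_uniq// => -[i k] [j l]/= [/val_inj -> ->].
move=> /(_ us) H.
have {}H : P (\bigcap_(j in [set` s]) B j) = (\prod_(j <- s) P (B j))%E.
  by apply: H => _ /mapP[p _ ->]/=; split; [exact: ltn_ord|rewrite BE; exact: FA].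
have -> : \bigcap_p A p = \bigcap_(j in [set` s]) B j.
  apply/seteqP; split => x /=.
    by move=> Ax _ /= /mapP[p _ ->]; rewrite BE; exact: Ax.
  move=> Bx p _; rewrite -BE; apply: Bx => /=; apply/mapP; exists p => //.
  by rewrite mem_enum.
rewrite H /s big_map big_enum/=; apply: eq_bigr => p _; by rewrite BE.
Qed.

Let inc (s t : R) (p : I) : T -> R := fun w => WI p t w - WI p s w.
Let past (s : R) (p : I) : set (set T) := sigma_gen [set u | 0 <= u <= s] (WI p).

Let minc s t p : 0 <= s -> 0 <= t -> measurable_fun setT (inc s t p).
Proof. by move=> s0 t0; apply: measurable_funB; exact: mW. Qed.

Let past_pi s p : pi_system (past s p).
Proof. by apply: sigma_gen_pi => u /= /andP[u0 _]; exact: mW. Qed.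

Let inc_full s t p : 0 <= s -> 0 <= t -> sig (inc s t p) `<=` full p.
Proof.
move=> s0 t0; apply: sig_sub; apply: measurable_funB.
  exact: (@smeas_gen _ _ _ [set s | 0 <= s]).
exact: (@smeas_gen _ _ _ [set s | 0 <= s]).
Qed.

Let past_full s p : past s p `<=` full p.
Proof. by apply: sigma_gen_sub => u /= /andP[u0 _]; exact: (@smeas_gen _ _ _ [set s | 0 <= s]). Qed.

Definition noise_past (s : R) : set (set T) :=
  sigma_gen [set q : nat * 'I_d * R | (q.1.1 < n)%N /\ 0 <= q.2 <= s]
    (fun q => W q.1.1 q.1.2 q.2).

Definition noise_inc (s t : R) : set (set T) :=
  sigma_gen [set q : nat * 'I_d | (q.1 < n)%N]
    (fun q w => W q.1 q.2 t w - W q.1 q.2 s w).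

(** For each particle and coordinate, past and increment are independent by the Brownian property.
    The array indexed by (Brownian motion, past or increment) is then independent, and is regrouped
    along its flag. *)
Lemma indep_past_inc s t : 0 <= s -> s < t -> indep2 P (noise_past s) (noise_inc s t).
Proof.
move=> s0 st; have t0 : 0 <= t by exact: ltW (le_lt_trans s0 st).
pose G (p : I) (b : bool) := if b then past s p else sig (inc s t p).
have Gf p b : G p b `<=` full p.
  by case: b; [exact: past_full|exact: inc_full].
have pG p b : pi_system (G p b).
  by case: b; [exact: past_pi|apply: sig_pi; exact: minc].
have iG : mindep P (fun q : I * bool => G q.1 q.2).
  apply: (mindep_split _ mindep_noise) => p; last first.
    apply/mindep2; have [_ _ _ _ H] := BM p.2 (ltn_ord p.1).
    exact: H.
  move=> A GA; apply: sigma_bigcap_fin => b; exact: Gf (GA b).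
have := @mindep_regroup _ _ _ P _ _ (snd : I * bool -> bool) _ (fun q => pG q.1 q.2) iG.
move=> iR; apply/mindep2; apply: mindepS iR => -[] /=.
  apply: sigma_gen_sub => -[[i k] u] /= [ilt us].
  apply: smeasP => A mA; apply: sub_sigma_algebra.
  exists ((Ordinal ilt, k), true) => //=.
  have : smeas (gens [set u | 0 <= u <= s] (WI (Ordinal ilt, k))) (W i k u).
    exact: (@smeas_gen _ _ _ [set u | 0 <= u <= s] (WI (Ordinal ilt, k))).
  by move/smeas_preimage; exact.
apply: sigma_gen_sub => -[i k] /= ilt.
apply: smeasP => A mA; apply: sub_sigma_algebra.
exists ((Ordinal ilt, k), false) => //=.
by apply: sigE.
Qed.

Definition noise_avg (k : 'I_d) (t : R) (w : T) : R := (\sum_(i < n) W i k t w) / n%:R.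
Definition noise_dev (i : nat) (k : 'I_d) (t : R) (w : T) : R := W i k t w - noise_avg k t w.

Lemma noise_avgB k s t w :
  noise_avg k t w - noise_avg k s w = n%:R^-1 * \sum_(i < n) (W i k t w - W i k s w).
Proof. by rewrite /noise_avg sumrB -mulrBl mulrC. Qed.

(** [gauss_sum_residual] with equal variances: the weight [v j / V] is [1 / n], so the residuals are
    exactly the deviations from the average. *)
Lemma avg_inc_gauss k s t : 0 <= s -> s < t ->
  gauss P (fun w => noise_avg k t w - noise_avg k s w) ((t - s) / n%:R) /\
  indep2 P (sig (fun w => noise_avg k t w - noise_avg k s w))
    (sigma_gen [set i | (i < n)%N]
      (fun i w => noise_dev i k t w - noise_dev i k s w)).
Proof.
move=> s0 st; have t0 : 0 <= t by exact: ltW (le_lt_trans s0 st).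
have ts : 0 < t - s by rewrite subr_gt0.
pose X (i : nat) (w : T) := W i k t w - W i k s w.
have [n' nE] : exists n', n = n'.+1 by exists n.-1; rewrite prednK.
have mX i : (i < n)%N -> measurable_fun setT (X i).
  by move=> ilt; apply: measurable_funB; exact: mW.
have iX : mindep P (fun p : I => sig (inc s t p)).
  by apply: mindepS mindep_noise => p; exact: inc_full.
have gX i : (i < n)%N -> gauss P (X i) (t - s).
  move=> ilt; split; first exact: mX.
  by have [_ _ _ H _] := BM k ilt; move=> A mA; rewrite -(H s t s0 st A mA).
have := @gauss_sum_residual _ _ _ P X (fun=> t - s) n'.
case.
- by [].
- by move=> q qn; apply: gX; rewrite nE ltnS.
- move=> q qn.
  have := @mindep_regroup _ _ _ P _ _ (fun p : I => (p.1 <= q)%N) _ (fun p => sig_pi (minc p s0 t0)) iX.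
  move=> iR; apply/mindep2; apply: mindepS iR => -[] /=.
    apply: sigma_gen_sub => j /= jq.
    have jn : (j < n)%N by rewrite nE ltnS (leq_trans jq)// ltnW.
    apply: smeasP => A mA; apply: sub_sigma_algebra.
    by exists (Ordinal jn, k) => //=; exact: sigE.
  have qn1 : (q.+1 < n)%N by rewrite nE ltnS.
  apply: sig_sub; apply: smeasP => A mA; apply: sub_sigma_algebra.
  by exists (Ordinal qn1, k); [rewrite /= ltnn|exact: sigE].
set S := (fun w => \sum_(i < n'.+1) X i w); set V := \sum_(i < n'.+1) _.
have nR0 : n%:R != 0 :> R by rewrite pnatr_eq0 -lt0n.
have VE : V = n%:R * (t - s) by rewrite /V sumr_const card_ord nE mulr_natl.
have SE w : noise_avg k t w - noise_avg k s w = n%:R^-1 * S w.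
  by rewrite noise_avgB /S -nE.
move=> V0 gS iS.
have eE : (fun w => noise_avg k t w - noise_avg k s w) = (fun w => n%:R^-1 * S w).
  by apply/funext.
rewrite eE; split.
  have nV0 : n%:R^-1 != 0 :> R by rewrite invr_eq0.
  have := gaussZ nV0 V0 gS; congr (gauss _ _ _).
  by rewrite VE; field.
apply: indep2S iS.
  apply: sig_sub; apply: measurable_funM => //.
  exact: (@smeas_gen _ _ _ [set: unit] (fun=> S) tt).
apply: sigma_gen_sub => i /= ilt.
have iln : (i <= n')%N by rewrite -ltnS -nE.
have := @smeas_gen _ _ _ [set j | (j <= n')%N] (fun j w => X j w - (t - s) / V * S w) i iln.
congr smeas; apply/funext => w; rewrite /noise_dev.
have -> : W i k t w - noise_avg k t w - (W i k s w - noise_avg k s w) =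
  X i w - (noise_avg k t w - noise_avg k s w) by rewrite /X; ring.
by rewrite SE VE; congr (_ - _ * _); field; rewrite nR0 gt_eqF.
Qed.

(* The flag [true] stands for the deviations, [false] for the average. *)
Definition dev_avg_inc (s t : R) (q : 'I_d * bool) : set (set T) :=
  if q.2 then sigma_gen [set i | (i < n)%N]
      (fun i w => noise_dev i q.1 t w - noise_dev i q.1 s w)
  else sig (fun w => noise_avg q.1 t w - noise_avg q.1 s w).

Let smeas_avg_inc s t k G :
  (forall i, (i < n)%N -> smeas G (fun w => W i k t w - W i k s w)) ->
  smeas G (fun w => noise_avg k t w - noise_avg k s w).
Proof.
move=> sX; have -> : (fun w => noise_avg k t w - noise_avg k s w) =
   (fun w => n%:R^-1 * \sum_(i < n) (W i k t w - W i k s w)).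
  by apply/funext => w; rewrite noise_avgB.
apply: measurable_funM => //.
by apply: measurable_sum => i; exact: sX.
Qed.

Let smeas_dev_inc s t i k G : (i < n)%N ->
  (forall i, (i < n)%N -> smeas G (fun w => W i k t w - W i k s w)) ->
  smeas G (fun w => noise_dev i k t w - noise_dev i k s w).
Proof.
move=> ilt sX; have -> : (fun w => noise_dev i k t w - noise_dev i k s w) =
   (fun w => (W i k t w - W i k s w) - (noise_avg k t w - noise_avg k s w)).
  by apply/funext => w; rewrite /noise_dev; ring.
by apply: measurable_funB; [exact: sX|exact: smeas_avg_inc].
Qed.

Lemma dev_avg_inc_sub s t q G :
  (forall i, (i < n)%N -> smeas G (fun w => W i q.1 t w - W i q.1 s w)) ->
  dev_avg_inc s t q `<=` <<s G >>.
Proof.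
move=> sX; rewrite /dev_avg_inc; case: q.2.
  by apply: sigma_gen_sub => i /= ilt; exact: smeas_dev_inc.
by apply: sig_sub; exact: smeas_avg_inc.
Qed.

Lemma dev_avg_inc_pi s t q : 0 <= s -> 0 <= t -> pi_system (dev_avg_inc s t q).
Proof.
move=> s0 t0.
pose G := gens [set i | (i < n)%N] (fun i w => W i q.1 t w - W i q.1 s w).
have Gm : G `<=` measurable.
  by apply: gens_measurable => i /= ilt; apply: measurable_funB; exact: mW.
have sX i : (i < n)%N -> smeas G (fun w => W i q.1 t w - W i q.1 s w).
  exact: (@smeas_gen _ _ _ [set i | (i < n)%N] (fun i w => W i q.1 t w - W i q.1 s w)).
rewrite /dev_avg_inc; case: q.2.
  by apply: sigma_gen_pi => i /= ilt; apply: (smeas_measurable Gm); exact: smeas_dev_inc.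
by apply: sig_pi; apply: (smeas_measurable Gm); exact: smeas_avg_inc.
Qed.

(** Different coordinates involve disjoint sets of Brownian motions; within a coordinate,
    [avg_inc_gauss] separates the two flags. *)
Lemma mindep_dev_avg_inc s t : 0 <= s -> s < t -> mindep P (dev_avg_inc s t).
Proof.
move=> s0 st; have t0 : 0 <= t by exact: ltW (le_lt_trans s0 st).
have iX : mindep P (fun p : I => sig (inc s t p)).
  by apply: mindepS mindep_noise => p; exact: inc_full.
have iK := @mindep_regroup _ _ _ P _ _ (snd : I -> 'I_d) _ (fun p => sig_pi (minc p s0 t0)) iX.
apply: (mindep_split (G := fun k b => dev_avg_inc s t (k, b)) _ iK) => k.
  move=> A GA; apply: sigma_bigcap_fin => b; move: (GA b).
  apply: dev_avg_inc_sub => i ilt /=; apply: smeasP => C mC.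
  by apply: sub_sigma_algebra; exists (Ordinal ilt, k) => //=; exact: sigE.
have [_ /indep2C/mindep2 iS] := avg_inc_gauss k s0 st.
by apply: mindepS iS => -[].
Qed.

Lemma smeas_avg k t G :
  (forall i, (i < n)%N -> smeas G (W i k t)) -> smeas G (noise_avg k t).
Proof.
move=> sW; apply: measurable_funM => //.
by apply: measurable_sum => i; exact: sW.
Qed.

Lemma smeas_dev i k t G : (i < n)%N ->
  (forall i, (i < n)%N -> smeas G (W i k t)) -> smeas G (noise_dev i k t).
Proof. by move=> ilt sW; apply: measurable_funB; [exact: sW|exact: smeas_avg]. Qed.

Lemma cvg_noise_avg (k : 'I_d) (u : nat -> R) (s : R) (w : T) : 0 <= s -> (forall r, 0 <= u r) ->
  u r @[r --> \oo] --> s ->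
  noise_avg k (u r) w @[r --> \oo] --> noise_avg k s w.
Proof.
move=> s0 u0 us; apply: cvgM; last exact: cvg_cst.
apply: cvg_big => [|i _]; first exact: add_continuous.
 have [_ _ cW _ _] := BM k (ltn_ord i).
by apply: (cvg_seq_within (cW w)) => //= [|r]; rewrite in_itv/= ?s0 ?u0.
Qed.

Lemma cvg_noise_dev (i : nat) (k : 'I_d) (u : nat -> R) (s : R) (w : T) : (i < n)%N -> 0 <= s ->
  (forall r, 0 <= u r) -> u r @[r --> \oo] --> s ->
  noise_dev i k (u r) w @[r --> \oo] --> noise_dev i k s w.
Proof.
move=> ilt s0 u0 us; apply: cvgB; last exact: cvg_noise_avg.
have [_ _ cW _ _] := BM k ilt.
by apply: (cvg_seq_within (cW w)) => //= [|r]; rewrite in_itv/= ?s0 ?u0.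
Qed.

(** The flag has the same meaning as in [dev_avg_inc]. [D] is the set of observed times, which grows
    from dyadic grids to [[0, 1]]. *)
Definition dev_avg_gen (D : set R) (q : 'I_d * bool) : set (set T) :=
  if q.2 then sigma_gen [set p : nat * R | (p.1 < n)%N /\ D p.2]
      (fun p => noise_dev p.1 q.1 p.2)
  else sigma_gen D (noise_avg q.1).

Lemma dev_avg_gen_sub (D : set R) (q : 'I_d * bool) (G : set (set T)) :
  (forall i s, q.2 -> (i < n)%N -> D s -> smeas G (noise_dev i q.1 s)) ->
  (forall s, ~~ q.2 -> D s -> smeas G (noise_avg q.1 s)) ->
  dev_avg_gen D q `<=` <<s G >>.
Proof.
rewrite /dev_avg_gen; case: q.2 => sd sa; apply: sigma_gen_sub.
  by move=> [i s] /= [ilt Ds]; exact: sd.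
by move=> s Ds; exact: sa.
Qed.

Lemma dev_avg_gen_pi D q : (forall s, D s -> 0 <= s) -> pi_system (dev_avg_gen D q).
Proof.
move=> D0.
pose G := gens [set p : nat * R | (p.1 < n)%N /\ D p.2] (fun p => W p.1 q.1 p.2).
have Gm : G `<=` measurable.
  by apply: gens_measurable => -[i s] /= [ilt /D0]; exact: mW.
have sW s : D s -> forall i, (i < n)%N -> smeas G (W i q.1 s).
  move=> Ds i ilt.
  exact: (@smeas_gen _ _ _ [set p : nat * R | (p.1 < n)%N /\ D p.2] (fun p => W p.1 q.1 p.2) (i, s)).
rewrite /dev_avg_gen; case: q.2; apply: sigma_gen_pi.
  by move=> [i s] /= [ilt Ds]; apply: (smeas_measurable Gm); apply: smeas_dev => //; exact: sW.
by move=> s Ds; apply: (smeas_measurable Gm); apply: smeas_avg; exact: sW.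
Qed.

Lemma smeas_dev_gen (D : set R) (q : 'I_d * bool) i (s : R) : q.2 -> (i < n)%N -> D s ->
  smeas (dev_avg_gen D q) (noise_dev i q.1 s).
Proof.
rewrite /dev_avg_gen => -> ilt Ds; apply: smeasP => A mA; apply: sub_sigma_algebra.
have := @smeas_gen _ _ _ [set p : nat * R | (p.1 < n)%N /\ D p.2]
  (fun p => noise_dev p.1 q.1 p.2) (i, s) (conj ilt Ds).
by move=> /smeas_preimage; exact.
Qed.

Lemma smeas_avg_gen (D : set R) (q : 'I_d * bool) (s : R) : ~~ q.2 -> D s ->
  smeas (dev_avg_gen D q) (noise_avg q.1 s).
Proof.
rewrite /dev_avg_gen => /negbTE -> Ds; apply: smeasP => A mA; apply: sub_sigma_algebra.
by have := @smeas_gen _ _ _ D (noise_avg q.1) s Ds => /smeas_preimage; exact.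
Qed.

Lemma mindep_trivial (J : finType) :
  mindep P (fun _ : J => <<s [set setT] >> : set (set T)).
Proof.
apply: mindep_sigma => [_|A AT].
  by split=> // [_ ->|_ _ -> ->]; rewrite ?setTI//; exact: measurableT.
have -> : \bigcap_i A i = setT by apply/seteqP; split => // x _ i _; rewrite AT.
by rewrite probability_setT big1// => i _; rewrite AT probability_setT.
Qed.

Lemma smeas_cst (G : set (set T)) (c : R) : smeas G (fun=> c).
Proof. exact: measurable_cst. Qed.

(** Induction along the grid: the increments over the next cell form an independent family and are
    independent of everything before, so [mindep_join] adds them. At time 0 all values vanish. *)
Lemma mindep_dyadic_grid r l :
  mindep P (dev_avg_gen [set s | exists2 j, (j <= l)%N & s = dyadic r j]).
Proof.
elim: l => [|l IH].
  apply: mindepS (@mindep_trivial _) => q.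
  have a0 k w : noise_avg k 0 w = 0.
    rewrite /noise_avg big1 ?mul0r// => i _.
    by have [_ W0 _ _ _] := BM k (ltn_ord i); rewrite W0.
  apply: dev_avg_gen_sub => [i s _ ilt [j]|s _ [j]]; rewrite leqn0 => /eqP -> ->;
    rewrite /dyadic mul0r.
    rewrite (_ : noise_dev i q.1 0 = fun=> 0); first exact: smeas_cst.
    apply/funext => w; have [_ W0 _ _ _] := BM q.1 ilt.
    by rewrite /noise_dev W0 a0 subr0.
  by rewrite (_ : noise_avg q.1 0 = fun=> 0); [exact: smeas_cst|exact/funext].
pose s : R := dyadic r l; pose t : R := dyadic r l.+1.
have s0 : 0 <= s by exact: dyadic_ge0.
have st : s < t by rewrite -subr_gt0 dyadicS invr_gt0 pow2_gt0.
have t0 := ltW (le_lt_trans s0 st).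
pose D m := [set s : R | exists2 j, (j <= m)%N & s = dyadic r j].
have D0 m u : D m u -> 0 <= u by move=> [j _ ->]; exact: dyadic_ge0.
have Ds u : D l u -> 0 <= u <= s.
  move=> [j jl ->]; rewrite dyadic_ge0 /s /dyadic ler_pM2r ?invr_gt0 ?pow2_gt0//.
  by rewrite ler_nat.
have : mindep P (fun q => <<s dev_avg_gen (D l) q `|` dev_avg_inc s t q >>).
  apply: (mindep_join
    (H := gens [set q : nat * 'I_d * R | (q.1.1 < n)%N /\ 0 <= q.2 <= s]
      (fun q => W q.1.1 q.1.2 q.2))
    (K := gens [set q : nat * 'I_d | (q.1 < n)%N]
      (fun q w => W q.1 q.2 t w - W q.1 q.2 s w))).
  - by move=> q; apply: dev_avg_gen_pi => u; exact: D0.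
  - by move=> q; exact: dev_avg_inc_pi.
  - move=> q.
    have sW u : D l u -> forall i, (i < n)%N ->
        smeas (gens [set q : nat * 'I_d * R | (q.1.1 < n)%N /\ 0 <= q.2 <= s]
          (fun q => W q.1.1 q.1.2 q.2)) (W i q.1 u).
      move=> Du i ilt.
      exact: (@smeas_gen _ _ _ [set q : nat * 'I_d * R | (q.1.1 < n)%N /\ 0 <= q.2 <= s]
        (fun q => W q.1.1 q.1.2 q.2) (i, q.1, u) (conj ilt (Ds _ Du))).
    apply: dev_avg_gen_sub => [i u _ ilt Du|u _ Du].
      by apply: smeas_dev => //; exact: sW.
    by apply: smeas_avg; exact: sW.
  - move=> q; apply: dev_avg_inc_sub => i ilt.
    exact: (@smeas_gen _ _ _ [set q : nat * 'I_d | (q.1 < n)%N]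
      (fun q w => W q.1 q.2 t w - W q.1 q.2 s w) (i, q.1)).
  - exact: indep_past_inc.
  - exact: IH.
  - exact: mindep_dev_avg_inc.
apply: mindepS => q.
have subl u (f : T -> R) : D l u -> smeas (dev_avg_gen (D l) q) f ->
    smeas (dev_avg_gen (D l) q `|` dev_avg_inc s t q) f.
  move=> _; apply: smeasS => A FA; apply: sub_sigma_algebra; by left.
have Dl j : (j <= l)%N -> D l (dyadic r j) by move=> jl; exists j.
apply: dev_avg_gen_sub => [i u q2 ilt [j jl ->]|u q2 [j jl ->]];
    move: jl; rewrite leq_eqVlt => /predU1P[->|]; rewrite ?ltnS.
- rewrite (_ : noise_dev i q.1 (dyadic r l.+1) =
    (fun w => noise_dev i q.1 s w + (noise_dev i q.1 t w - noise_dev i q.1 s w))).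
    apply: measurable_funD; first by apply: (subl s); [exact: Dl|exact: smeas_dev_gen (Dl _ _)].
    apply: (smeasS (G := dev_avg_inc s t q)).
      by move=> A FA; apply: sub_sigma_algebra; right.
    rewrite /dev_avg_inc q2; apply: smeasP => A mA; apply: sub_sigma_algebra.
    have := @smeas_gen _ _ _ [set i | (i < n)%N]
      (fun i w => noise_dev i q.1 t w - noise_dev i q.1 s w) i ilt.
    by move=> /smeas_preimage; exact.
  by apply/funext => w; rewrite addrC subrK.
- by move=> jl; apply: (subl (dyadic r j)); [exact: Dl|exact: smeas_dev_gen (Dl _ _)].
- rewrite (_ : noise_avg q.1 (dyadic r l.+1) =
    (fun w => noise_avg q.1 s w + (noise_avg q.1 t w - noise_avg q.1 s w))).
    apply: measurable_funD; first by apply: (subl s); [exact: Dl|exact: smeas_avg_gen (Dl _ _)].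
    apply: (smeasS (G := dev_avg_inc s t q)).
      by move=> A FA; apply: sub_sigma_algebra; right.
    rewrite /dev_avg_inc (negbTE q2); apply: smeasP => A mA; apply: sub_sigma_algebra.
    exact: sigE.
  by apply/funext => w; rewrite addrC subrK.
- by move=> jl; apply: (subl (dyadic r j)); [exact: Dl|exact: smeas_avg_gen (Dl _ _)].
Qed.

(** The grids are nested in [r], so independence passes to their union, and continuity of the paths
    recovers every time from its [dyadic_floor]. *)
Lemma mindep_dev_avg : mindep P (dev_avg_gen [set s | 0 <= s <= 1]).
Proof.
pose D r : set R := [set s : R | exists2 j, (j <= 2 ^ r)%N & s = dyadic r j].
have : mindep P (fun q => <<s \bigcup_r dev_avg_gen (D r) q >>).
  apply: mindep_limit.
  - by move=> r q; apply: dev_avg_gen_pi => _ [j _ ->]; exact: dyadic_ge0.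
  - have DD r : D r `<=` D r.+1.
      move=> _ [j jr ->]; exists j.*2; last by rewrite dyadic_double.
      by rewrite expnS mul2n leq_double.
    move=> r q.
    have := @dev_avg_gen_sub (D r) q (dev_avg_gen (D r.+1) q).
    rewrite sigma_algebra_id; last first.
      by rewrite /dev_avg_gen; case: q.2; exact: smallest_sigma_algebra.
    apply=> [i s q2 ilt Ds|s q2 Ds].
      by apply: smeas_dev_gen => //; exact: DD.
    by apply: smeas_avg_gen => //; exact: DD.
  - by move=> r; exact: mindep_dyadic_grid.
apply: mindepS => q.
have Df r s : 0 <= s <= 1 -> D r (dyadic_floor r s).
  move=> /andP[s0 s1]; exists (Num.truncn (s * 2 ^+ r)) => //.
  rewrite -(@ler_nat R) natrX; apply: le_trans (_ : s * 2 ^+ r <= _).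
    by rewrite truncn_le mulr_ge0// ltW ?pow2_gt0.
  by rewrite ler_piMl// ltW ?pow2_gt0.
have sub r (f : T -> R) : smeas (dev_avg_gen (D r) q) f ->
    smeas (\bigcup_r dev_avg_gen (D r) q) f.
  by apply: smeasS => A FA; apply: sub_sigma_algebra; exists r.
apply: dev_avg_gen_sub => [i s q2 ilt|s q2] /= s01; have /andP[s0 s1] := s01.
  apply: (smeas_cvg (h := fun r => noise_dev i q.1 (dyadic_floor r s))).
    by move=> r; apply: (sub r); apply: smeas_dev_gen => //; exact: Df.
  move=> w; apply: cvg_noise_dev => //; first by move=> r; exact: dyadic_ge0.
  exact: cvg_dyadic_floor.
apply: (smeas_cvg (h := fun r => noise_avg q.1 (dyadic_floor r s))).
  by move=> r; apply: (sub r); apply: smeas_avg_gen => //; exact: Df.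
move=> w; apply: cvg_noise_avg => //; first by move=> r; exact: dyadic_ge0.
exact: cvg_dyadic_floor.
Qed.

End level.

(** * Paths of the center of mass and of the fluctuations *)

Section riemann_sums.
Context {R : realType}.

Lemma compact_uniform_continuity (A : set R) (h : R -> R) (e : R) :
  compact A -> {within A, continuous h} -> 0 < e ->
  exists2 dl, 0 < dl & forall x y, A x -> A y -> `|x - y| < dl -> `|h x - h y| < e.
Proof.
move=> cA /subspace_continuousP ch e0.
have e20 : 0 < e / 2 by rewrite divr_gt0.
have H : \forall dl \near 0^'+, A `<=` [set x | A x ->
    forall y, A y -> `|x - y| < dl -> `|h x - h y| < e].
  apply: ((compact_near_coveringP A).1 cA R) => //= x Ax.
  have /cvgrPdist_lt/(_ _ e20) := ch x Ax.
  rewrite near_withinE => /nbhs_ballP[r /= r0 rh].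
  have r20 : 0 < r / 2 by rewrite divr_gt0.
  exists (ball x (r / 2), [set dl | dl < r / 2]) => /=.
    split; first by exists (r / 2).
    exact: nbhs_right_lt.
  move=> [x' dl] /= [xx' dlr] Ax' y Ay x'y.
  have xy : ball x r y.
    rewrite (splitr r); apply: ball_triangle xx' _.
    by rewrite /ball/=; exact: lt_trans dlr.
  have xr : ball x r x' by apply: le_ball xx'; rewrite ler_pdivrMr// ler_peMr ?(ltW r0)// ler1n.
  rewrite (splitr e) -(subrKA (h x)).
  apply: le_lt_trans (ler_normD _ _) _; apply: ltrD.
    by rewrite distrC; exact: rh.
  exact: rh.
have [dl [dl0 hdl]] : exists dl, 0 < dl /\ A `<=` [set x | A x ->
    forall y, A y -> `|x - y| < dl -> `|h x - h y| < e].
  by apply: (@filter_ex _ (0^'+ : set_system R)); near=> dl; split; near: dl; [exact: nbhs_right_gt|exact: H].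
by exists dl => // x y Ax Ay; apply: hdl.
Unshelve. all: by end_near. Qed.

(** On each cell the increment of [f] is [h c] times the mesh for some interior [c], by the mean
    value theorem, and [h c] is close to the value at the left endpoint by uniform continuity. *)
Lemma riemann_sum_cvg (f h : R -> R) (t : R) : 0 < t ->
  {within `[0, t], continuous f} ->
  (forall x, 0 < x < t -> is_derive x 1 f (h x)) ->
  {within `[0, t], continuous h} ->
  \sum_(j < n.+1) h (j%:R * (t / n.+1%:R)) * (t / n.+1%:R) @[n --> \oo] --> f t - f 0.
Proof.
move=> t0 cf df ch.
apply/cvgrPdist_lt => e e0.
have et0 : 0 < e / (2 * t) by rewrite divr_gt0// mulr_gt0.
have [dl dl0 hdl] := compact_uniform_continuity (@segment_compact _ 0 t) ch et0.
have dlt : 0 < dl / t by rewrite divr_gt0.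
near=> n.
set s := t / n.+1%:R.
have s0 : 0 < s by rewrite divr_gt0.
have sdl : s < dl.
  have : n.+1%:R^-1 < dl / t by near: n; exact: (near_infty_natSinv_lt (PosNum dlt)).
  by rewrite ltr_pdivlMr// mulrC.
have nst : n.+1%:R * s = t by rewrite /s mulrC divfK.
have -> : f t - f 0 = \sum_(j < n.+1) (f (j.+1%:R * s) - f (j%:R * s)).
  by rewrite -(big_mkord xpredT (fun j => f (j.+1%:R * s) - f (j%:R * s))) telescope_sumr// mul0r nst.
rewrite -sumrB; apply: le_lt_trans (ler_norm_sum _ _ _) _.
have cell (j : 'I_n.+1) : `|f (j.+1%:R * s) - f (j%:R * s) - h (j%:R * s) * s| <= e / (2 * t) * s.
  have jn : j.+1%:R * s <= t by rewrite -nst ler_pM2r// ler_nat.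
  have ab : j%:R * s < j.+1%:R * s by rewrite ltr_pM2r// ltr_nat.
  have a0 : 0 <= j%:R * s by rewrite mulr_ge0// ltW.
  have sub : `[j%:R * s, j.+1%:R * s] `<=` `[0, t].
    move=> x /=; rewrite !in_itv/= => /andP[h1 h2].
    by rewrite (le_trans a0 h1) (le_trans h2 jn).
  have dfx x : x \in `]j%:R * s, j.+1%:R * s[%R -> is_derive x 1 f (h x).
    rewrite in_itv/= => /andP[h1 h2]; apply: df.
    by rewrite (le_lt_trans a0 h1) (lt_le_trans h2 jn).
  have cfab : {within `[j%:R * s, j.+1%:R * s], continuous f} by exact: continuous_subspaceW cf.
  have [c cab ->] := MVT ab dfx cfab.
  have -> : j.+1%:R * s - j%:R * s = s by rewrite -mulrBl -natr1 addrAC subrr add0r mul1r.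
  rewrite -mulrBl normrM (gtr0_norm s0) ler_pM2r//.
  move: cab; rewrite in_itv/= => /andP[c1 c2].
  apply/ltW/hdl.
  - by apply: sub; rewrite /= in_itv/= (ltW c1) (ltW c2).
  - by apply: sub; rewrite /= in_itv/= lexx (ltW ab).
  - rewrite gtr0_norm ?subr_gt0//; apply: lt_trans sdl.
    rewrite ltrBlDr; apply: lt_le_trans c2 _.
    by rewrite -natr1 mulrDl mul1r addrC.
apply: le_lt_trans (ler_sum _ (fun j _ => cell j)) _.
rewrite sumr_const card_ord -[X in X < _]mulr_natl mulrCA nst.
by rewrite invfM mulrA divfK ?gt_eqF// ltr_pdivrMr// ltr_pMr// ltr1n.
Unshelve. all: by end_near. Qed.

(* Riemann sum of the explicit solution
   y t = y0 + g t - gamma * int_0^t exp (- gamma * (t - s)) * (y0 + g s) ds,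
   which exhibits y t as a measurable function of y0 and of the path g. *)
Definition OU_sum (gamma y0 : R) (g : R -> R) (t : R) (n : nat) : R :=
  y0 + g t - gamma * (expR (- (gamma * t)) *
    \sum_(j < n.+1) expR (gamma * (j%:R * (t / n.+1%:R))) *
      (y0 + g (j%:R * (t / n.+1%:R))) * (t / n.+1%:R)).

(** With [I] the integral of [y], the function [expR (gamma * s) * I s] has derivative
    [expR (gamma * s) * (y0 + g s)], in which [y] no longer occurs; its Riemann sums therefore
    recover [I t], hence [y t]. Working with [I] requires no differentiability of [g]. *)
Lemma OU_sum_cvg (gamma y0 : R) (g y : R -> R) (t : R) : 0 < t ->
  {within `[0, t], continuous g} ->
  lebesgue_measure.-integrable `[0, t] (EFin \o y) ->
  (forall s, 0 <= s <= t ->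
    y s = y0 + g s - gamma * (\int[lebesgue_measure]_(u in `[0, s]) y u)%R) ->
  OU_sum gamma y0 g t n @[n --> \oo] --> y t.
Proof.
move=> t0 cg iy yE.
pose I s := (\int[lebesgue_measure]_(u in `[0, s]) y u)%R.
have cI : {within `[0, t], continuous I} by exact: parameterized_integral_continuous (ltW t0) iy.
have I0 : I 0 = 0 by rewrite /I set_itv1 Rintegral_set1.
(* The equation bootstraps integrability of [y] to continuity, which the fundamental theorem of
   calculus asks for below. *)
have cy : {within `[0, t], continuous y}.
  have c1 : {within `[0, t], continuous (fun s => y0 + g s - gamma * I s)}.
    move=> x; apply: cvgB; first by apply: cvgD; [exact: cvg_cst|exact: cg].
    by apply: cvgM; [exact: cvg_cst|exact: cI].
  apply: subspace_eq_continuous c1 => s; rewrite inE/= in_itv/= => s0t.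
  exact/esym/yE.
pose h s := expR (gamma * s) * (y0 + g s).
have cexp : continuous (fun s : R => expR (gamma * s)).
  move=> x; apply: continuous_comp; last exact: continuous_expR.
  by apply: mulrl_continuous.
have ch : {within `[0, t], continuous h}.
  move=> x; apply: cvgM; first by apply: continuous_subspaceT; exact: cexp.
  by apply: cvgD; [exact: cvg_cst|exact: cg].
pose J s := expR (gamma * s) * I s.
have cJ : {within `[0, t], continuous J}.
  move=> x; apply: cvgM; last exact: cI.
  by apply: continuous_subspaceT; exact: cexp.
have dJ x : 0 < x < t -> is_derive x 1 J (h x).
  move=> /andP[x0 xt].
  have cyx : {for x, continuous y}.
    by apply: (within_continuous_continuous t0 cy); rewrite in_itv/= x0.
  have [dI dIE] := continuous_FTC1_closed xt iy x0 cyx.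
  have isI : is_derive x 1 I (y x) by rewrite -dIE derive1E; exact: derivableP.
  have isE : is_derive x 1 (fun s => expR (gamma * s)) (gamma * expR (gamma * x)).
    have isg : is_derive x 1 (fun s => gamma * s) gamma.
      have := @is_deriveZ _ _ _ id gamma x 1 1 (is_derive_id x 1).
      by move=> /is_derive_eq; apply; rewrite /GRing.scale/= mulr1.
    rewrite mulrC; apply: (@is_derive1_comp R expR ( *%R gamma)).
  have := @is_deriveM _ _ _ _ x 1 _ _ isE isI.
  move=> /is_derive_eq; apply; rewrite /GRing.scale/= /h.
  have -> : y0 + g x = y x + gamma * I x by rewrite yE ?ltW//= ?(ltW x0) ?(ltW xt)// subrK.
  by ring.
have := riemann_sum_cvg t0 cJ dJ ch.
rewrite /J I0 mulr0 subr0 => cR.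
rewrite (_ : y t = y0 + g t - gamma * (expR (- (gamma * t)) * (expR (gamma * t) * I t))); last first.
  by rewrite (mulrA (expR _) (expR _)) -expRD addNr expR0 mul1r; apply: yE; rewrite lexx ltW.
by apply: cvgB; [exact: cvg_cst|apply: cvgM; [exact: cvg_cst|apply: cvgM => //; exact: cvg_cst]].
Qed.

End riemann_sums.

Section one_sided_limits.
Context {R : realType}.

Lemma cvg_at_right_shift (f : R -> R) (m u l : R) :
  f (m + v) @[v --> u^'+] --> l -> f s @[s --> (m + u)^'+] --> l.
Proof.
move=> fl; have -> : f = (fun v => f (m + v)) \o (fun s => s - m).
  by apply/funext => s /=; rewrite addrC subrK.
apply: cvg_comp fl => B [e /= e0 eB]; exists e => //= s /= s1 s2.
apply: eB => /=; last by rewrite ltrBrDl.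
by move: s1; rewrite /ball_/= => h; rewrite (_ : u - (s - m) = m + u - s)//; ring.
Qed.

Lemma cvg_seq_at_left (f : R -> R) (u : nat -> R) (x l : R) :
  f s @[s --> x^'-] --> l -> (forall n, u n < x) ->
  u n @[n --> \oo] --> x -> f (u n) @[n --> \oo] --> l.
Proof.
move=> fl xu ux; apply: cvg_comp fl => B /= /ux [N _ NB].
by exists N => // n Nn; apply: NB.
Qed.

Lemma within_cvg_at_right (a b x : R) (f : R -> R) : a <= x < b ->
  {within `[a, b], continuous f} -> f s @[s --> x^'+] --> f x.
Proof.
move=> /andP[]; rewrite le_eqVlt => /predU1P[<- ab|ax xb] cf.
  by have /continuous_within_itvP-/(_ ab)[] := cf.
apply: cvg_at_right_filter.
apply: (within_continuous_continuous (lt_trans ax xb) cf).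
by rewrite in_itv/= ax.
Qed.

End one_sided_limits.

Lemma sum_half (V : nmodType) (n : nat) (f : nat -> V) :
  \sum_(i < n.*2) f i./2 = (\sum_(i < n) f i) *+ 2.
Proof.
elim: n => [|n IH]; first by rewrite !big_ord0 mul0rn.
rewrite doubleS !big_ord_recr/= IH mulrnDl mulr2n -!addrA.
by rewrite uphalf_double doubleK.
Qed.

(** * Pathwise equations over one generation *)

Section paths.
Context {R : realType} {d : nat}.
Variables (gamma : R) (z : trajectory R d) (b : nat -> nat -> 'I_d -> R -> R).
Hypothesis dz : dyadic_branching z.
Hypothesis iz : interacting_motion gamma b z.
Hypothesis cb : forall m i k, (i < 2 ^ m)%N -> {within `[0, +oo[, continuous (b m i k)}.

Lemma nb_particlesE (m : nat) (u : R) : 0 <= u < 1 ->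
  nb_particles (m%:R + u) = (2 ^ m)%N.
Proof.
move=> /andP[u0 u1]; rewrite /nb_particles (@truncn_def _ _ m)//.
by rewrite lerDl u0/= -natr1 ltrD2l.
Qed.

Lemma nb_particles_nat (m : nat) : nb_particles (m%:R : R) = (2 ^ m)%N.
Proof. by rewrite -[m%:R]addr0 nb_particlesE// lexx ltr01. Qed.

Definition path_avg (m : nat) (k : 'I_d) (u : R) : R :=
  (\sum_(i < 2 ^ m) b m i k u) / (2 ^ m)%:R.

Lemma center_of_massE (m : nat) (u : R) k : 0 <= u < 1 ->
  center_of_mass z (m%:R + u) k = (\sum_(i < 2 ^ m) z (m%:R + u) i k) / (2 ^ m)%:R.
Proof. by move=> u01; rewrite /center_of_mass nb_particlesE. Qed.

(** The interaction is antisymmetric: summing [z_j - z_i] over all ordered pairs gives 0, so only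
    the noise moves the center of mass. *)
Lemma center_of_mass_motion (m : nat) (u : R) k : 0 <= u < 1 ->
  center_of_mass z (m%:R + u) k = center_of_mass z m%:R k + path_avg m k u.
Proof.
move=> u01; rewrite center_of_massE// -[m%:R in RHS]addr0 center_of_massE ?lexx ?ltr01//.
rewrite addr0 -mulrDl; congr (_ / _).
pose F (i : 'I_(2 ^ m)) (s : R) := \sum_(j < 2 ^ m) (z (m%:R + s) j k - z (m%:R + s) i k).
have iF (i : 'I_(2 ^ m)) : lebesgue_measure.-integrable `[0, u] (EFin \o F i).
  by have [] := iz k (ltn_ord i) u01.
transitivity (\sum_(i < 2 ^ m) (z m%:R i k + b m i k u +
    gamma / (2 ^ m)%:R * (\int[lebesgue_measure]_(s in `[0, u]) F i s)%R)).
  by apply: eq_bigr => i _; have [_ ->] := iz k (ltn_ord i) u01.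
rewrite big_split/= -mulr_sumr big_split/= -[RHS]addr0; congr (_ + _).
have RI (r : seq 'I_(2 ^ m)) :
    lebesgue_measure.-integrable `[0, u] (EFin \o (fun s => \sum_(i <- r) F i s)) /\
    (\sum_(i <- r) (\int[lebesgue_measure]_(s in `[0, u]) F i s)%R =
    \int[lebesgue_measure]_(s in `[0, u]) \sum_(i <- r) F i s)%R.
  elim: r => [|i r [IH1 IH2]].
    have -> : (fun s => \sum_(i <- [::]) F i s) = fun=> 0.
      by apply/funext => s; rewrite big_nil.
    by split; [exact: integrable0|rewrite big_nil Rintegral_cst// mul0r].
  have E : (fun s => \sum_(i0 <- i :: r) F i0 s) = (fun s => F i s + \sum_(i0 <- r) F i0 s).
    by apply/funext => s; rewrite big_cons.
  rewrite E big_cons IH2 RintegralD//; split=> //.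
  pose G s := \sum_(i0 <- r) F i0 s.
  have -> : EFin \o (fun s => F i s + G s) = (EFin \o F i) \+ (EFin \o G) by [].
  exact: integrableD.
have [_ ->] := RI (index_enum _).
rewrite (_ : (fun s => _) = fun=> 0); first by rewrite Rintegral_cst// mul0r mulr0.
apply/funext => s; rewrite /F; under eq_bigr do rewrite sumrB sumr_const card_ord.
by rewrite sumrB sumr_const card_ord -sumrMnl subrr.
Qed.

Lemma path_avg_within m k : {within `[0, +oo[, continuous (path_avg m k)}.
Proof.
move=> x; apply: cvgM; last exact: cvg_cst.
by apply: cvg_big => [|i _]; [exact: add_continuous|exact: cb].
Qed.

Lemma near_left1 (Q : R -> Prop) : (forall u, 0 <= u < 1 -> Q u) ->
  \forall u \near 1^'-, Q u.
Proof.
move=> H; near=> u; apply: H; apply/andP; split; last first.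
  by near: u; exact: nbhs_left_lt.
by apply/ltW; near: u; apply: nbhs_left_gt.
Unshelve. all: by end_near. Qed.

Lemma within_cvg_left1 (f : R -> R) : {within `[0, +oo[, continuous f} ->
  f u @[u --> 1^'-] --> f 1.
Proof.
move=> /continuous_within_itvcyP[cf _]; apply: cvg_at_left_filter.
by apply: cf; rewrite in_itv/= ltr01.
Qed.

(** Branching doubles every parent at its own position, which leaves the average unchanged
    ([sum_half]). *)
Lemma center_of_mass_cvg_left m k :
  center_of_mass z (m%:R + u) k @[u --> 1^'-] --> center_of_mass z m.+1%:R k.
Proof.
have -> : center_of_mass z m.+1%:R k =
    (\sum_(i < 2 ^ m.+1) z m.+1%:R i k) / (2 ^ m.+1)%:R.
  by rewrite /center_of_mass nb_particles_nat.
have H : (\sum_(i < 2 ^ m.+1) z (m%:R + u) i./2 k) / (2 ^ m.+1)%:R @[u --> 1^'-]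
    --> (\sum_(i < 2 ^ m.+1) z m.+1%:R i k) / (2 ^ m.+1)%:R.
  apply: cvgM; last exact: cvg_cst.
  by apply: cvg_big => [|i _]; [exact: add_continuous|exact: dz.2].
apply: cvg_trans H; apply: near_eq_cvg; apply: near_left1 => u u01.
rewrite center_of_massE// expnS mul2n (sum_half _ (fun i => z (m%:R + u) i k)).
by rewrite -muln2 natrM invfM mulrA -mulr_natr; field.
Qed.

Lemma center_of_massS m k :
  center_of_mass z m.+1%:R k = center_of_mass z m%:R k + path_avg m k 1.
Proof.
apply: (cvg_unique _ (@center_of_mass_cvg_left m k)) => //.
have H : center_of_mass z m%:R k + path_avg m k u @[u --> 1^'-]
    --> center_of_mass z m%:R k + path_avg m k 1.
  by apply: cvgD; [exact: cvg_cst|apply: within_cvg_left1; exact: path_avg_within].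
apply: cvg_trans H; apply: near_eq_cvg; apply: near_left1 => u u01.
by rewrite center_of_mass_motion.
Qed.

Lemma center_of_mass0 k : center_of_mass z 0 k = 0.
Proof.
rewrite /center_of_mass; have := nb_particles_nat 0; rewrite mulr0n => ->.
by rewrite expn0 big_ord1 dz.1 mul0r.
Qed.

Lemma fluct_dyadic_branching : dyadic_branching (fluct z).
Proof.
split=> [k|m i k im]; first by rewrite /fluct dz.1 center_of_mass0 subr0.
by apply: cvgB; [exact: dz.2|exact: center_of_mass_cvg_left].
Qed.

(** The sum of [z_j - z_i] over [j] is [- 2 ^ m] times the fluctuation of particle [i], so the
    factor [gamma / 2 ^ m] becomes the linear drift [- gamma]; subtracting the motion of the center
    of mass turns the noise into its deviation. *)
Lemma fluct_OU_motion : OU_motion gamma b (fluct z).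
Proof.
move=> m i k u im u01; have [iF zE] := iz k im u01.
set F := (X in EFin \o X) in iF; rewrite -/F in zE.
have FE s : `[0, u]%classic s -> fluct z (m%:R + s) i k = - (2 ^ m)%:R^-1 * F s.
  rewrite /= in_itv/= => /andP[s0 su].
  have s01 : 0 <= s < 1 by rewrite s0 (le_lt_trans su); case/andP: u01.
  rewrite /fluct center_of_massE// /F sumrB sumr_const card_ord -mulr_natl.
  by field.
have iF' : lebesgue_measure.-integrable `[0, u] (EFin \o (fun s => - (2 ^ m)%:R^-1 * F s)).
  rewrite (_ : EFin \o _ = (fun s => (- (2 ^ m)%:R^-1)%:E * (EFin \o F) s)%E)//.
  exact: integrableZl.
split.
  apply: eq_integrable iF' => // s; rewrite inE => us /=.
  by rewrite FE.
have -> : (\int[lebesgue_measure]_(s in `[0, u]) fluct z (m%:R + s) i k =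
    \int[lebesgue_measure]_(s in `[0, u]) (- (2 ^ m)%:R^-1 * F s))%R.
  by apply: eq_Rintegral => s us; rewrite FE//; exact: set_mem.
rewrite RintegralZl// /fluct center_of_mass_motion// zE /path_avg.
by field.
Qed.

(** The bound [u < 1] stays strict, since at time [m + 1] the label [i] denotes an offspring of
    another parent in general. *)
Lemma path_within m i k u : (i < 2 ^ m)%N -> 0 <= u < 1 ->
  {within `[0, u], continuous (fun s => z (m%:R + s) i k)}.
Proof.
move=> im u01; have /andP[u0 u1] := u01.
have [iF _] := iz k im u01; set F := (X in EFin \o X) in iF.
have cI := parameterized_integral_continuous u0 iF.
have c1 : {within `[0, u], continuous (fun s => z m%:R i k + b m i k s +
    gamma / (2 ^ m)%:R * (\int[lebesgue_measure]_(x in `[0, s]) F x)%R)}.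
  have cbu : {within `[0, u], continuous (b m i k)}.
    have sub : `[0, u]%classic `<=` `[0, +oo[%classic.
      by move=> s /=; rewrite !in_itv/= andbT => /andP[].
    exact: (continuous_subspaceW sub (@cb m i k im)).
  move=> x; apply: cvgD; last by apply: cvgM; [exact: cvg_cst|exact: cI].
  by apply: cvgD; [exact: cvg_cst|exact: cbu].
apply: subspace_eq_continuous c1 => s; rewrite inE/= in_itv/= => /andP[s0 su].
have s01 : 0 <= s < 1 by rewrite s0 (le_lt_trans su).
by have [_ E] := iz k im s01; exact/esym/E.
Qed.

Lemma path_right_continuous : right_continuous z.
Proof.
move=> t i k [/= t0 it].
have /andP[h1 h2] := truncn_itv t0.
pose m := Num.truncn t; pose u := t - m%:R.
have tE : t = m%:R + u by rewrite /u addrC subrK.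
have u0 : 0 <= u by rewrite subr_ge0.
have u1 : u < 1 by rewrite ltrBlDl natr1.
rewrite tE; apply: cvg_at_right_shift.
(* The midpoint leaves room to the right of [u] before the next branching time. *)
pose v := (u + 1) / 2.
have uv : u < v by rewrite midf_lt.
have v1 : v < 1 by rewrite midf_lt.
apply: (@within_cvg_at_right _ 0 v _ (fun s => z (m%:R + s) i k)); first by rewrite u0.
by apply: path_within; rewrite // (le_trans u0 (ltW uv)).
Qed.

End paths.

Section right_continuity.
Context {R : realType} {d : nat}.

Lemma nb_particles_near (t : R) : 0 <= t ->
  \forall s \near t^'+, nb_particles s = nb_particles t.
Proof.
move=> t0; have /andP[h1 h2] := truncn_itv t0.
near=> s; rewrite /nb_particles; congr (2 ^ _)%N; apply: truncn_def.
have ts : t < s by near: s; exact: nbhs_right_gt.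
rewrite (le_trans h1 (ltW ts))/=; near: s; exact: nbhs_right_lt.
Unshelve. all: by end_near. Qed.

Lemma center_of_mass_right_continuous (z : trajectory R d) t k :
  right_continuous z -> 0 <= t ->
  center_of_mass z s k @[s --> t^'+] --> center_of_mass z t k.
Proof.
move=> cz t0.
have H : (\sum_(i < nb_particles t) z s i k) / (nb_particles t)%:R @[s --> t^'+]
    --> center_of_mass z t k.
  apply: cvgM; last exact: cvg_cst.
  by apply: cvg_big => [|i _]; [exact: add_continuous|apply: cz; split => /=].
apply: cvg_trans H; apply: near_eq_cvg; near=> s.
rewrite /center_of_mass; have -> // : nb_particles s = nb_particles t.
by near: s; exact: nb_particles_near.
Unshelve. all: by end_near. Qed.

Lemma fluct_right_continuous (z : trajectory R d) :
  right_continuous z -> right_continuous (fluct z).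
Proof.
move=> cz t i k tik; apply: cvgB; first exact: cz.
by apply: center_of_mass_right_continuous => //; case: tik.
Qed.

End right_continuity.

Section measurability_of_the_center_of_mass.
Context {R : realType} {d : nat} {T : pointedType}.

Lemma smeas_center_of_mass (Z : T -> trajectory R d) G t k :
  (forall i, (i < nb_particles t)%N -> smeas G (fun w => Z w t i k)) ->
  smeas G (fun w => center_of_mass (Z w) t k).
Proof.
move=> sZ; apply: measurable_funM => //.
by apply: measurable_sum => i; exact: sZ.
Qed.

Lemma smeas_fluct (Z : T -> trajectory R d) G t i k : (i < nb_particles t)%N ->
  (forall i, (i < nb_particles t)%N -> smeas G (fun w => Z w t i k)) ->
  smeas G (fun w => fluct (Z w) t i k).
Proof.
by move=> it sZ; apply: measurable_funB; [exact: sZ|exact: smeas_center_of_mass].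
Qed.

End measurability_of_the_center_of_mass.

(** * Independence of the fluctuations and the center of mass *)

Section decomposition.
Context {R : realType} {d : nat} {dT : measure_display} {T : measurableType dT}.

(* The flag [true] stands for the fluctuations, [false] for the center of mass. *)
Definition dev_com_gen (D : set R) (Z : T -> trajectory R d) (q : 'I_d * bool) :
    set (set T) :=
  if q.2 then sigma_gen [set p : R * nat | D p.1 /\ (p.2 < nb_particles p.1)%N]
      (fun p w => fluct (Z w) p.1 p.2 q.1)
  else sigma_gen D (fun t w => center_of_mass (Z w) t q.1).

Lemma dev_com_gen_sub (D : set R) Z (q : 'I_d * bool) (G : set (set T)) :
  (forall t i, q.2 -> D t -> (i < nb_particles t)%N ->
     smeas G (fun w => fluct (Z w) t i q.1)) ->
  (forall t, ~~ q.2 -> D t -> smeas G (fun w => center_of_mass (Z w) t q.1)) ->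
  dev_com_gen D Z q `<=` <<s G >>.
Proof.
rewrite /dev_com_gen; case: q.2 => sd sa; apply: sigma_gen_sub.
  by move=> [t i] /= [Dt it]; exact: sd.
by move=> s Ds; exact: sa.
Qed.

Lemma smeas_fluct_gen (D : set R) Z (q : 'I_d * bool) t i : q.2 -> D t ->
  (i < nb_particles t)%N -> smeas (dev_com_gen D Z q) (fun w => fluct (Z w) t i q.1).
Proof.
rewrite /dev_com_gen => -> Dt it; apply: smeasP => A mA; apply: sub_sigma_algebra.
have := @smeas_gen _ _ _ [set p : R * nat | D p.1 /\ (p.2 < nb_particles p.1)%N]
  (fun p w => fluct (Z w) p.1 p.2 q.1) (t, i) (conj Dt it).
by move=> /smeas_preimage; exact.
Qed.

Lemma smeas_com_gen (D : set R) Z (q : 'I_d * bool) t : ~~ q.2 -> D t ->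
  smeas (dev_com_gen D Z q) (fun w => center_of_mass (Z w) t q.1).
Proof.
rewrite /dev_com_gen => /negbTE -> Dt; apply: smeasP => A mA; apply: sub_sigma_algebra.
by have := @smeas_gen _ _ _ D (fun t w => center_of_mass (Z w) t q.1) t Dt => /smeas_preimage; exact.
Qed.

Lemma measurable_center_of_mass (Z : T -> trajectory R d) t k :
  random_trajectory Z -> 0 <= t ->
  measurable_fun setT (fun w => center_of_mass (Z w) t k).
Proof.
move=> mZ t0; apply: measurable_funM => //.
apply: measurable_sum => i; apply: (mZ (t, val i, k)); split => //=.
Qed.

Lemma random_fluct (Z : T -> trajectory R d) :
  random_trajectory Z -> random_trajectory (fun w => fluct (Z w)).
Proof.
move=> mZ [[t i] k] [/= t0 it]; apply: measurable_funB; first exact: (mZ (t, i, k)).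
exact: measurable_center_of_mass.
Qed.

Lemma dev_com_gen_pi (D : set R) Z q : random_trajectory Z -> (forall t, D t -> 0 <= t) ->
  pi_system (dev_com_gen D Z q).
Proof.
move=> mZ D0; rewrite /dev_com_gen; case: q.2; apply: sigma_gen_pi.
  by move=> [t i] /= [/D0 t0 it]; exact: (@random_fluct Z mZ (t, i, q.1)).
by move=> t /D0; exact: measurable_center_of_mass.
Qed.

Lemma dev_com_genS (D E : set R) Z q : D `<=` E ->
  dev_com_gen D Z q `<=` dev_com_gen E Z q.
Proof.
move=> DE.
have := @dev_com_gen_sub D Z q (dev_com_gen E Z q).
rewrite sigma_algebra_id; last first.
  by rewrite /dev_com_gen; case: q.2; exact: smallest_sigma_algebra.
apply=> [t i q2 Dt it|t q2 Dt].
  by apply: smeas_fluct_gen => //; exact: DE.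
by apply: smeas_com_gen => //; exact: DE.
Qed.

Variables (gamma : R) (P : probability T R) (B : noise R d T) (Z : T -> trajectory R d).
Hypothesis hZ : interacting_BBM gamma P B Z.

Let mZ : random_trajectory Z. Proof. by case: hZ. Qed.
Let dn : driving_noise P B Z. Proof. by case: hZ. Qed.
Let dz w : dyadic_branching (Z w). Proof. by case: hZ. Qed.
Let iz w : interacting_motion gamma (fun m i k s => B m i k s w) (Z w).
Proof. by case: hZ. Qed.

Let BM m i k : (i < 2 ^ m)%N -> standard_BM P (B m i k).
Proof. by have [+ _ _] := dn m; apply. Qed.
Let iB m : mutual_indep P [set p : nat * 'I_d | (p.1 < 2 ^ m)%N]
        (fun p => sigma_gen [set s | 0 <= s] (B m p.1 p.2)).
Proof. by have [_ + _] := dn m. Qed.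
Let cB m i k w : (i < 2 ^ m)%N -> {within `[0, +oo[, continuous (fun s => B m i k s w)}.
Proof. by move=> /(BM k)[]. Qed.
Let fdz w : dyadic_branching (fluct (Z w)).
Proof. exact: fluct_dyadic_branching (dz w). Qed.
Let pow2_gt0 m : (0 < 2 ^ m)%N. Proof. by rewrite expn_gt0. Qed.

Lemma fluct_step m i k w u : (i < 2 ^ m)%N -> 0 < u < 1 ->
  OU_sum gamma (fluct (Z w) m%:R i k) (fun s => noise_dev (2 ^ m) (B m) i k s w) u n
    @[n --> \oo] --> fluct (Z w) (m%:R + u) i k.
Proof.
move=> im /andP[u0 u1].
have ou s : 0 <= s < 1 -> _ := fluct_OU_motion (@iz w) k im.
apply: (@OU_sum_cvg _ gamma _ _ (fun s => fluct (Z w) (m%:R + s) i k)) => //.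
- have sub : `[0, u]%classic `<=` `[0, +oo[%classic.
    by move=> s /=; rewrite !in_itv/= andbT => /andP[].
  apply: (continuous_subspaceW sub) => x; apply: cvgB; first exact: cB.
  exact: (@path_avg_within _ _ (fun m i k s => B m i k s w) (fun m i k => @cB m i k w)).
- by have [] := ou u; rewrite ?(ltW u0).
- move=> s /andP[s0 su].
  have s01 : 0 <= s < 1 by rewrite s0 (le_lt_trans su).
  by have [_ ->] := ou s s01.
Qed.

(** Induction over generations. [mindep_join] adds the averages and deviations of the noise on
    [[m, m + 1]], which is independent of the past of [Z]. Flag by flag these determine the new
    values: the center of mass by addition, the fluctuations as limits of [OU_sum]. *)
Lemma mindep_dev_com_step m : mindep P (dev_com_gen [set t | 0 <= t <= m%:R] Z).
Proof.
elim: m => [|m IH].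
  apply: mindepS (@mindep_trivial _ _ _ P _) => q.
  have E0 (t : R) : 0 <= t <= 0%:R -> t = 0.
    by move=> h; apply/eqP; rewrite eq_le andbC.
  apply: dev_com_gen_sub => [t i _ /E0 ->|t _ /E0 ->].
    have := @nb_particles_nat R 0; rewrite mulr0n => ->; rewrite expn0 ltnS leqn0 => /eqP ->.
    rewrite (_ : (fun w => _) = fun=> 0); first exact: smeas_cst.
    by apply/funext => w; exact: (fdz w).1.
  rewrite (_ : (fun w => _) = fun=> 0); first exact: smeas_cst.
  by apply/funext => w; exact: center_of_mass0.
pose D m : set R := [set t : R | 0 <= t <= m%:R].
have : mindep P (fun q => <<s dev_com_gen (D m) Z q `|`
    dev_avg_gen (2 ^ m) (B m) [set s | 0 <= s <= 1] q >>).
  apply: (mindep_join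
    (H := gens [set j | live j /\ j.1.1 <= m%:R] (fun j w => coord j (Z w)))
    (K := gens [set j | (j.1.2 < 2 ^ m)%N /\ 0 <= j.1.1]
           (fun j : R * nat * 'I_d => B m j.1.2 j.2 j.1.1))).
  - by move=> q; apply: dev_com_gen_pi => // t /= /andP[].
  - move=> q; apply: (@dev_avg_gen_pi _ _ _ _ P) => [i k im|s /= /andP[]//]; exact: BM.
  - move=> q.
    have sZ t i : D m t -> (i < nb_particles t)%N ->
        smeas (gens [set j | live j /\ j.1.1 <= m%:R] (fun j w => coord j (Z w)))
          (fun w => Z w t i q.1).
      move=> /andP[t0 tm] it.
      exact: (@smeas_gen _ _ _ [set j | live j /\ j.1.1 <= m%:R]
        (fun j w => coord j (Z w)) (t, i, q.1)).
    apply: dev_com_gen_sub => [t i _ Dt it|t _ Dt].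
      by apply: smeas_fluct => // j jt; exact: sZ.
    by apply: smeas_center_of_mass => j jt; exact: sZ.
  - move=> q.
    have sB s i : 0 <= s <= 1 -> (i < 2 ^ m)%N ->
        smeas (gens [set j | (j.1.2 < 2 ^ m)%N /\ 0 <= j.1.1]
           (fun j : R * nat * 'I_d => B m j.1.2 j.2 j.1.1)) (B m i q.1 s).
      move=> /andP[s0 _] im.
      exact: (@smeas_gen _ _ _ [set j : R * nat * 'I_d | (j.1.2 < 2 ^ m)%N /\ 0 <= j.1.1]
        (fun j : R * nat * 'I_d => B m j.1.2 j.2 j.1.1) (s, i, q.1)).
    apply: dev_avg_gen_sub => [i s _ im s01|s _ s01].
      by apply: smeas_dev => // j jm; exact: sB.
    by apply: smeas_avg => j jm; exact: sB.
  - by have [_ _] := dn m.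
  - exact: IH.
  - by apply: mindep_dev_avg => // i k im; exact: BM.
apply: mindepS => q.
set G := (X in <<s X >>).
have sl f : smeas (dev_com_gen (D m) Z q) f -> smeas G f.
  by apply: smeasS => A FA; apply: sub_sigma_algebra; left.
have sr f : smeas (dev_avg_gen (2 ^ m) (B m) [set s | 0 <= s <= 1] q) f -> smeas G f.
  by apply: smeasS => A FA; apply: sub_sigma_algebra; right.
have Dm : D m m%:R by rewrite /D/= lexx ler0n.
(* The time [m + 1] stands apart: there the fluctuation of particle [i] is only reached as a left
   limit along its parent [i./2]. *)
have split_time t : D m.+1 t -> [\/ D m t, exists2 u, 0 < u < 1 & t = m%:R + u | t = m.+1%:R].
  move=> /andP[t0]; rewrite le_eqVlt => /predU1P[->|tm]; first by constructor 3.
  have [tm'|mt] := leP t m%:R; first by constructor 1; rewrite /D/= t0.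
  constructor 2; exists (t - m%:R); last by rewrite addrC subrK.
  by rewrite subr_gt0 mt/= ltrBlDl natr1.
have scom u : 0 <= u <= 1 -> ~~ q.2 ->
    smeas G (fun w => center_of_mass (Z w) m%:R q.1 + noise_avg (2 ^ m) (B m) q.1 u w).
  move=> u01 q2; apply: measurable_funD.
    by apply: sl; exact: smeas_com_gen.
  by apply: sr; exact: smeas_avg_gen.
have sflu u i : q.2 -> 0 < u < 1 -> (i < 2 ^ m)%N ->
    smeas G (fun w => fluct (Z w) (m%:R + u) i q.1).
  move=> q2 u01 im.
  apply: (smeas_cvg (h := fun n w => OU_sum gamma (fluct (Z w) m%:R i q.1)
      (fun s => noise_dev (2 ^ m) (B m) i q.1 s w) u n)); last first.
    by move=> w; exact: fluct_step.
  move=> n.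
  have s0 : smeas G (fun w => fluct (Z w) m%:R i q.1).
    by apply: sl; apply: smeas_fluct_gen => //; rewrite nb_particles_nat.
  have sd s : 0 <= s <= 1 -> smeas G (noise_dev (2 ^ m) (B m) i q.1 s).
    by move=> s01; apply: sr; exact: smeas_dev_gen.
  have /andP[u0 u1] := u01.
  rewrite /OU_sum; apply: measurable_funB.
    by apply: measurable_funD => //; apply: sd; rewrite !ltW.
  apply: measurable_funM => //; apply: measurable_funM => //.
  apply: measurable_sum => j; apply: measurable_funM => //.
  apply: measurable_funM => //; apply: measurable_funD => //; apply: sd.
  have un : 0 <= u / n.+1%:R by rewrite divr_ge0// ltW.
  rewrite mulr_ge0//=; apply: le_trans (ltW u1).
  by rewrite mulrA ler_pdivrMr// mulrC ler_pM2l// ler_nat ltnW.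
apply: dev_com_gen_sub => [t i q2 /split_time[Dt|[u u01 ->]|->] it|t q2 /split_time[Dt|[u u01 ->]|->]].
- by apply: sl; exact: smeas_fluct_gen.
- apply: sflu => //; move: it; rewrite nb_particlesE//.
  by case/andP: u01 => /ltW -> ->.
- have im : (i < 2 ^ m.+1)%N by move: it; rewrite nb_particles_nat.
  have im2 : (i./2 < 2 ^ m)%N by rewrite ltn_half_double -mul2n -expnS.
  (* The shift [n.+2] keeps [v n] strictly between 0 and 1 from [n = 0] on, as [sflu] requires. *)
  pose v n : R := 1 - n.+2%:R^-1.
  have v01 n : 0 < v n < 1.
    by rewrite subr_gt0 invf_lt1// ltr1n/= gtrBl invr_gt0.
  have cv : v n @[n --> \oo] --> (1 : R).
    rewrite -[X in _ --> X]subr0; apply: cvgB; first exact: cvg_cst.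
    by have := @cvg_harmonic R; rewrite -(cvg_shiftS).
  apply: (smeas_cvg (h := fun n w => fluct (Z w) (m%:R + v n) i./2 q.1)).
    by move=> n; exact: sflu.
  move=> w.
  have := (fdz w).2 m i q.1 im.
  move=> /cvg_seq_at_left; apply=> // n; by case/andP: (v01 n).
- by apply: sl; exact: smeas_com_gen.
- have /andP[u0 u1] := u01.
  rewrite (_ : (fun w => _) = (fun w => center_of_mass (Z w) m%:R q.1 +
    noise_avg (2 ^ m) (B m) q.1 u w)); first by apply: scom => //; rewrite !ltW.
  apply/funext => w; rewrite (center_of_mass_motion (@iz w))// ltW//.
- rewrite (_ : (fun w => _) = (fun w => center_of_mass (Z w) m%:R q.1 +
    noise_avg (2 ^ m) (B m) q.1 1 w)); first by apply: scom => //; rewrite ler01 lexx.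
  apply/funext => w.
  by rewrite (center_of_massS (dz w) (@iz w) (fun m i k => @cB m i k w)).
Qed.

Lemma mindep_dev_com : mindep P (dev_com_gen [set t | 0 <= t] Z).
Proof.
have : mindep P (fun q => <<s \bigcup_m dev_com_gen [set t : R | 0 <= t <= m%:R] Z q >>).
  apply: mindep_limit.
  - by move=> m q; apply: dev_com_gen_pi => // t /= /andP[].
  - move=> m q; apply: dev_com_genS => t /= /andP[-> /le_trans]; apply.
    by rewrite ler_nat.
  - exact: mindep_dev_com_step.
apply: mindepS => q.
have sub m (f : T -> R) : smeas (dev_com_gen [set t : R | 0 <= t <= m%:R] Z q) f ->
    smeas (\bigcup_m dev_com_gen [set t : R | 0 <= t <= m%:R] Z q) f.
  by apply: smeasS => A FA; apply: sub_sigma_algebra; exists m.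
have ub (t : R) : 0 <= t -> 0 <= t <= (Num.truncn t).+1%:R.
  by move=> t0; rewrite t0/= ltW// truncnS_gt.
apply: dev_com_gen_sub => [t i q2 /= t0 it|t q2 /= t0].
  by apply: (sub (Num.truncn t).+1); apply: smeas_fluct_gen => //; exact: ub.
by apply: (sub (Num.truncn t).+1); apply: smeas_com_gen => //; exact: ub.
Qed.

End decomposition.

(** * Convergence of the center of mass *)

Section series_and_chaining.
Context {R : realType}.

Lemma nneseries_geometric_le (u : nat -> \bar R) (c x : R) : 0 <= c -> 0 < x < 1 ->
  (forall n, (0 <= u n <= (c * x ^+ n)%:E)%E) ->
  (\sum_(n <oo) u n <= (c / (1 - x))%:E)%E.
Proof.
move=> c0 /andP[x0 x1] uc; apply: lime_le.
  by apply: is_cvg_nneseries => n _ _; case/andP: (uc n).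
apply: nearW => n.
apply: (@le_trans _ _ (\sum_(0 <= i < n) (c * x ^+ i)%:E)%E).
  by apply: lee_sum => i _; case/andP: (uc i).
rewrite sumEFin lee_fin.
by apply: (geometric_le_lim n c0 x0); rewrite ger0_norm// ltW.
Qed.

(** An even point of level [r + 1] is a point of level [r], and an odd one is a single cell away
    from such a point; each level thus costs [c * x ^+ r]. Points [t < 1] are reached from the
    right, and [t = 1] is itself dyadic. *)
Lemma chaining_bound (f : R -> R) (c x : R) : 0 <= c -> 0 < x < 1 -> f 0 = 0 ->
  (forall t, 0 <= t < 1 -> f s @[s --> t^'+] --> f t) ->
  (forall r l, (l < 2 ^ r)%N -> `|f (dyadic r l.+1) - f (dyadic r l)| <= c * x ^+ r) ->
  forall t, 0 <= t <= 1 -> `|f t| <= c / (1 - x).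
Proof.
move=> c0 /andP[x0 x1] f0 rf inc.
have grid r l : (l <= 2 ^ r)%N -> `|f (dyadic r l)| <= \sum_(q < r.+1) c * x ^+ q.
  elim: r l => [|r IH] l.
    rewrite expn0 big_ord1; case: l => [|[|//]] _.
      by rewrite /dyadic mul0r f0 normr0 mulr_ge0// exprn_ge0// ltW.
    have := @inc 0%N 0%N isT; rewrite [X in f X - _]/dyadic.
    by rewrite (_ : f (dyadic 0 0) = 0) ?subr0// /dyadic mul0r.
  move=> lr; rewrite big_ord_recr/=.
  have l2 : (l./2 <= 2 ^ r)%N.
    by have := half_leq lr; rewrite expnS mul2n doubleK.
  have x0' : 0 <= c * x ^+ r.+1 by rewrite mulr_ge0// exprn_ge0// ltW.
  have [ol|el] := boolP (odd l); last first.
    have -> : l = l./2.*2 by rewrite -[LHS]odd_double_half (negbTE el).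
    rewrite dyadic_double; apply: le_trans (IH _ l2) _.
    by rewrite lerDl.
  have E : l = l./2.*2.+1 by rewrite -[LHS]odd_double_half ol.
  have ll : (l./2.*2 < 2 ^ r.+1)%N by rewrite -E.
  have := inc r.+1 l./2.*2 ll; rewrite -E => h1.
  have h2 := IH _ l2; rewrite -dyadic_double in h2.
  rewrite -(subrK (f (dyadic r.+1 l./2.*2)) (f (dyadic r.+1 l))).
  by apply: le_trans (ler_normD _ _) _; rewrite addrC lerD.
have bound r : \sum_(q < r) c * x ^+ q <= c / (1 - x).
  rewrite -(big_mkord xpredT (fun q => c * x ^+ q)).
  by apply: (geometric_le_lim r c0 x0); rewrite ger0_norm// ltW.
have gridb r l : (l <= 2 ^ r)%N -> `|f (dyadic r l)| <= c / (1 - x).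
  by move=> /grid /le_trans; apply.
move=> t /andP[t0]; rewrite le_eqVlt => /predU1P[->|t1].
  by have := gridb 0%N 1%N isT; rewrite /dyadic expr0 divr1.
have cv : f (dyadic_next r t) @[r --> \oo] --> f t.
  apply: cvg_seq_at_right (rf t _) _ (cvg_dyadic_next t0); first by rewrite t0.
  by move=> r; case/andP: (dyadic_nextP r t0).
have cvn : `|f (dyadic_next r t)| @[r --> \oo] --> `|f t| by apply: cvg_norm.
rewrite -(cvg_lim (@Rhausdorff R) cvn); apply: limr_le.
  by apply/cvg_ex; exists `|f t|.
apply: nearW => r /=; apply: gridb.
rewrite -(ltr_nat R) -?(ler_nat R).
have : (Num.truncn (t * 2 ^+ r))%:R <= t * 2 ^+ r.
  by have := truncn_le (t * 2 ^+ r); rewrite mulr_ge0// ltW// pow2_gt0.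
move=> h.
have : (Num.truncn (t * 2 ^+ r))%:R < (2 ^ r)%:R :> R.
  apply: le_lt_trans h _; rewrite natrX gtr_pMl//; exact: pow2_gt0.
by rewrite ltr_nat.
Qed.

End series_and_chaining.

(** * The variance clock *)

Section clock.
Context {R : realType}.

(* The variance at time t of a coordinate of the center of mass. *)
Definition clock (t : R) : R :=
  2 - 2 / 2 ^+ Num.truncn t + (t - (Num.truncn t)%:R) / 2 ^+ Num.truncn t.

(** The right end [u = 1] is included: there the formula agrees with the one for [m + 1] at 0. The
    constant part is the partial sum of [2 ^- j] over [j < m]. *)
Lemma clockE (m : nat) (u : R) : 0 <= u <= 1 ->
  clock (m%:R + u) = 2 - 2 / 2 ^+ m + u / 2 ^+ m.
Proof.
move=> /andP[u0]; rewrite le_eqVlt => /predU1P[->|u1].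
  rewrite natr1 /clock natrK subrr mul0r addr0 exprSr.
  have := pow2_gt0 (R := R) m => /lt0r_neq0 h; field.
  by rewrite h.
have E : Num.truncn (m%:R + u) = m.
  apply/eqP; rewrite -(@eqr_nat R); apply/eqP.
  have mu0 : 0 <= m%:R + u by rewrite addr_ge0.
  apply: f_equal; apply: truncn_def; rewrite lerDl u0/= -natr1 ltrD2l//.
by rewrite /clock E [m%:R + u]addrC addrK.
Qed.

Lemma clock0 : clock 0 = 0.
Proof.
have := @clockE 0 0; rewrite mulr0n addr0 lexx ler01 => -> //.
by rewrite expr0 !divr1 subrr add0r.
Qed.

(** With [m] the integer part of [t], [2 - clock t] is at most [2 / 2 ^ m], and [m + 1 <= 2 ^ m].
    The resulting rate [4 / (t + 1)] is crude but enough for convergence to 2. *)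
Lemma clock_bounds t : 0 <= t -> 0 < 2 - clock t /\ (2 - clock t) * (t + 1) <= 4.
Proof.
move=> t0; have /andP[h1 h2] := truncn_itv t0.
rewrite /clock; set m := Num.truncn t in h1 h2 *.
have p := pow2_gt0 (R := R) m.
have -> : 2 - (2 - 2 / 2 ^+ m + (t - m%:R) / 2 ^+ m) = (2 - (t - m%:R)) / 2 ^+ m.
  by field; rewrite lt0r_neq0.
have h3 : t - m%:R < 1 by rewrite ltrBlDl natr1.
split.
  by rewrite divr_gt0// subr_gt0 (lt_trans h3)// ltr1n.
rewrite mulrAC ler_pdivrMr//.
have m2 : (m.+1 <= 2 ^ m)%N by exact: ltn_expl.
have m2' : m%:R + 1 <= 2 ^+ m :> R by rewrite natr1 -natrX ler_nat.
rewrite -natr1 in h2.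
set p2 := 2 ^+ m in m2' *.
have m0 : 0 <= m%:R :> R by [].
have := mulr_ge0 (_ : 0 <= t - m%:R) t0; rewrite subr_ge0 => /(_ h1) ?.
nra.
Qed.

(** A cell of level [r] never straddles an integer, so the rate is constant on it, determined by the
    integer part [l %/ 2 ^ r]. *)
Lemma clock_dyadicS r l :
  clock (dyadic r l.+1) - clock (dyadic r l) = (2 ^+ r)^-1 / 2 ^+ (l %/ 2 ^ r).
Proof.
have p : (0 < 2 ^ r)%N by rewrite expn_gt0.
have pr := pow2_gt0 (R := R) r.
have E q : (l + q)%:R / 2 ^+ r = (l %/ 2 ^ r)%:R + dyadic r (l %% 2 ^ r + q)%N :> R.
  rewrite {1}(divn_eq l (2 ^ r)) -addnA natrD natrM natrX mulrDl mulfK ?lt0r_neq0//.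
have lt := ltn_pmod l p.
have E0 := E 0%N; have E1 := E 1%N; rewrite !addn0 in E0; rewrite !addn1 in E1.
rewrite {1 2}/dyadic E0 E1 !clockE.
- rewrite -[RHS]mulr1 -(dyadicS r (l %% 2 ^ r)); have := pow2_gt0 (R := R) (l %/ 2 ^ r).
  by move=> /lt0r_neq0 h; field.
- rewrite dyadic_ge0/= ler_pdivrMr// mul1r -natrX ler_nat ltnW//.
- by rewrite dyadic_ge0/= ler_pdivrMr// mul1r -natrX ler_nat.
Qed.

Lemma cvg_clock_dyadic r l : clock (dyadic r (l + n)) @[n --> \oo] --> (2 : R).
Proof.
have pr := pow2_gt0 (R := R) r.
rewrite -[X in _ --> X]subr0.
have E n : clock (dyadic r (l + n)) = 2 - (2 - clock (dyadic r (l + n))) by rewrite opprB addrC subrK.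
under eq_cvg do rewrite E.
apply: cvgB; first exact: cvg_cst.
apply: (@squeeze_cvgr _ _ _ _ (fun=> 0) (fun n => (4 * 2 ^+ r) * harmonic n)).
- apply: nearW => n; have [h1 h2] := clock_bounds (dyadic_ge0 (R := R) r (l + n)).
  rewrite (ltW h1)/= /harmonic/= ler_pdivlMr//.
  have : n.+1%:R <= (dyadic r (l + n) + 1) * 2 ^+ r :> R.
    rewrite mulrDl mul1r divfK ?lt0r_neq0// -natr1 lerD ?ler_nat ?leq_addl//.
    by rewrite exprn_ege1// ler1n.
  move=> h3.
  apply: (@le_trans _ _ ((2 - clock (dyadic r (l + n))) * ((dyadic r (l + n) + 1) * 2 ^+ r))).
    by rewrite ler_pM2l.
  by rewrite mulrA ler_pM2r.
- exact: cvg_cst.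
- rewrite -(mulr0 (4 * 2 ^+ r)); apply: cvgMr; last exact: cvg_harmonic.
Qed.

Lemma clock_right_continuous t : 0 <= t -> clock s @[s --> t^'+] --> clock t.
Proof.
move=> t0; set m := Num.truncn t.
apply: (@cvg_trans _ ((2 - 2 / 2 ^+ m + (s - m%:R) / 2 ^+ m) @[s --> t^'+])).
  apply: near_eq_cvg; near=> s.
  have : nb_particles s = nb_particles t.
    near: s; exact: nb_particles_near.
  by move=> /(expnI (isT : (1 < 2)%N)) E; rewrite /clock -/m E.
apply: cvg_at_right_filter; apply: cvgD; first exact: cvg_cst.
apply: cvgMl; apply: cvgB; [exact: cvg_id|exact: cvg_cst].
Unshelve. all: by end_near. Qed.

Lemma dyadic_cvg_pinfty r l : (dyadic r (l + n) : R) @[n --> \oo] --> +oo.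
Proof.
apply/cvgryPge => A; near=> n.
rewrite /dyadic ler_pdivlMr ?pow2_gt0//.
apply: (@le_trans _ _ n%:R); last by rewrite ler_nat leq_addl.
by near: n; exact: nbhs_infty_ger.
Unshelve. all: by end_near. Qed.

End clock.

Section generated_sigma_algebras.
Context {R : realType} {T : pointedType} {I J : Type}.

Lemma smeas_sigma_gen (D : set I) (X : I -> T -> R) j :
  D j -> smeas (sigma_gen D X) (X j).
Proof.
move=> Dj; apply: smeasP => A mA; apply: sub_sigma_algebra.
by have /smeas_preimage := @smeas_gen _ _ _ D X j Dj; exact.
Qed.

Lemma sigma_gen_incl (D : set I) (X : I -> T -> R) (E : set J) (Y : J -> T -> R) :
  (forall j, D j -> smeas (sigma_gen E Y) (X j)) -> sigma_gen D X `<=` sigma_gen E Y.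
Proof.
move=> /sigma_gen_sub sub A /sub; rewrite sigma_algebra_id//.
exact: smallest_sigma_algebra.
Qed.

End generated_sigma_algebras.

Lemma clock_dyadic_lt {R : realType} r l n :
  0 < clock (dyadic r (l + n.+1)) - clock (dyadic r l) :> R.
Proof.
have step q : 0 < clock (dyadic r q.+1) - clock (dyadic r q) :> R.
  by rewrite clock_dyadicS divr_gt0 ?invr_gt0 ?pow2_gt0.
elim: n => [|n IH]; first by rewrite addn1.
have := addr_gt0 (step (l + n.+1)%N) IH; by rewrite addrA subrK -addnS.
Qed.

(** * Processes with independent Gaussian increments along the clock *)

Section clocked_process.
Context {R : realType} {dT : measure_display} {T : measurableType dT}.

(** What is retained of a coordinate of the center of mass. Increments are described within one unit
    interval only; longer ones are assembled along dyadic grids. *)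
Definition gaussian_increments (P : probability T R) (X : R -> T -> R) : Prop :=
  [/\ forall t, 0 <= t -> measurable_fun setT (X t),
      forall w, X 0 w = 0,
      forall w t, 0 <= t -> X s w @[s --> t^'+] --> X t w &
      forall (m : nat) s t, 0 <= s -> s < t -> t <= 1 ->
        gauss P (fun w => X (m%:R + t) w - X (m%:R + s) w) ((t - s) / 2 ^+ m) /\
        indep2 P (sigma_gen [set u | 0 <= u <= m%:R + s] X)
          (sig (fun w => X (m%:R + t) w - X (m%:R + s) w))].

Variables (P : probability T R) (X : R -> T -> R).
Hypothesis hX : gaussian_increments P X.

Let mX t : 0 <= t -> measurable_fun setT (X t). Proof. by case: hX => + _ _ _; apply. Qed.
Let X0 w : X 0 w = 0. Proof. by case: hX. Qed.
Let rX w t : 0 <= t -> X s w @[s --> t^'+] --> X t w.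
Proof. by case: hX => _ _ + _; apply. Qed.
Let gX (m : nat) s t : 0 <= s -> s < t -> t <= 1 ->
  gauss P (fun w => X (m%:R + t) w - X (m%:R + s) w) ((t - s) / 2 ^+ m).
Proof. by move=> s0 st t1; case: hX => _ _ _ /(_ m s t s0 st t1)[]. Qed.
Let iX (m : nat) s t : 0 <= s -> s < t -> t <= 1 ->
  indep2 P (sigma_gen [set u | 0 <= u <= m%:R + s] X)
          (sig (fun w => X (m%:R + t) w - X (m%:R + s) w)).
Proof. by move=> s0 st t1; case: hX => _ _ _ /(_ m s t s0 st t1)[]. Qed.

Lemma dyadic_le1 r l : (l <= 2 ^ r)%N -> dyadic r l <= 1 :> R.
Proof. by move=> lr; rewrite ler_pdivrMr ?pow2_gt0// mul1r -natrX ler_nat. Qed.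

Lemma dyadic_ltS r l : dyadic r l < dyadic r l.+1 :> R.
Proof. by rewrite -subr_gt0 dyadicS invr_gt0 pow2_gt0. Qed.

(** The threshold decays in [m] and in [r]: summation over the levels [r] bounds the oscillation on
    [[m, m + 1]] by a multiple of [a ^+ m], which is again summable. *)
Let large (a : R) m r (l : nat) : set T :=
  [set w | a ^+ (m + r) < `|X (m%:R + dyadic r l.+1) w - X (m%:R + dyadic r l) w|].

Let mlarge a m r l : measurable (large a m r l).
Proof.
rewrite /large; set f := fun w => _.
have mf : measurable_fun setT (fun w => `|X (m%:R + dyadic r l.+1) w - X (m%:R + dyadic r l) w|).
  by apply: measurableT_comp => //; apply: measurable_funB; apply: mX; rewrite addr_ge0// dyadic_ge0.
rewrite (_ : [set w | _] = (fun w => `|X (m%:R + dyadic r l.+1) w - X (m%:R + dyadic r l) w|) @^-1` `]a ^+ (m + r), +oo[%classic).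
  by rewrite -[X in measurable X]setTI; exact: mf.
by apply/seteqP; split=> w; rewrite /= in_itv/= andbT.
Qed.

Let oscillation a m : set T := \bigcup_r \big[setU/set0]_(l < 2 ^ r) large a m r l.

Let moscillation a m : measurable (oscillation a m).
Proof. by apply: bigcup_measurable => r _; apply: bigsetU_measurable => l _. Qed.

(** Level [r] has [2 ^ r] cells of variance [2 ^- (m + r)], so [gauss_tail] bounds it by 128 times
    [2 ^ r * 2 ^- (2 (m + r)) / a ^ (4 (m + r))], which is at most 128 times
    [(2 a ^ 4) ^- (m + r)]. *)
Let prob_oscillation a m : 0 < a -> 0 < (2 * a ^+ 4)^-1 < 1 ->
  (P (oscillation a m) <= (128 / (1 - (2 * a ^+ 4)^-1) * (2 * a ^+ 4)^-1 ^+ m)%:E)%E.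
Proof.
move=> a0; set x := (2 * a ^+ 4)^-1 => x01.
have x0 : 0 <= x by case/andP: x01 => /ltW.
apply: le_trans (generalized_Boole_inequality _ _ _) _ => //.
- by move=> r; apply: bigsetU_measurable => l _.
- exact: moscillation.
rewrite mulrAC; apply: nneseries_geometric_le => //; first by rewrite mulr_ge0// exprn_ge0.
move=> r; rewrite measure_ge0/=.
apply: le_trans (Boole_inequality _ _) _ => //.
apply: (@le_trans _ _ (\sum_(l < 2 ^ r) ((128 * ((2 ^+ r)^-1 / 2 ^+ m) ^+ 2 / (a ^+ (m + r)) ^+ 4))%:E)%E).
  apply: lee_sum => l _; rewrite -(dyadicS r l).
  apply: gauss_tail; rewrite ?exprn_gt0//.
    by rewrite dyadicS divr_gt0// ?invr_gt0 pow2_gt0.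
  by apply: gX; rewrite ?dyadic_ge0 ?dyadic_ltS ?dyadic_le1.
rewrite sumEFin lee_fin sumr_const card_ord -[leLHS]mulr_natl natrX.
have -> : 128 * x ^+ m * x ^+ r = 128 * (2 ^+ (m + r))^-1 / (a ^+ (m + r)) ^+ 4.
  by rewrite -mulrA -exprD /x exprVn exprMn -!exprM mulnC invfM mulrA.
have pr := pow2_gt0 (R := R) r; have pm := pow2_gt0 (R := R) m.
rewrite mulrA ler_pM2r ?invr_gt0 ?exprn_gt0//.
rewrite mulrCA ler_pM2l// exprD.
have -> : 2 ^+ r * ((2 ^+ r)^-1 / 2 ^+ m) ^+ 2 = (2 ^+ m * 2 ^+ r)^-1 * (2 ^+ m)^-1 :> R.
  by field; rewrite !lt0r_neq0.
rewrite ger_pMr; last by rewrite invr_gt0 mulr_gt0.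
by rewrite invf_le1// exprn_ege1// ler1n.
Qed.

Lemma ae_cvg_pinfty : {ae P, forall w, cvg (X t w @[t --> +oo])}.
Proof.
(* The choice meets both requirements: [a < 1] makes the oscillations summable, and [2 * a ^+ 4 > 1]
   the probabilities. The constants 10 and 100 below are [1 / (1 - a)] and [10 / (1 - a)]. *)
pose a : R := 9 / 10.
have a0 : 0 < a by rewrite /a; lra.
have x01 : 0 < (2 * a ^+ 4)^-1 < 1.
  by rewrite invr_gt0 mulr_gt0 ?exprn_gt0//= invf_lt1 ?mulr_gt0 ?exprn_gt0// /a; lra.
have neg : P.-negligible (lim_sup_set (oscillation a)).
  exists (lim_sup_set (oscillation a)); split => //.
    by apply: bigcap_measurable => // n _; apply: bigcup_measurable.
  apply: lim_sup_set_cvg0 => //.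
  apply: le_lt_trans (ltry (128 / (1 - (2 * a ^+ 4)^-1) / (1 - (2 * a ^+ 4)^-1))).
  apply: (nneseries_geometric_le _ x01) => [|m]; last by rewrite measure_ge0/=; exact: prob_oscillation.
  by rewrite divr_ge0// subr_ge0 ltW//; case/andP: x01.
apply: negligibleS neg => w /= nc n _.
apply: contrapT => no; apply: nc.
have osc m : (n <= m)%N -> forall u, 0 <= u <= 1 ->
    `|X (m%:R + u) w - X m%:R w| <= 10 * a ^+ m.
  move=> nm.
  have -> : 10 * a ^+ m = a ^+ m / (1 - a).
    by rewrite mulrC; congr (_ * _); rewrite /a; field.
  apply: (@chaining_bound R (fun u => X (m%:R + u) w - X m%:R w)).
  - by rewrite exprn_ge0// ltW.
  - by rewrite a0 /a; lra.
  - by rewrite addr0 subrr.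
  - move=> t /andP[t0 t1]; apply: cvgB; last exact: cvg_cst.
    have := @cvg_at_right_shift R (fun s => X (m%:R + s) w) (- m%:R) (m%:R + t) (X (m%:R + t) w).
    rewrite addKr; apply.
    under eq_cvg do rewrite addrA subrr add0r.
    by apply: rX; rewrite addr_ge0.
  - move=> r l lr; rewrite leNgt; apply/negP.
    rewrite opprB addrA subrK -exprD => big; apply: no.
    exists m => //; exists r => //.
    by rewrite -bigcup_mkord; exists l.
have a1 : `|a| < 1 by rewrite gtr0_norm// /a; lra.
(* The bound is written as a difference so that it telescopes:
   [10 * a ^+ m = 100 * (a ^+ m - a ^+ m.+1)]. *)
have osc_int m j : (n <= m)%N ->
    `|X (m + j)%:R w - X m%:R w| <= 100 * (a ^+ m - a ^+ (m + j)).
  move=> nm; elim: j => [|j IH]; first by rewrite addn0 !subrr normr0 mulr0.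
  have := osc (m + j)%N (leq_trans nm (leq_addr _ _)) 1; rewrite ler01 lexx => /(_ isT).
  rewrite natr1 -addnS => h.
  rewrite -(subrK (X (m + j)%:R w) (X (m + j.+1)%:R w)) -addrA.
  apply: le_trans (ler_normD _ _) _.
  apply: le_trans (lerD h IH) _.
  rewrite addnS exprS /a; set b := (9 / 10) ^+ (m + j); lra.
have osc_all m t : (n <= m)%N -> m%:R <= t -> `|X m%:R w - X t w| <= 100 * a ^+ m.
  move=> nm mt.
  have t0 : 0 <= t by rewrite (le_trans _ mt).
  have /andP[h1 h2] := truncn_itv t0.
  have mj : (m <= Num.truncn t)%N.
    by rewrite -ltnS -(ltr_nat R) (le_lt_trans mt).
  have u01 : 0 <= t - (Num.truncn t)%:R <= 1.
    by rewrite subr_ge0 h1/= lerBlDl natr1 ltW.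
  have := osc _ (leq_trans nm mj) _ u01; rewrite [_%:R + (_ - _)]addrC subrK => hu.
  have := osc_int m (Num.truncn t - m)%N nm; rewrite subnKC// => hi.
  rewrite distrC -(subrK (X (Num.truncn t)%:R w) (X t w)) -addrA.
  apply: le_trans (ler_normD _ _) _.
  apply: le_trans (lerD hu hi) _.
  have : 0 <= a ^+ Num.truncn t by rewrite exprn_ge0// ltW.
  lra.
apply/cauchy_cvgP; apply: cauchy_exP => e e0.
have : \forall m \near \oo, 100 * a ^+ m < e.
  have /cvgr_lt : 100 * a ^+ m @[m --> \oo] --> (100 * 0 : R).
    by apply: cvgMr; exact: cvg_expr.
  by rewrite mulr0; apply.
move=> [m0 _ hm0].
pose m := maxn m0 n.
have hm : 100 * a ^+ m < e by apply: hm0; rewrite /= leq_maxl.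
exists (X m%:R w); rewrite /nbhs/=; near=> t.
rewrite /ball/=; apply: le_lt_trans (osc_all m t _ _) hm; first exact: leq_maxr.
by near: t; exact: nbhs_pinfty_ge.
Unshelve. all: by end_near. Qed.


Let past (t : R) : set (set T) := sigma_gen [set u | 0 <= u <= t] X.

Let past_pi t : pi_system (past t).
Proof. by apply: sigma_gen_pi => u /= /andP[u0 _]; exact: mX. Qed.

Let mdX s t : 0 <= s -> 0 <= t -> measurable_fun setT (fun w => X t w - X s w).
Proof. by move=> s0 t0; apply: measurable_funB; exact: mX. Qed.

Let smeas_past t u : 0 <= u <= t -> smeas (past t) (X u).
Proof.
move=> ut; exact: (@smeas_sigma_gen _ _ _ [set u | 0 <= u <= t] X u).
Qed.

Let pastS s t : s <= t -> past s `<=` past t.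
Proof.
move=> st; apply: sigma_gen_incl => u /= /andP[u0 us]; apply: smeas_past.
by rewrite u0 (le_trans us).
Qed.

Lemma dyadic_le r l l' : (l <= l')%N -> dyadic r l <= dyadic r l' :> R.
Proof. by move=> ll; rewrite ler_pM2r ?invr_gt0 ?pow2_gt0// ler_nat. Qed.

Let grid_step r l :
  gauss P (fun w => X (dyadic r l.+1) w - X (dyadic r l) w)
    (clock (dyadic r l.+1) - clock (dyadic r l)) /\
  indep2 P (past (dyadic r l)) (sig (fun w => X (dyadic r l.+1) w - X (dyadic r l) w)).
Proof.
rewrite clock_dyadicS -(dyadicS r (l %% 2 ^ r)).
have E q : dyadic r (l + q) = (l %/ 2 ^ r)%:R + dyadic r (l %% 2 ^ r + q) :> R.
  rewrite /dyadic {1}(divn_eq l (2 ^ r)) -addnA natrD natrM natrX mulrDl mulfK//.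
have E0 := E 0%N; have E1 := E 1%N; rewrite !addn0 in E0; rewrite !addn1 in E1.
have lt : (l %% 2 ^ r < 2 ^ r)%N by rewrite ltn_pmod// expn_gt0.
rewrite E0 E1; split; [apply: gX|apply: iX]; rewrite ?dyadic_ge0 ?dyadic_ltS//.
  exact: dyadic_le1.
exact: dyadic_le1.
Qed.

(** Cells are added one by one: the new increment is independent of the past and of the sum so far,
    so variances add by [gaussD] and independence of the past survives by [indep2_assoc]. *)
Let grid_increment r l n :
  gauss P (fun w => X (dyadic r (l + n.+1)) w - X (dyadic r l) w)
    (clock (dyadic r (l + n.+1)) - clock (dyadic r l)) /\
  indep2 P (past (dyadic r l)) (sig (fun w => X (dyadic r (l + n.+1)) w - X (dyadic r l) w)).
Proof.
elim: n => [|n [g i]]; first by rewrite addn1; exact: grid_step.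
pose t : R := dyadic r (l + n.+1); have [gs is_] := grid_step r (l + n.+1).
rewrite -addnS -/t in gs is_.
pose t' : R := dyadic r (l + n.+2); pose s : R := dyadic r l.
rewrite -/t' in gs is_ *; rewrite -/s -/t in g i *.
have s0 : 0 <= s by exact: dyadic_ge0.
have t0 : 0 <= t by exact: dyadic_ge0.
have t'0 : 0 <= t' by exact: dyadic_ge0.
have st : s <= t by apply: dyadic_le; exact: leq_addr.
have E : (fun w => X t' w - X s w) = (fun w => (X t w - X s w) + (X t' w - X t w)).
  by apply/funext => w; rewrite [RHS]addrC addrA subrK.
have sub : sig (fun w => X t w - X s w) `<=` past t.
  by apply: sigma_gen_incl => _ _; apply: measurable_funB; apply: smeas_past; rewrite ?s0 ?t0/=.
rewrite E; split.
  rewrite -(subrK (clock t) (clock t')) -addrA [X in gauss _ _ X]addrC.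
  apply: (@gaussD _ _ _ P) g gs (indep2S sub (@subset_refl _ _) is_).
  - exact: clock_dyadic_lt.
  - by rewrite /t /t' addnS clock_dyadicS divr_gt0 ?invr_gt0 ?pow2_gt0.
have : indep2 P (past s) <<s sig (fun w => X t w - X s w) `|` sig (fun w => X t' w - X t w) >>.
  apply: indep2_assoc => //.
  - exact/sig_pi/mdX.
  - exact/sig_pi/mdX.
  - apply: indep2S is_ => //.
    have -> : past t = <<s past t >>.
      by rewrite sigma_algebra_id//; exact: smallest_sigma_algebra.
    by apply: sigma_idem => A [/(pastS st)|/sub]; exact: sub_sigma_algebra.
apply: indep2S => //; apply: sig_sub; apply: measurable_funD.
  by apply: smeasP => A mA; apply: sub_sigma_algebra; left; exact: sigE.
by apply: smeasP => A mA; apply: sub_sigma_algebra; right; exact: sigE.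
Qed.

(* Total and measurable everywhere; the limit of X at infinity where it exists. *)
Definition terminal (w : T) : R := fine (limn_esup (fun m => (X m%:R w)%:E)).

Lemma smeas_terminal : smeas (gens [set t | 0 <= t] X) terminal.
Proof.
apply: measurableT_comp => //.
apply: measurable_fun_limn_esup => m; apply/measurable_EFinP.
exact: (@smeas_gen _ _ _ [set t : R | 0 <= t] X m%:R (ler0n _ _)).
Qed.

Lemma ae_cvg_terminal : {ae P, forall w, X t w @[t --> +oo] --> terminal w}.
Proof.
apply: filterS ae_cvg_pinfty => w /cvg_ex[l wl].
rewrite (_ : terminal w = l)//.
have cl : X m%:R w @[m --> \oo] --> l.
  apply: cvg_comp wl; exact: cvgr_idn.
rewrite /terminal.
have /cvg_limn_einf_sup[_ ->//] : (fun m => (X m%:R w)%:E) @ \oo --> l%:E.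
by apply: cvg_EFin => //; exact: nearW.
Qed.

Lemma measurable_terminal : measurable_fun setT terminal.
Proof. by apply: smeas_measurable smeas_terminal; exact: gens_measurable. Qed.

(** [gauss_limit] applied to [grid_increment] as [n] grows: the variances tend to [2 - clock], and
    independence of the past passes to the limit. *)
Let terminal_increment r l :
  gauss P (fun w => terminal w - X (dyadic r l) w) (2 - clock (dyadic r l)) /\
  indep2 P (past (dyadic r l)) (sig (fun w => terminal w - X (dyadic r l) w)).
Proof.
have [p _] := clock_bounds (dyadic_ge0 (R := R) r l).
apply: (@gauss_limit _ _ _ P _ (fun n w => X (dyadic r (l + n.+1)) w - X (dyadic r l) w) _
  (fun n => clock (dyadic r (l + n.+1)) - clock (dyadic r l))) => //.
- by move=> m; exact: clock_dyadic_lt.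
- apply: cvgB; last exact: cvg_cst.
  by under eq_cvg do rewrite -addSnnS; exact: cvg_clock_dyadic.
- by move=> m; have [] := grid_increment r l m.
- by have [] := past_pi (dyadic r l).
- by have [] := past_pi (dyadic r l).
- by move=> m; have [] := grid_increment r l m.
- by apply: measurable_funB; [exact: measurable_terminal|apply: mX; exact: dyadic_ge0].
- apply: filterS ae_cvg_terminal => w wl.
  apply: cvgB; last exact: cvg_cst.
  under eq_cvg do rewrite -addSnnS.
  by apply: cvg_comp wl; exact: dyadic_cvg_pinfty.
Qed.

Lemma gauss_terminal : gauss P terminal 2.
Proof.
have [+ _] := terminal_increment 0 0.
rewrite /dyadic mul0r clock0 subr0.
by under eq_fun do rewrite X0 subr0.
Qed.

(** The coefficient [clock t / 2] is the regression coefficient of [X t] on [terminal]: covariance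
    [clock t] over variance 2. *)
Definition bridge (t : R) (w : T) : R := X t w - clock t / 2 * terminal w.

(** [gauss_sum_residual] for the increments on the grid of mesh [2 ^- r] up to time [r], completed
    by a last increment up to infinity. Their sum is [terminal], of variance 2, and the partial sums
    of the residuals are the values of the bridge. *)
Let indep_bridge_grid r :
  indep2 P (sigma_gen [set t | exists2 l, (l <= r * 2 ^ r)%N & t = dyadic r l] bridge)
    (sig terminal).
Proof.
set n := (r * 2 ^ r)%N.
(* The index [n] carries the increment from time [r] to infinity, with variance [2 - clock] at that
   time. *)
pose D q w := if (q < n)%N then X (dyadic r q.+1) w - X (dyadic r q) w
  else terminal w - X (dyadic r q) w.
pose v q : R := if (q < n)%N then clock (dyadic r q.+1) - clock (dyadic r q)
  else 2 - clock (dyadic r q).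
have gD q : gauss P (D q) (v q) /\ indep2 P (past (dyadic r q)) (sig (D q)).
  by rewrite /D /v; case: ifP => _; [exact: grid_step|exact: terminal_increment].
have v0 q : 0 < v q.
  rewrite /v; case: ifP => _; last by have [] := clock_bounds (dyadic_ge0 (R := R) r q).
  by rewrite clock_dyadicS divr_gt0 ?invr_gt0 ?pow2_gt0.
have [|q qn|q qn|] := @gauss_sum_residual _ _ _ P D v n.
- by [].
- by have [] := gD q.
- have [_] := gD q.+1; apply: indep2S => //.
  apply: sigma_gen_incl => j /= jq; rewrite /D (leq_ltn_trans jq qn).
  apply: measurable_funB; apply: smeas_past; rewrite dyadic_ge0/=; apply: dyadic_le => //.
  exact: leqW.
have SX w q : (q <= n)%N -> \sum_(j < q) D j w = X (dyadic r q) w.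
  elim: q => [|q IH] qn; first by rewrite big_ord0 /dyadic mul0r X0.
  by rewrite big_ord_recr/= IH ?(ltnW qn)// /D qn addrC subrK.
have Sv q : (q <= n)%N -> \sum_(j < q) v j = clock (dyadic r q).
  elim: q => [|q IH] qn; first by rewrite big_ord0 /dyadic mul0r clock0.
  by rewrite big_ord_recr/= IH ?(ltnW qn)// /v qn addrC subrK.
have SD : (fun w => \sum_(i < n.+1) D i w) = terminal.
  by apply/funext => w; rewrite big_ord_recr/= SX// /D ltnn addrC subrK.
have -> : \sum_(i < n.+1) v i = 2 by rewrite big_ord_recr/= Sv// /v ltnn addrC subrK.
move=> _ _ h.
have {h} : indep2 P (sig terminal)
    (sigma_gen [set j | (j <= n)%N] (fun j w => D j w - v j / 2 * terminal w)).
  by rewrite -SD.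
move=> /indep2C; apply: indep2S => //.
apply: sigma_gen_incl => _ [q qn ->].
rewrite (_ : bridge _ = (fun w => \sum_(j < q) (D j w - v j / 2 * terminal w))).
  apply: measurable_sum => j.
  apply: (@smeas_sigma_gen _ _ _ [set j | (j <= n)%N]
    (fun j w => D j w - v j / 2 * terminal w) j).
  by rewrite /= (leq_trans (ltnW (ltn_ord j))).
apply/funext => w.
by rewrite sumrB SX// -mulr_suml -mulr_suml Sv.
Qed.

(** As [r] grows the grids become finer and their horizon longer, so their union contains all dyadic
    times; right-continuity of [X] and [clock] reaches the others. *)
Lemma indep_bridge_terminal :
  indep2 P (sigma_gen [set t | 0 <= t] bridge) (sig terminal).
Proof.
have mb t : 0 <= t -> measurable_fun setT (bridge t).
  move=> t0; apply: measurable_funB; first exact: mX.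
  by apply: measurable_funM => //; exact: measurable_terminal.
have mT := measurable_terminal.
pose F r := sigma_gen [set t | exists2 l, (l <= r * 2 ^ r)%N & t = dyadic r l] bridge.
have Fpi r : pi_system (F r).
  by apply: sigma_gen_pi => _ [l _ ->]; apply: mb; exact: dyadic_ge0.
have sF r l : (l <= r * 2 ^ r)%N -> smeas (F r) (bridge (dyadic r l)).
  by move=> lr; apply: smeas_sigma_gen; exists l.
have lim := @mindep_limit _ _ _ P bool (fun r b => if b then F r else sig terminal).
have /mindep2 : mindep P (fun b : bool =>
    if b then <<s \bigcup_r F r >> else <<s \bigcup_(r in [set: nat]) sig terminal >>).
  have -> : (fun b : bool => if b then <<s \bigcup_r F r >> else
      <<s \bigcup_(r in [set: nat]) sig terminal >>) =
    (fun b => <<s \bigcup_r (if b then F r else sig terminal) >>).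
    by apply/funext => -[].
  apply: lim.
  - by move=> r [] //; exact: sig_pi.
  - move=> r [] //.
    apply: sigma_gen_incl => _ [l lr ->]; rewrite -dyadic_double; apply: sF.
    by rewrite expnS mulnCA -mul2n leq_pmul2l// (leq_trans lr)// leq_pmul2r ?expn_gt0.
  - by move=> r; apply/mindep2; exact: indep_bridge_grid.
apply: indep2S; last first.
  by move=> A SA; apply: sub_sigma_algebra; exists 0%N.
apply: sigma_gen_sub => t t0.
(* Two units of slack, one for the fractional part of [t] and one for the mesh, keep
   [dyadic_next (n + C) t] below the horizon [n + C] of its grid. *)
pose C := (Num.truncn t).+2.
apply: (@smeas_cvg _ _ _ (fun n => bridge (dyadic_next (n + C) t))).
  move=> n; apply: (smeasS (G := F (n + C)%N)).
    by move=> A FA; apply: sub_sigma_algebra; exists (n + C)%N.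
  apply: sF.
  have tn : dyadic_next (n + C) t <= (n + C)%:R.
    have /andP[_ h] := dyadic_nextP (n + C) t0; apply: le_trans h _.
    have h1 := truncnS_gt t.
    have h2 : (2 ^+ (n + C))^-1 <= 1 :> R by rewrite invf_le1 ?pow2_gt0// exprn_ege1// ler1n.
    have h3 : (Num.truncn t).+1%:R + 1 <= (n + C)%:R :> R by rewrite natr1 ler_nat leq_addl.
    move: h1 h2 h3; set a := _%:R; set b := _^-1; set c := _%:R; lra.
  by move: tn; rewrite ler_pdivrMr ?pow2_gt0// -natrX -natrM ler_nat.
move=> w.
have cn : (dyadic_next (n + C) t : R) @[n --> \oo] --> t.
  by rewrite (cvg_shiftn C (fun n => dyadic_next n t)); exact: cvg_dyadic_next.
have ncn n : t < dyadic_next (n + C) t by case/andP: (dyadic_nextP (n + C) t0).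
have h1 : X (dyadic_next (n + C) t) w @[n --> \oo] --> X t w.
  exact: (@cvg_seq_at_right R (fun s => X s w) _ t (X t w) (@rX w t t0) ncn cn).
have h2 : clock (dyadic_next (n + C) t) @[n --> \oo] --> clock t.
  exact: cvg_seq_at_right (clock_right_continuous t0) ncn cn.
rewrite /bridge; apply: cvgB; first exact: h1.
by apply: cvgMl; apply: cvgMl.
Qed.

End clocked_process.

(** * The limit of the center of mass and its normal law *)

Section limit_of_the_center_of_mass.
Context {R : realType} {d : nat} {dT : measure_display} {T : measurableType dT}.
Variables (gamma : R) (P : probability T R) (B : noise R d T) (Z : T -> trajectory R d).
Hypothesis hZ : interacting_BBM gamma P B Z.

Let mZ : random_trajectory Z. Proof. by case: hZ. Qed.
Let dn : driving_noise P B Z. Proof. by case: hZ. Qed.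
Let dz w : dyadic_branching (Z w). Proof. by case: hZ. Qed.
Let iz w : interacting_motion gamma (fun m i k s => B m i k s w) (Z w).
Proof. by case: hZ. Qed.
Let BM m i k : (i < 2 ^ m)%N -> standard_BM P (B m i k).
Proof. by have [+ _ _] := dn m; apply. Qed.
Let iB m : mutual_indep P [set p : nat * 'I_d | (p.1 < 2 ^ m)%N]
        (fun p => sigma_gen [set s | 0 <= s] (B m p.1 p.2)).
Proof. by have [_ + _] := dn m. Qed.
Let cB m i k w : (i < 2 ^ m)%N -> {within `[0, +oo[, continuous (fun s => B m i k s w)}.
Proof. by move=> /(BM k)[]. Qed.
Let pow2n_gt0 m : (0 < 2 ^ m)%N. Proof. by rewrite expn_gt0. Qed.

Lemma right_continuous_interacting_BBM w : right_continuous (Z w).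
Proof. exact: (path_right_continuous (@iz w) (fun m i k => @cB m i k w)). Qed.

Definition com (k : 'I_d) (t : R) (w : T) : R := center_of_mass (Z w) t k.

Let com_avg m k u w : 0 <= u <= 1 ->
  com k (m%:R + u) w = com k m%:R w + noise_avg (2 ^ m) (B m) k u w.
Proof.
move=> /andP[u0]; rewrite le_eqVlt => /predU1P[->|u1].
  by rewrite natr1 /com (center_of_massS (dz w) (@iz w) (fun m i k => @cB m i k w)).
by rewrite /com (center_of_mass_motion (@iz w))// u0.
Qed.

(** Within a generation the increment is that of the noise average, of variance [(t - s) / 2 ^ m].
    The past up to [m + s] is generated by two sources, the process up to [m] and the noise up to
    [s]. *)
Lemma com_gaussian_increments k : gaussian_increments P (com k).
Proof.
split.
- by move=> t t0; exact: measurable_center_of_mass.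
- by move=> w; exact: center_of_mass0.
- move=> w t t0; apply: center_of_mass_right_continuous => //.
  exact: right_continuous_interacting_BBM.
move=> m s t s0 st t1.
have s1 : 0 <= s <= 1 by rewrite s0 ltW// (lt_le_trans st).
have t01 : 0 <= t <= 1 by rewrite t1 ltW// (le_lt_trans s0).
have E : (fun w => com k (m%:R + t) w - com k (m%:R + s) w) =
    (fun w => noise_avg (2 ^ m) (B m) k t w - noise_avg (2 ^ m) (B m) k s w).
  by apply/funext => w; rewrite !com_avg// [com k _ w + _]addrC addrKA.
rewrite E; split.
  have [+ _] := @avg_inc_gauss _ _ _ _ P (2 ^ m) (B m) (pow2n_gt0 m)
    (fun i k => @BM m i k) (@iB m) k s t s0 st.
  by rewrite natrX.
pose ZP := sigma_gen [set j : R * nat * 'I_d | live j /\ j.1.1 <= m%:R]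
  (fun j w => coord j (Z w)).
have ZPpi : pi_system ZP by apply: sigma_gen_pi => j [lj _]; exact: mZ.
pose inc := noise_inc (2 ^ m) (B m) s t.
pose pst := noise_past (2 ^ m) (B m) s.
have mB i k' u : (i < 2 ^ m)%N -> 0 <= u -> measurable_fun setT (B m i k' u).
  by move=> im u0; have [+ _ _ _ _] := BM k' im; apply.
have incpi : pi_system inc.
  apply: sigma_gen_pi => -[i k'] /= im; apply: measurable_funB; apply: mB => //.
  by case/andP: t01.
have pstpi : pi_system pst.
  by apply: sigma_gen_pi => -[[i k'] u] /= [im /andP[u0 _]]; exact: mB.
have full_sub : <<s inc `|` pst >> `<=`
    sigma_gen [set j | (j.1.2 < 2 ^ m)%N /\ 0 <= j.1.1]
           (fun j : R * nat * 'I_d => B m j.1.2 j.2 j.1.1).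
  have sB i k' u : (i < 2 ^ m)%N -> 0 <= u ->
     smeas (sigma_gen [set j | (j.1.2 < 2 ^ m)%N /\ 0 <= j.1.1]
           (fun j : R * nat * 'I_d => B m j.1.2 j.2 j.1.1)) (B m i k' u).
    move=> im u0.
    exact: (@smeas_sigma_gen _ _ _ [set j | (j.1.2 < 2 ^ m)%N /\ 0 <= j.1.1]
           (fun j : R * nat * 'I_d => B m j.1.2 j.2 j.1.1) (u, i, k')).
  set H := (X in _ `<=` X).
  have -> : H = <<s H >> by rewrite sigma_algebra_id//; exact: smallest_sigma_algebra.
  apply: sigma_idem => A [incA|pstA]; apply: sub_sigma_algebra.
    apply: sigma_gen_incl incA => -[i k'] /= im; apply: measurable_funB; apply: sB => //.
    by case/andP: t01.
  by apply: sigma_gen_incl pstA => -[[i k'] u] /= [im /andP[u0 _]]; exact: sB.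
have i1 : indep2 P inc pst.
  apply: indep2C; apply: (@indep_past_inc _ _ _ _ P (2 ^ m) (B m)) => //.
  exact: (fun i k => @BM m i k).
have i2 : indep2 P <<s inc `|` pst >> ZP.
  apply: indep2C; have [_ _] := dn m; exact: indep2S.
(* The increment is independent of the noise past, and the noise as a whole of the past of [Z];
   together this gives independence of both pasts jointly. *)
have i3 := indep2_assoc incpi pstpi ZPpi i1 i2.
apply: indep2C; apply: indep2S i3.
  apply: sigma_gen_incl => _ _.
  rewrite (_ : (fun w => _) = (fun w => (2 ^ m)%:R^-1 *
    \sum_(i < 2 ^ m) (B m i k t w - B m i k s w))); last first.
    by apply/funext => w; exact: noise_avgB.
  apply: measurable_funM; first exact: measurable_cst.
  apply: measurable_sum => i.
  exact: (@smeas_sigma_gen _ _ _ [set q : nat * 'I_d | (q.1 < 2 ^ m)%N]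
    (fun q w => B m q.1 q.2 t w - B m q.1 q.2 s w) (val i, k) (ltn_ord i)).
have sZ i k' u : 0 <= u <= m%:R -> (i < nb_particles u)%N ->
    smeas (pst `|` ZP) (fun w => Z w u i k').
  move=> /andP[u0 um] iu; apply: (smeasS (G := ZP)).
    by move=> A ZA; apply: sub_sigma_algebra; right.
  exact: (@smeas_sigma_gen _ _ _ [set j : R * nat * 'I_d | live j /\ j.1.1 <= m%:R]
    (fun j w => coord j (Z w)) (u, i, k')).
have scom u : 0 <= u <= m%:R -> smeas (pst `|` ZP) (com k u).
  by move=> um; apply: smeas_center_of_mass => i iu; exact: sZ.
apply: sigma_gen_sub => u /= /andP[u0 us].
have [um|mu] := leP u m%:R; first by apply: scom; rewrite u0.
have v0 : 0 <= u - m%:R <= s by rewrite subr_ge0 ltW//= lerBlDl.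
rewrite (_ : com k u = (fun w => com k m%:R w + noise_avg (2 ^ m) (B m) k (u - m%:R) w)).
  apply: measurable_funD; first by apply: scom; rewrite ler0n lexx.
  apply: smeas_avg => i im; apply: (smeasS (G := pst)).
    by move=> A pA; apply: sub_sigma_algebra; left.
  exact: (@smeas_sigma_gen _ _ _ [set q : nat * 'I_d * R | (q.1.1 < 2 ^ m)%N /\ 0 <= q.2 <= s]
    (fun q => B m q.1.1 q.1.2 q.2) (i, k, u - m%:R)).
apply/funext => w; rewrite -com_avg.
  by rewrite addrC subrK.
case/andP: v0 => -> /le_trans; apply; by case/andP: s1.
Qed.

Definition com_limit (k : 'I_d) : T -> R := terminal (com k).

Definition com_bridge (k : 'I_d) : R -> T -> R := bridge (com k).

Lemma measurable_com_limit k : measurable_fun setT (com_limit k).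
Proof. exact: measurable_terminal (com_gaussian_increments k). Qed.

Lemma measurable_com_bridge k t : 0 <= t -> measurable_fun setT (com_bridge k t).
Proof.
move=> t0; apply: measurable_funB; first exact: measurable_center_of_mass.
by apply: measurable_funM => //; exact: measurable_com_limit.
Qed.

Definition fluct_sigma : set (set T) := sigma_gen live (fun j w => coord j (fluct (Z w))).

Definition com_sigma : set (set T) :=
  sigma_gen [set p : R * 'I_d | 0 <= p.1] (fun p => com p.2 p.1).

Let dev_com_pi q : pi_system (dev_com_gen [set t | 0 <= t] Z q).
Proof. exact: dev_com_gen_pi. Qed.

Lemma indep_fluct_com : indep2 P fluct_sigma com_sigma.
Proof.
have /mindep_regroup := mindep_dev_com hZ.
move=> /(_ _ snd dev_com_pi) h.
have /mindep2 : mindep P (fun b : bool => if b then fluct_sigma else com_sigma).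
  2: by [].
apply: mindepS h => -[] /=.
  apply: sigma_gen_sub => -[[t i] k] [/= t0 it].
  apply: (smeasS (G := dev_com_gen [set t | 0 <= t] Z (k, true))).
    by move=> A hA; apply: sub_sigma_algebra; exists (k, true).
  exact: (@smeas_fluct_gen _ _ _ _ [set t | 0 <= t] Z (k, true)).
apply: sigma_gen_sub => -[t k] /= t0.
apply: (smeasS (G := dev_com_gen [set t | 0 <= t] Z (k, false))).
  by move=> A hA; apply: sub_sigma_algebra; exists (k, false).
exact: (@smeas_com_gen _ _ _ _ [set t | 0 <= t] Z (k, false)).
Qed.

Lemma smeas_com_limit k : smeas com_sigma (com_limit k).
Proof.
apply: (smeasS (G := gens [set t | 0 <= t] (com k))); last exact: smeas_terminal.
apply: subset_trans (@sub_sigma_algebra _ _ _) _.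
apply: sigma_gen_sub => t t0.
apply: (smeasS (G := com_sigma)); first by move=> A hA; exact: sub_sigma_algebra.
exact: (@smeas_sigma_gen _ _ _ [set p : R * 'I_d | 0 <= p.1] (fun p => com p.2 p.1) (t, k)).
Qed.

(** The second flag tells what is kept when the limit is replaced ([true]) from the limit itself
    ([false]). A trivial sigma-algebra fills the slot of the fluctuations, which have no limit part,
    so that the index set stays a product. *)
Let split_gen (q : 'I_d * bool) (b : bool) : set (set T) :=
  match q.2, b with
  | true, true => dev_com_gen [set t | 0 <= t] Z q
  | true, false => sig (fun=> 0 : R)
  | false, true => sigma_gen [set t | 0 <= t] (com_bridge q.1)
  | false, false => sig (com_limit q.1)
  end.

Let split_gen_pi q b : pi_system (split_gen q b).
Proof.
case: q b => k [] [] /=.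
- exact: (@dev_com_pi (k, true)).
- exact: sig_pi.
- by apply: sigma_gen_pi => t t0; exact: measurable_com_bridge.
- exact/sig_pi/measurable_com_limit.
Qed.

Let smeas_limit_gen k : smeas (dev_com_gen [set t | 0 <= t] Z (k, false)) (com_limit k).
Proof.
apply: (smeasS (G := gens [set t | 0 <= t] (com k))); last exact: smeas_terminal.
by move=> A hA; do 2 apply: sub_sigma_algebra.
Qed.

Let mindep_split_gen : mindep P (fun p : ('I_d * bool) * bool => split_gen p.1 p.2).
Proof.
apply: (mindep_split (F := dev_com_gen [set t | 0 <= t] Z)).
- move=> q A hA.
  set H := dev_com_gen _ _ _.
  have HE : H = <<s H >>.
    by rewrite sigma_algebra_id// /H /dev_com_gen; case: q.2; exact: smallest_sigma_algebra.
  rewrite HE; apply: sigma_bigcap_fin => b.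
  move: (A b) (hA b); rewrite /H; case: q b {A hA H HE} => k [] [] /= A.
  + exact: sub_sigma_algebra.
  + by apply: sigma_gen_sub => _ _; exact: measurable_cst.
  + apply: sigma_gen_sub => t t0.
    apply: measurable_funB.
      exact: (@smeas_com_gen _ _ _ _ [set t | 0 <= t] Z (k, false)).
    by apply: measurable_funM => //; exact: smeas_limit_gen.
  + by apply: sigma_gen_sub => _ _; exact: smeas_limit_gen.
- exact: mindep_dev_com hZ.
- move=> [k b].
  have -> : split_gen (k, b) = (fun c => if c then split_gen (k, b) true else split_gen (k, b) false).
    by apply/funext => -[].
  apply/mindep2; case: b.
    by apply: indep2_const; have [] := @dev_com_pi (k, true).
  exact: indep_bridge_terminal (com_gaussian_increments k).
Qed.

Definition residual_sigma : set (set T) :=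
  <<s fluct_sigma `|` sigma_gen [set p : R * 'I_d | 0 <= p.1] (fun p => com_bridge p.2 p.1) >>.

Definition limit_sigma : set (set T) := sigma_gen [set: 'I_d] com_limit.

(** The array [split_gen] is regrouped along its second flag; regrouping it by coordinate gives
    [mindep_com_limit]. *)
Lemma indep_residual_limit : indep2 P residual_sigma limit_sigma.
Proof.
have := @mindep_regroup _ _ _ P _ _ (fun p : ('I_d * bool) * bool => p.2) _
  (fun p => split_gen_pi p.1 p.2) mindep_split_gen.
move=> h.
have /mindep2 : mindep P (fun b : bool => if b then residual_sigma else limit_sigma).
  2: by [].
apply: mindepS h => b.
have sub q c (f : T -> R) : c = b -> smeas (split_gen q c) f ->
    smeas (\bigcup_(i in [set i | i.2 = b]) split_gen i.1 i.2) f.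
  by move=> cb; apply: smeasS => A hA; apply: sub_sigma_algebra; exists (q, c).
case: b sub => sub.
  apply: sigma_idem => A [hA|hA].
    apply: (sigma_gen_sub _ hA) => -[[t i] k] [/= t0 it].
    apply: (sub (k, true) true) => //.
    exact: (@smeas_fluct_gen _ _ _ _ [set t | 0 <= t] Z (k, true)).
  apply: (sigma_gen_sub _ hA) => -[t k] /= t0.
  apply: (sub (k, false) true) => //.
  exact: (@smeas_sigma_gen _ _ _ [set t : R | 0 <= t] (com_bridge k) t).
apply: sigma_gen_sub => k _.
apply: (sub (k, false) false) => //.
exact: (@smeas_sigma_gen _ _ _ [set: unit] (fun=> com_limit k) tt).
Qed.

Lemma mindep_com_limit : mindep P (fun k => sig (com_limit k)).
Proof.
have h := @mindep_regroup _ _ _ P _ _ (fun p : ('I_d * bool) * bool => p.1.1) _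
  (fun p => split_gen_pi p.1 p.2) mindep_split_gen.
apply: mindepS h => k A hA; apply: sub_sigma_algebra.
by exists ((k, false), false).
Qed.

Lemma gauss_com_limit_comb (a : 'I_d -> R) : (exists k, a k != 0) ->
  gauss P (fun w => \sum_k a k * com_limit k w) (2 * \sum_k a k ^+ 2).
Proof.
move=> [k0 ak0].
have mL := measurable_com_limit.
pose S s w := \sum_(k <- s) a k * com_limit k w.
(* The sum lemmas work with positive variances, so zero coefficients are set aside; the left
   alternative is the case in which the partial sum vanishes identically. *)
have claim s : uniq s -> (forall k, k \in s -> a k = 0) \/
    0 < \sum_(k <- s) a k ^+ 2 /\ gauss P (S s) (2 * \sum_(k <- s) a k ^+ 2).
  elim: s => [|k s IH]; first by left.
  move=> /= /andP[ks us].
  have [ak|ak] := eqVneq (a k) 0.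
    have [h|[h1 h2]] := IH us; [left|right].
      by move=> j; rewrite inE => /predU1P[->//|]; exact: h.
    rewrite big_cons ak expr0n/= add0r; split => //.
    rewrite (_ : S (k :: s) = S s)//.
    by apply/funext => w; rewrite /S big_cons ak mul0r add0r.
  right; rewrite big_cons.
  have ak2 : 0 < a k ^+ 2 by rewrite exprn_even_gt0.
  have gk : gauss P (fun w => a k * com_limit k w) (2 * a k ^+ 2).
    rewrite mulrC; apply: gaussZ => //.
    exact: gauss_terminal (com_gaussian_increments k).
  have [h|[h1 h2]] := IH us.
    have -> : \sum_(j <- s) a j ^+ 2 = 0.
      by rewrite big_seq big1// => j /h ->; rewrite expr0n.
    rewrite addr0; split => //.
    rewrite (_ : S (k :: s) = (fun w => a k * com_limit k w))//.
    apply/funext => w; rewrite /S big_cons big_seq big1 ?addr0// => j /h ->.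
    by rewrite mul0r.
  split; first by rewrite addr_gt0.
  rewrite (_ : S (k :: s) = (fun w => a k * com_limit k w + S s w)); last first.
    by apply/funext => w; rewrite /S big_cons.
  rewrite mulrDr; apply: (@gaussD _ _ _ P) gk h2 _.
  - by rewrite mulr_gt0.
  - by rewrite mulr_gt0.
  have r := @mindep_regroup _ _ _ P _ _ (fun j : 'I_d => j \in s) _
    (fun j => sig_pi (mL j)) mindep_com_limit.
  have /mindep2 : mindep P (fun b : bool => if b then sig (S s)
    else sig (fun w => a k * com_limit k w)).
    apply: mindepS r => -[].
      apply: sig_sub; rewrite /S.
      have sub (s' : seq 'I_d) : {subset s' <= s} ->
          smeas (\bigcup_(i in [set i | (i \in s) = true]) sig (com_limit i))
            (fun w => \sum_(j <- s') a j * com_limit j w).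
        elim: s' => [|j s' IHs] ss'.
          rewrite (_ : (fun w => _) = fun=> 0); first exact: measurable_cst.
          by apply/funext => w; rewrite big_nil.
        rewrite (_ : (fun w => _) = (fun w => a j * com_limit j w +
            \sum_(j <- s') a j * com_limit j w)); last first.
          by apply/funext => w; rewrite big_cons.
        apply: measurable_funD; last by apply: IHs => x xs; apply: ss'; rewrite inE xs orbT.
        apply: measurable_funM; first exact: measurable_cst.
        apply: (smeasS (G := sig (com_limit j))).
          move=> A hA; apply: sub_sigma_algebra; exists j => //=.
          by rewrite ss'// inE eqxx.
        exact: (@smeas_sigma_gen _ _ _ [set: unit] (fun=> com_limit j) tt).
      exact: sub.
    apply: sig_sub; apply: measurable_funM; first exact: measurable_cst.
    apply: (smeasS (G := sig (com_limit k))).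
      by move=> A hA; apply: sub_sigma_algebra; exists k => //=; apply/negbTE.
    exact: (@smeas_sigma_gen _ _ _ [set: unit] (fun=> com_limit k) tt).
  exact: indep2C.
have [h|[_]] := claim (index_enum 'I_d) (index_enum_uniq _).
  by move: ak0; rewrite h ?eqxx// mem_index_enum.
exact.
Qed.

Definition com_limit_tuple (w : T) : d.-tuple R := [tuple com_limit k w | k < d].

Lemma measurable_com_limit_tuple : measurable_fun setT com_limit_tuple.
Proof.
apply/measurable_fun_tnthP => k.
rewrite (_ : _ \o _ = com_limit k); first exact: measurable_com_limit.
by apply/funext => w /=; rewrite tnth_mktuple.
Qed.

Lemma com_limit_tuple_sigma G : (forall k, smeas G (com_limit k)) ->
  forall D, measurable D -> <<s G >> (com_limit_tuple @^-1` D).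
Proof.
move=> sG D mD.
have : measurable_fun (setT : set (g_sigma_algebraType G)) com_limit_tuple.
  apply/measurable_fun_tnthP => k.
  rewrite (_ : _ \o _ = com_limit k); first exact: sG.
  by apply/funext => w /=; rewrite tnth_mktuple.
by move=> /(_ measurableT D mD); rewrite setTI.
Qed.

(** The coordinates are independent, centred and of variance 2, whence mean 0 and covariance
    [2%:M]. *)
Lemma is_normal_com_limit : is_normal P com_limit_tuple.
Proof.
exists 0, 2%:M; split.
- exact: tr_scalar_mx.
- move=> a a0; rewrite mul_mx_scalar -scalemxAl mxE mulr_gt0// mxE.
  have /rV0Pn[k ak] := a0.
  rewrite (bigD1 k)//=; apply: ltr_pwDl.
    by rewrite mxE -expr2 exprn_even_gt0.
  by apply: sumr_ge0 => j _; rewrite mxE -expr2 sqr_ge0.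
- move=> a a0 A mA.
  have /rV0Pn[k ak] := a0.
  have [_ /(_ A mA)] := gauss_com_limit_comb (ex_intro _ k ak).
  move=> g; apply: eq_trans (eq_trans g _).
    congr (P _); apply/funext => w; congr (A _); apply: eq_bigr => j _.
    by rewrite tnth_mktuple.
  have -> : \sum_k a 0 k * (0 : 'rV[R]_d) 0 k = 0.
    by rewrite big1// => j _; rewrite mxE mulr0.
  have -> // : (a *m 2%:M *m a^T) 0 0 = 2 * \sum_k a 0 k ^+ 2.
  rewrite mul_mx_scalar -scalemxAl mxE; congr (_ * _); rewrite mxE.
  by apply: eq_bigr => j _; rewrite mxE expr2.
Qed.

Lemma ae_cvg_com_limit : {ae P, forall w, forall k : 'I_d,
  center_of_mass (Z w) t k @[t --> +oo] --> tnth (com_limit_tuple w) k}.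
Proof.
have h k : {ae P, forall w, com k t w @[t --> +oo] --> com_limit k w}.
  exact: ae_cvg_terminal (com_gaussian_increments k).
have : {ae P, forall w, forall k, k \in index_enum 'I_d -> com k t w @[t --> +oo] --> com_limit k w}.
  elim: (index_enum 'I_d) => [|k s IH]; first exact: aeW.
  apply: filterS2 (h k) IH => w h1 h2 j; rewrite inE => /predU1P[->//|]; exact: h2.
apply: filterS => w hw k; rewrite tnth_mktuple; apply: hw; exact: mem_index_enum.
Qed.

End limit_of_the_center_of_mass.

(** * The conditioned process *)

Lemma preimage_sigma_gen {R : realType} {T : pointedType} {U I : Type} (X : T -> U)
    (D : set I) (c : I -> U -> R) (G : set (set T)) :
  (forall j, D j -> smeas G (fun w => c j (X w))) ->
  forall C, sigma_gen D c C -> <<s G >> (X @^-1` C).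
Proof.
move=> sX C; suff : sigma_gen D c `<=` [set C | <<s G >> (X @^-1` C)] by apply.
apply: smallest_sub.
  split=> /=.
  - by rewrite preimage_set0; exact: sigma_algebra0.
  - by move=> A hA; rewrite setTD preimage_setC; exact: sigma_algebraC.
  - by move=> F hF; rewrite preimage_bigcup; exact: sigma_algebra_bigcup.
move=> _ [j Dj [A mA <-]] /=; rewrite setTI.
exact: (smeas_preimage (sX j Dj) mA).
Qed.

Lemma measure_unique_pi {R : realType} {d : measure_display} {T : measurableType d}
    (m1 m2 : {measure set T -> \bar R}) (G : set (set T)) :
  G `<=` measurable -> setI_closed G -> G setT -> (m1 setT < +oo)%E ->
  (forall A, G A -> m1 A = m2 A) -> forall A, <<s G >> A -> m1 A = m2 A.
Proof.
move=> mG GI GT fin m12 A GA.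
have GE : [set X | G X /\ X `<=` setT] = G.
  by apply/seteqP; split=> X // [].
apply: (@g_sigma_algebra_measure_unique_trace _ _ _ G setT); rewrite ?GE//.
exact: m12.
Qed.

Section slice_kernel.
Context {R : realType} {d1 d2 : measure_display} {T1 : measurableType d1}
  {T2 : measurableType d2} (P : probability T1 R).

Let measurable_slice (x : T2) : measurable_fun setT (fun w : T1 => (w, x)).
Proof. exact: measurable_fun_pair. Qed.

(** The product of [P] with the Dirac mass at [x]: the second component hands the conditioning value
    to the process. *)
Definition slice_kernel (x : T2) : {measure set (T1 * T2) -> \bar R} :=
  image_measure P (measurable_slice x).

Lemma slice_kernelE x A : slice_kernel x A = P (ysection A x).
Proof.
rewrite /slice_kernel image_measureE; congr (P _); apply/seteqP.
by split=> w; rewrite /ysection/= inE.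
Qed.

Let measurable_slice_kernel U : measurable U ->
  measurable_fun setT (slice_kernel ^~ U).
Proof.
move=> mU; rewrite (_ : (fun x => _) = P \o ysection U).
  exact: measurable_fun_ysection.
by apply/funext => x; exact: slice_kernelE.
Qed.

HB.instance Definition _ := isKernel.Build _ _ _ _ _ slice_kernel measurable_slice_kernel.

Let slice_kernel_setT x : slice_kernel x setT = 1%E.
Proof. exact: probability_setT. Qed.

HB.instance Definition _ := Kernel_isProbability.Build _ _ _ _ _ slice_kernel slice_kernel_setT.

End slice_kernel.

Section conditioned_process.
Context {R : realType} {d : nat} {dT : measure_display} {T : measurableType dT}.
Variables (gamma : R) (P : probability T R) (B : noise R d T) (Z : T -> trajectory R d).
Hypothesis hZ : interacting_BBM gamma P B Z.

Let mZ : random_trajectory Z. Proof. by case: hZ. Qed.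

(* Replaces the limit of the center of mass by x in the decomposition
   Z = fluct + bridge + (clock / 2) * limit, whose first two terms are
   independent of the third. *)
Definition shifted_BBM (p : T * d.-tuple R) : trajectory R d :=
  fun t i k => Z p.1 t i k - clock t / 2 * (com_limit Z k p.1 - tnth p.2 k).

Lemma random_shifted_BBM : random_trajectory shifted_BBM.
Proof.
move=> [[t i] k] lj; apply: measurable_funB.
  by apply: (measurableT_comp (f := fun w => Z w t i k)) => //; exact: (mZ lj).
apply: measurable_funM => //; apply: measurable_funB.
  by apply: (measurableT_comp (f := com_limit Z k)) => //; exact: measurable_com_limit hZ _.
by apply: (measurableT_comp (f := fun x : d.-tuple R => tnth x k)) => //; exact: measurable_tnth.
Qed.

Lemma right_continuous_shifted_BBM p : right_continuous (shifted_BBM p).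
Proof.
move=> t i k lj; apply: cvgB.
  exact: (right_continuous_interacting_BBM hZ).
by do 2 apply: cvgMl; apply: clock_right_continuous; case: lj.
Qed.

(** The first sides are restricted to [residual_sigma], the events known to be independent of the
    limit; on general rectangles the law of [(w, N w)] is not a product. *)
Definition residual_rectangles : set (set (T * d.-tuple R)) :=
  [set E | exists A D, [/\ residual_sigma Z A, measurable D & E = A `*` D]].

Let residual_sub : residual_sigma Z `<=` measurable.
Proof.
apply: sigma_sub_measurable => A [hA|hA].
  have [+ _ _] : pi_system (fluct_sigma Z); last exact.
  by apply: sigma_gen_pi => j lj; exact: random_fluct.
have [+ _ _] : pi_system (sigma_gen [set p : R * 'I_d | 0 <= p.1] (fun p => com_bridge Z p.2 p.1)).
  2: exact.
by apply: sigma_gen_pi => -[t k] /= t0; exact: measurable_com_bridge hZ _ _ _.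
Qed.

Let residual_sigmaE : residual_sigma Z = <<s residual_sigma Z >>.
Proof. by rewrite [RHS]sigma_algebra_id//; exact: smallest_sigma_algebra. Qed.

(** The limit cancels: each coordinate is fluctuation plus bridge, a function of the first component
    measurable for [residual_sigma], plus [clock t / 2] times the second component. *)
Lemma smeas_shifted_BBM j : live j ->
  smeas residual_rectangles (fun p => coord j (shifted_BBM p)).
Proof.
move: j => [[t i] k] lj; rewrite /coord/= /shifted_BBM.
have left_ (f : T -> R) : smeas (residual_sigma Z) f ->
    smeas residual_rectangles (fun p => f p.1).
  move=> sf; apply: smeasP => A mA; apply: sub_sigma_algebra.
  exists (f @^-1` A), setT; split => //.
    by rewrite residual_sigmaE; exact: smeas_preimage.
  by apply/seteqP; split=> p //= [].
have right_ : smeas residual_rectangles (fun p => tnth p.2 k).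
  apply: smeasP => A mA; apply: sub_sigma_algebra.
  exists setT, ((fun x : d.-tuple R => tnth x k) @^-1` A); split.
  - by rewrite residual_sigmaE; exact: sigma_setT.
  - by rewrite -[X in measurable X]setTI; exact: measurable_tnth.
  - by apply/seteqP; split=> p //= [].
rewrite (_ : (fun p => _) = (fun p => (fluct (Z p.1) t i k + com_bridge Z k t p.1) +
   clock t / 2 * tnth p.2 k)).
  apply: measurable_funD; last by apply: measurable_funM => //; exact: measurable_cst.
  apply: (left_ (fun w => fluct (Z w) t i k + com_bridge Z k t w)).
  have sub : fluct_sigma Z `|` sigma_gen [set p : R * 'I_d | 0 <= p.1]
      (fun p => com_bridge Z p.2 p.1) `<=` <<s residual_sigma Z >>.
    by move=> A hA; do 2 apply: sub_sigma_algebra.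
  apply: measurable_funD.
    apply: (smeasS (G := fluct_sigma Z)).
      by move=> A hA; apply: sub; left.
    exact: (@smeas_sigma_gen _ _ _ live (fun j w => coord j (fluct (Z w))) (t, i, k)).
  apply: (smeasS (G := sigma_gen [set p : R * 'I_d | 0 <= p.1] (fun p => com_bridge Z p.2 p.1))).
    by move=> A hA; apply: sub; right.
  apply: (@smeas_sigma_gen _ _ _ [set p : R * 'I_d | 0 <= p.1] (fun p => com_bridge Z p.2 p.1) (t, k)).
  by case: lj.
apply/funext => p; rewrite /fluct /com_bridge /bridge /com -/(com_limit Z k); ring.
Qed.

(** By [indep_residual_limit], the law of [(w, N w)] and the product of [P] with the law of [N]
    agree on [residual_rectangles], hence on every event of [shifted_BBM]. The product measure,
    written as an integral over its second component, is the disintegration formula. *)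
Lemma conditional_process_shifted_BBM (N : {RV P >-> d.-tuple R}) :
  (N : T -> d.-tuple R) = com_limit_tuple Z ->
  conditional_process Z N (slice_kernel P) shifted_BBM.
Proof.
move=> NE; split.
- exact: random_shifted_BBM.
- exact: right_continuous_shifted_BBM.
move=> C D hC mD.
have mN : measurable_fun setT (N : T -> d.-tuple R) by exact: measurable_funP.
have mdiag : measurable_fun setT (fun w => (w, N w)) by exact: measurable_fun_pair.
have CN : <<s residual_rectangles >> (shifted_BBM @^-1` C).
  apply: preimage_sigma_gen hC => j lj; exact: smeas_shifted_BBM.
have mrect : residual_rectangles `<=` measurable.
  move=> _ [A [D' [/residual_sub mA mD' ->]]]; exact: measurableX.
have mC := sigma_sub_measurable mrect CN.
have rectT : residual_rectangles setT.
  exists setT, setT; split => //; last by rewrite setXTT.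
  by rewrite residual_sigmaE; exact: sigma_setT.
have CDN : <<s residual_rectangles >> (shifted_BBM @^-1` C `&` (setT `*` D)).
  apply: sigma_setI => //; apply: sub_sigma_algebra; exists setT, D; split => //.
  by rewrite residual_sigmaE; exact: sigma_setT.
have := @measure_unique_pi _ _ _ (image_measure P mdiag) (P \x^ distribution P N)%E
  residual_rectangles mrect _ rectT _ _ _ CDN.
move=> eqm.
(* On the graph of [N] the correction in [shifted_BBM] vanishes and the path is [Z w] itself. *)
transitivity (P ((fun w => (w, N w)) @^-1` (shifted_BBM @^-1` C `&` (setT `*` D)))).
  congr (P _); apply/seteqP; split=> w /=.
    move=> [ZC ND]; split => //.
    rewrite (_ : shifted_BBM _ = Z w)//.
    apply/funext => t; apply/funext => i; apply/funext => k.
    by rewrite /shifted_BBM/= NE tnth_mktuple subrr mulr0 subr0.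
  move=> [ZC [_ ND]]; split => //.
  rewrite (_ : shifted_BBM _ = Z w) in ZC => //.
  apply/funext => t; apply/funext => i; apply/funext => k.
  by rewrite /shifted_BBM/= NE tnth_mktuple subrr mulr0 subr0.
rewrite -(image_measureE P mdiag) eqm.
- transitivity (\int[distribution P N]_x
      (P \o ysection (shifted_BBM @^-1` C `&` (setT `*` D))) x)%E => //.
  rewrite [RHS]integral_mkcond; apply: eq_integral => x _.
  rewrite patchE; case: ifPn => xD /=.
    rewrite slice_kernelE; congr (P _); apply/seteqP; split=> w; rewrite /ysection/= !inE.
      by move=> [].
    by move=> h; split => //; split => //; rewrite inE in xD.
  rewrite (_ : ysection _ x = set0) ?measure0//.
  apply/seteqP; split=> w //; rewrite /ysection/= inE => -[_ [_ /= xD']].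
  by rewrite notin_setE in xD.
- move=> _ _ [A [A' [hA mA ->]]] [E [E' [hE mE ->]]].
  exists (A `&` E), (A' `&` E'); split; last by rewrite setXI.
    by rewrite residual_sigmaE; apply: sigma_setI; rewrite -residual_sigmaE.
  exact: measurableI.
- by rewrite image_measureE preimage_setT; apply: le_lt_trans (probability_le1 _ _) (ltry _).
- move=> _ [A [D' [hA mD' ->]]].
  have mA := residual_sub hA.
  rewrite image_measureE.
  apply: eq_trans (esym (product_measure2E _ _ mA mD')).
  rewrite (_ : _ @^-1` _ = A `&` N @^-1` D')//.
  apply: (indep_residual_limit hZ hA).
  rewrite NE /limit_sigma.
  have -> : sigma_gen [set: 'I_d] (com_limit Z) = <<s sigma_gen [set: 'I_d] (com_limit Z) >>.
    by rewrite [RHS]sigma_algebra_id//; exact: smallest_sigma_algebra.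
  apply: com_limit_tuple_sigma mD' => k.
  exact: (@smeas_sigma_gen _ _ _ [set: 'I_d] (com_limit Z) k).
Qed.

End conditioned_process.

(** * Reduction to dyadic times *)

Section kernel_probability.
Context {R : realType} {d d' : measure_display} {X : measurableType d}
  {Y : measurableType d'}.

(** Carries the probability structure of a single [Q x], so that the independence lemmas apply to
    it. *)
Definition kernel_probability (Q : R.-pker X ~> Y) (x : X) : set Y -> \bar R := Q x.

HB.instance Definition _ Q x := Measure.on (kernel_probability Q x).

HB.instance Definition _ Q x := Measure_isProbability.Build _ _ _
  (kernel_probability Q x) (prob_kernel (s := Q) x).

End kernel_probability.

Lemma indep2_sigma {R : realType} {d : measure_display} {T : measurableType d}
    (P : probability T R) (F G : set (set T)) :
  pi_system F -> pi_system G -> indep2 P F G -> indep2 P <<s F >> <<s G >>.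
Proof.
move=> Fpi Gpi iFG.
have h : mindep P (fun b : bool => <<s if b then F else G >>).
  apply: mindep_sigma; first by case.
  by apply/mindep2.
apply/mindep2; apply: mindepS h => -[] //.
Qed.

Section dyadic_skeleton.
Context {R : realType} {d : nat}.

Definition dyadic_live : set (R * nat * 'I_d) :=
  [set j | live j /\ exists r l, j.1.1 = dyadic r l].

(** The number of particles is right-continuous in time, and integers less than 1 apart coincide. *)
Lemma nb_particles_dyadic_next (t : R) : 0 <= t ->
  exists n0, forall n, nb_particles (dyadic_next (n + n0) t) = nb_particles t.
Proof.
move=> t0.
have h : (nb_particles s)%:R @[s --> t^'+] --> ((nb_particles t)%:R : R).
  apply: (@cvg_trans _ ((fun=> (nb_particles t)%:R) @ t^'+)); last exact: cvg_cst.
  apply: near_eq_cvg; near=> s; congr _%:R; apply/esym; near: s.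
  exact: nb_particles_near.
have gt n : t < dyadic_next n t by case/andP: (dyadic_nextP n t0).
have := cvg_seq_at_right h gt (cvg_dyadic_next t0).
move=> /cvgrPdist_lt /(_ 1 ltr01)[n0 _ hn0].
exists n0 => n; have := hn0 (n + n0)%N (leq_addl _ _) => /=.
set a := nb_particles _; set b := nb_particles _.
have [ab|ba|->//] := ltngtP a b.
  rewrite distrC -natrB ?(ltnW ab)// normr_nat ltNge ler1n subn_gt0 ab//.
rewrite -natrB ?(ltnW ba)// normr_nat ltNge ler1n subn_gt0 ba//.
Unshelve. all: by end_near. Qed.

Lemma dyadic_live_next (t : R) i (k : 'I_d) : live (t, i, k) ->
  exists n0, (forall n, dyadic_live (dyadic_next (n + n0) t, i, k)) /\
    forall z : trajectory R d, right_continuous z ->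
      z (dyadic_next (n + n0) t) i k @[n --> \oo] --> z t i k.
Proof.
move=> lj; have [/= t0 it] := lj.
have [n0 hn0] := nb_particles_dyadic_next t0.
have gt n : t < dyadic_next (n + n0) t by case/andP: (dyadic_nextP (n + n0) t0).
exists n0; split=> [n|z rz].
  split; last by do 2 eexists.
  by split => /=; [exact: dyadic_ge0|rewrite hn0].
apply: (@cvg_seq_at_right R (fun s => z s i k) _ t (z t i k) (rz t i k lj) gt).
rewrite (cvg_shiftn n0 (fun n => dyadic_next n t)); exact: cvg_dyadic_next.
Qed.

Lemma smeas_dyadic_live {T : pointedType} (X : T -> trajectory R d) (G : set (set T)) :
  (forall w, right_continuous (X w)) ->
  (forall j, dyadic_live j -> smeas G (fun w => coord j (X w))) ->
  forall j, live j -> smeas G (fun w => coord j (X w)).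
Proof.
move=> rX sX [[t i] k] lj; have [n0 [hn0 cn0]] := dyadic_live_next lj.
apply: (@smeas_cvg _ _ _ (fun n w => X w (dyadic_next (n + n0) t) i k)).
  by move=> n; exact: (sX _ (hn0 n)).
by move=> w; exact: cn0.
Qed.

(** A dyadic time [(r, l)], a label, a coordinate and a rational threshold. The type is countable,
    and so is the type of finite sequences of atoms; this permits exchanging quantifiers over them
    with almost sure statements. *)
Definition atom : Type := (nat * nat * nat * 'I_d * rat)%type.

(** The implication makes conditions on labels without a particle vacuous, so every atom defines an
    event. *)
Definition below (z : trajectory R d) (a : atom) : bool :=
  let: (r, l, i, k, q) := a in
  (i < nb_particles (dyadic r l : R))%N ==> (z (dyadic r l) i k <= ratr q).

Definition below_sets {T : Type} (X : T -> trajectory R d) : set (set T) :=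
  [set A | exists s : seq atom, A = [set w | all (below (X w)) s]].

Lemma below_setsI {T : Type} (X : T -> trajectory R d) : setI_closed (below_sets X).
Proof.
move=> _ _ [s ->] [s' ->]; exists (s ++ s').
apply/seteqP; split=> w /=; rewrite all_cat; first by move=> [-> ->].
by move=> /andP[].
Qed.

Lemma below_setsT {T : Type} (X : T -> trajectory R d) : below_sets X setT.
Proof. by exists [::]; apply/seteqP; split. Qed.

Lemma sigma_below_sets {T : pointedType} (X : T -> trajectory R d) (G : set (set T)) :
  (forall j, dyadic_live j -> smeas G (fun w => coord j (X w))) ->
  below_sets X `<=` <<s G >>.
Proof.
move=> sX _ [s ->].
elim: s => [|[[[[r l] i] k] q] s IH].
  by rewrite (_ : [set w | _] = setT); [exact: sigma_setT|apply/seteqP; split].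
rewrite (_ : [set w | _] = [set w | below (X w) (r, l, i, k, q)] `&`
  [set w | all (below (X w)) s]); last first.
  by apply/seteqP; split=> w /=; [move=> /andP[]|move=> [-> ->]].
apply: sigma_setI => //; rewrite /below.
have [ir|ir] := boolP (i < nb_particles (dyadic r l : R))%N; last first.
  by rewrite (_ : [set w | _] = setT); [exact: sigma_setT|apply/seteqP; split].
have lj : dyadic_live (dyadic r l, i, k).
  by split; [split => //=; exact: dyadic_ge0|exists r, l].
rewrite (_ : [set w | _] = (fun w => X w (dyadic r l) i k) @^-1` `]-oo, ratr q]%classic).
  exact: smeas_preimage (sX _ lj) (measurable_itv _).
by apply/seteqP; split=> w /=; rewrite in_itv.
Qed.

Lemma smeas_below_sets {T : pointedType} (X : T -> trajectory R d) j :
  dyadic_live j -> smeas (below_sets X) (fun w => coord j (X w)).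
Proof.
move: j => [[t i] k] [[/= t0 it] [r [l /= tE]]].
apply: (measurability _ (RGenInftyO.measurableE R)) => _ [_ [x ->] <-].
rewrite setTI.
(* Strict inequalities with a real bound are recovered as countable unions over rational
   thresholds. *)
rewrite (_ : _ @^-1` _ = \bigcup_q [set w | X w t i k <= ratr q /\ ratr q < x]).
  apply: bigcupT_measurable_rat => q.
  have [qx|qx] := ltP (ratr q) x; last first.
    rewrite (_ : [set w | _] = set0); first exact: measurable0.
    by apply/seteqP; split=> w //= [].
  apply: sub_sigma_algebra; exists [:: (r, l, i, k, q)].
  apply/seteqP; split=> w /=; rewrite -tE it andbT; first by case.
  by [].
apply/seteqP; split=> w /=; rewrite in_itv/=.
  move=> /rat_in_itvoo[q]; rewrite in_itv/= => /andP[h1 h2].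
  by exists q => //; split => //; exact: ltW.
by move=> [q _ [h1 h2]]; exact: le_lt_trans h1 h2.
Qed.

(** Cylinder events involve uncountably many times, the skeleton only countably many; on
    right-continuous trajectories the two carry the same information. The sets with this property
    form a sigma-algebra that contains the coordinate events. *)
Lemma cylinder_sigma_skeleton (C : set (trajectory R d)) : cylinder_sigma C ->
  exists2 C0, <<s below_sets (@id (trajectory R d)) >> C0 &
    forall z, right_continuous z -> C z <-> C0 z.
Proof.
pose E := [set C : set (trajectory R d) |
  exists2 C0, <<s below_sets (@id (trajectory R d)) >> C0 &
    forall z, right_continuous z -> C z <-> C0 z].
suff : @cylinder_sigma R d `<=` E by apply.
apply: smallest_sub.
  split.
  - by exists set0; [exact: sigma_algebra0|].
  - move=> A [A0 sA0 hA]; exists (~` A0); first exact: sigma_algebraC.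
    by move=> z rz; rewrite setTD /setC/= (hA z rz).
  - move=> F hF.
    have [F0 hF0] := @choice _ _ (fun n C0 => <<s below_sets (@id (trajectory R d)) >> C0 /\
      forall z, right_continuous z -> F n z <-> C0 z) (fun n =>
      let: ex_intro2 C0 h1 h2 := hF n in ex_intro _ C0 (conj h1 h2)).
    exists (\bigcup_n F0 n); first by apply: sigma_algebra_bigcup => n; have [] := hF0 n.
    move=> z rz; split=> -[n _ Fz]; exists n => //; by apply/((hF0 n).2 z rz).
move=> _ [[[t i] k] lj [A mA <-]]; have [n0 [hn0 cn0]] := dyadic_live_next lj.
(* A total function of the skeleton: the upper limit along dyadic times from the right, equal to the
   coordinate whenever [z] is right-continuous. *)
pose h (z : trajectory R d) := fine (limn_esup (fun n => (z (dyadic_next (n + n0) t) i k)%:E)).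
exists (h @^-1` A).
  apply: smeas_preimage mA; apply: measurableT_comp => //.
  apply: measurable_fun_limn_esup => n; apply/measurable_EFinP.
  exact: (@smeas_below_sets _ (@id (trajectory R d)) (dyadic_next (n + n0) t, i, k)).
move=> z rz; rewrite setTI /preimage/=.
have -> // : h z = coord (t, i, k) z.
rewrite /h.
have /cvg_limn_einf_sup[_ ->//] :
  (fun n => (z (dyadic_next (n + n0) t) i k)%:E) @ \oo --> (z t i k)%:E.
apply: cvg_EFin; first exact: nearW.
exact: cn0.
Qed.

Lemma same_law_below {dT dT' : measure_display} {T : measurableType dT}
    {T' : measurableType dT'} (P : probability T R) (P' : probability T' R)
    (X : T -> trajectory R d) (X' : T' -> trajectory R d) :
  random_trajectory X -> random_trajectory X' ->
  (forall w, right_continuous (X w)) -> (forall w, right_continuous (X' w)) ->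
  (forall s, P [set w | all (below (X w)) s] = P' [set w | all (below (X' w)) s]) ->
  same_law P X P' X'.
Proof.
move=> mX mX' rX rX' eqs C /cylinder_sigma_skeleton[C0 sC0 CC0].
have meas (dS : measure_display) (S : measurableType dS) (U : S -> trajectory R d) :
    random_trajectory U ->
    @measurable_fun _ _ S (g_sigma_algebraType (below_sets (@id (trajectory R d)))) setT U.
  set G := below_sets _.
  move=> mU; apply: (@measurability _ _ S (g_sigma_algebraType G) setT U G) => //.
  move=> _ [_ [s ->] <-]; rewrite setTI.
  have : <<s gens live (fun j w => coord j (U w)) >> (U @^-1` [set w | all (below (id w)) s]).
    apply: (@sigma_below_sets S U); last by exists s.
    by move=> j [lj _]; exact: (@smeas_gen _ _ _ live (fun j w => coord j (U w))).
  by apply: sigma_sub_measurable; apply: gens_measurable.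
have eqC (dS : measure_display) (S : measurableType dS) (U : S -> trajectory R d) :
    (forall w, right_continuous (U w)) -> U @^-1` C = U @^-1` C0.
  by move=> rU; apply/seteqP; split=> w /=; apply CC0; exact: rU.
rewrite (eqC _ _ X rX) (eqC _ _ X' rX').
have := @measure_unique_pi R _ (g_sigma_algebraType (below_sets (@id (trajectory R d))))
  (image_measure P (meas _ _ X mX)) (image_measure P' (meas _ _ X' mX'))
  (below_sets (@id (trajectory R d))).
rewrite !image_measureE; apply => //.
- by move=> A hA; exact: sub_sigma_algebra.
- exact: below_setsI.
- exact: below_setsT.
- by rewrite preimage_setT; apply: le_lt_trans (probability_le1 _ _) (ltry _).
- by move=> _ [s ->]; rewrite !image_measureE; exact: eqs.
Qed.

End dyadic_skeleton.

(** * The fluctuations under an arbitrary version of the conditional law *)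

Section conditional_law.
Context {R : realType} {d : nat} {dT : measure_display} {T : measurableType dT}.
Variables (gamma : R) (P : probability T R) (B : noise R d T) (Z : T -> trajectory R d).
Hypothesis hZ : interacting_BBM gamma P B Z.
Variable N : {RV P >-> d.-tuple R}.
Hypothesis NE : (N : T -> d.-tuple R) = com_limit_tuple Z.
Context {dT' : measure_display} {T' : measurableType dT'}
  (Q : R.-pker (d.-tuple R) ~> T') (Z' : T' -> trajectory R d).
Hypothesis cZ : conditional_process Z N Q Z'.

Let mZ : random_trajectory Z. Proof. by case: hZ. Qed.
Let mZ' : random_trajectory Z'. Proof. by case: cZ. Qed.
Let rZ' w : right_continuous (Z' w). Proof. by case: cZ. Qed.
Let disint (C : set (trajectory R d)) (D : set (d.-tuple R)) :
  cylinder_sigma C -> measurable D ->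
  P (Z @^-1` C `&` N @^-1` D) = (\int[distribution P N]_(x in D) Q x (Z' @^-1` C))%E.
Proof. by case: cZ => _ _; exact. Qed.

(** The center of mass is viewed as a trajectory constant in the label, so that [below_sets] and the
    dyadic skeleton apply to it as well. *)
Definition com_trajectory (z : trajectory R d) : trajectory R d :=
  fun t _ k => center_of_mass z t k.

Let random_com dS (V : measurableType dS) (X : V -> trajectory R d) :
  random_trajectory X -> random_trajectory (fun w => com_trajectory (X w)).
Proof. by move=> mX [[t i] k] [t0 _]; exact: measurable_center_of_mass. Qed.

Let right_continuous_com z : right_continuous z -> right_continuous (com_trajectory z).
Proof. by move=> rz t i k [t0 _]; exact: center_of_mass_right_continuous. Qed.

Let cylinder_fluct_below s :
  cylinder_sigma [set z : trajectory R d | all (below (fluct z)) s].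
Proof.
apply: (@sigma_below_sets _ _ (trajectory R d) (@fluct R d) (gens live coord)); last by exists s.
move=> [[t i] k] [[/= t0 it] _].
apply: (smeas_fluct (Z := @id (trajectory R d))) => // j jt.
exact: (@smeas_gen _ (trajectory R d) _ live coord (t, j, k)).
Qed.

Let cylinder_com_below s :
  cylinder_sigma [set z : trajectory R d | all (below (com_trajectory z)) s].
Proof.
apply: (@sigma_below_sets _ _ (trajectory R d) com_trajectory (gens live coord)); last by exists s.
move=> [[t i] k] [[/= t0 it] _].
apply: (smeas_center_of_mass (Z := @id (trajectory R d))) => // j jt.
exact: (@smeas_gen _ (trajectory R d) _ live coord (t, j, k)).
Qed.

Let fluct_set s : set (trajectory R d) := [set z | all (below (fluct z)) s].
Let com_set s : set (trajectory R d) := [set z | all (below (com_trajectory z)) s].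

(** The limit is a function of the center of mass, so the event on [N] joins the center-of-mass
    factor of [indep_fluct_com]. *)
Let product_law s s' (D : set (d.-tuple R)) : measurable D ->
  P (Z @^-1` (fluct_set s `&` com_set s') `&` N @^-1` D) =
  (P (Z @^-1` fluct_set s) * P (Z @^-1` com_set s' `&` N @^-1` D))%E.
Proof.
move=> mD; rewrite preimage_setI -setIA; apply: (indep_fluct_com hZ).
  have -> : fluct_sigma Z = <<s fluct_sigma Z >>.
    by rewrite [RHS]sigma_algebra_id//; exact: smallest_sigma_algebra.
  apply: (@sigma_below_sets _ _ T (fun w => fluct (Z w))); last by exists s.
  by move=> j [lj _]; exact: (@smeas_sigma_gen _ _ _ live (fun j w => coord j (fluct (Z w)))).
have -> : com_sigma Z = <<s com_sigma Z >>.
  by rewrite [RHS]sigma_algebra_id//; exact: smallest_sigma_algebra.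
apply: sigma_setI.
  apply: (@sigma_below_sets _ _ T (fun w => com_trajectory (Z w))); last by exists s'.
  move=> [[t i] k] [[/= t0 it] _].
  exact: (@smeas_sigma_gen _ _ _ [set p : R * 'I_d | 0 <= p.1] (fun p => com Z p.2 p.1) (t, k)).
rewrite NE; apply: com_limit_tuple_sigma mD => k; exact: smeas_com_limit.
Qed.

Let mcyl dS (V : measurableType dS) (X : V -> trajectory R d) C :
  random_trajectory X -> cylinder_sigma C -> measurable (X @^-1` C).
Proof.
move=> mX hC.
have : <<s gens live (fun j w => coord j (X w)) >> (X @^-1` C).
  apply: preimage_sigma_gen hC => j lj.
  exact: (@smeas_gen _ _ _ live (fun j w => coord j (X w))).
by apply: sigma_sub_measurable; exact: gens_measurable.
Qed.

(** By the disintegration formula and [product_law], both sides have the same integral over every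
    measurable [D]. *)
Let ae_product s s' : {ae distribution P N, forall x,
  Q x (Z' @^-1` (fluct_set s `&` com_set s')) =
  (P (Z @^-1` fluct_set s) * Q x (Z' @^-1` com_set s'))%E}.
Proof.
have cI : cylinder_sigma (fluct_set s `&` com_set s').
  apply: sigma_setI; [exact: cylinder_fluct_below|exact: cylinder_com_below].
have mI := mcyl mZ' cI.
have mC := mcyl mZ' (cylinder_com_below s').
have Q1 x A : measurable A -> (Q x A <= 1)%E.
  move=> mA; rewrite -(prob_kernel (s := Q) x); apply: le_measure; rewrite ?inE//.
have int_ : (distribution P N).-integrable setT (fun x => Q x (Z' @^-1` (fluct_set s `&` com_set s'))).
  apply: (le_integrable measurableT (g := EFin \o cst 1)).
  - exact: measurable_kernel.
  - by move=> x _; rewrite gee0_abs//= normr1; exact: Q1.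
  - exact: finite_measure_integrable_cst.
have mg : measurable_fun setT (fun x => P (Z @^-1` fluct_set s) * Q x (Z' @^-1` com_set s'))%E.
  by apply: measurable_funeM; exact: measurable_kernel.
have h : ae_eq (distribution P N) setT
    (fun x => Q x (Z' @^-1` (fluct_set s `&` com_set s')))
    (fun x => P (Z @^-1` fluct_set s) * Q x (Z' @^-1` com_set s'))%E.
  apply: (integral_ae_eq measurableT int_ mg) => D _ mD.
  rewrite -(disint cI mD) product_law// (disint (cylinder_com_below s') mD).
  apply/esym; apply: ge0_integralZl => //.
  by apply: measurable_funS (measurable_kernel Q _ mC).
by apply: filterS h => x; apply.
Qed.

(** The pairs of sequences of atoms are countable, so the exceptional null sets can be united
    through their [pickle] codes. *)
Let ae_products : {ae distribution P N, forall x, forall s s',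
  Q x (Z' @^-1` (fluct_set s `&` com_set s')) =
  (P (Z @^-1` fluct_set s) * Q x (Z' @^-1` com_set s'))%E}.
Proof.
pose G n x := if unpickle n is Some p then
  Q x (Z' @^-1` (fluct_set p.1 `&` com_set p.2)) =
  (P (Z @^-1` fluct_set p.1) * Q x (Z' @^-1` com_set p.2))%E else True.
have aeG n : (distribution P N).-negligible (~` [set x | G n x]).
  rewrite /G; case: unpickle => [p|]; first exact: ae_product.
  by rewrite setCT; exact: negligible_set0.
apply: negligibleS (negligible_bigcup aeG) => x /= nx.
apply: contrapT => nG; apply: nx => s s'.
apply: contrapT => ne; apply: nG.
by exists (pickle (s, s')) => //=; rewrite /G pickleK.
Qed.

(** The driving noise is that of [Z]; its independence of the past is inherited because the past of
    the fluctuations is contained in the past of [Z]. *)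
Let fluct_driven : driven_branching_OU gamma P B (fun w => fluct (Z w)).
Proof.
have [_ dn dz iz] := hZ; split.
- exact: random_fluct.
- move=> m; have [BM iB iP] := dn m; split => //.
  apply: indep2S iP => //; apply: sigma_gen_incl => -[[t i] k] [[/= t0 it] tm].
  apply: smeas_fluct => // j jt.
  exact: (@smeas_sigma_gen _ _ _ [set j | live j /\ j.1.1 <= m%:R] (fun j w => coord j (Z w)) (t, j, k)).
- by move=> w; exact: fluct_dyadic_branching.
- by move=> w; exact: fluct_OU_motion (iz w).
Qed.

Lemma conditional_decomposition : {ae distribution P N, forall x,
  (forall t : R, 0 <= t ->
    indep2 (Q x)
      (sigma_gen [set: 'I_d] (fun k w => center_of_mass (Z' w) t k))
      (sigma_gen [set p : nat * 'I_d | (p.1 < nb_particles t)%N]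
         (fun p w => fluct (Z' w) t p.1 p.2))) /\
  is_branching_OU gamma (Q x) (fun w => fluct (Z' w))}.
Proof.
apply: filterS ae_products => x hx.
pose Qx : probability T' R := kernel_probability Q x.
have rF w : right_continuous (fluct (Z' w)) by exact: fluct_right_continuous.
have rC w : right_continuous (com_trajectory (Z' w)) by exact: right_continuous_com.
have mF : random_trajectory (fun w => fluct (Z' w)) by exact: random_fluct.
have mC : random_trajectory (fun w => com_trajectory (Z' w)) by exact: random_com.
(* An empty list of conditions on the center of mass leaves the marginal law of the fluctuations,
   the same for almost every [x]. *)
have law s : Qx [set w | all (below (fluct (Z' w))) s] = P [set w | all (below (fluct (Z w))) s].
  have := hx s [::].
  rewrite (_ : com_set [::] = setT) ?setIT ?preimage_setT; last by apply/seteqP; split.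
  by rewrite prob_kernel mule1.
have pi_below (X : T' -> trajectory R d) : random_trajectory X -> pi_system (below_sets X).
  move=> mX; split; [|exact: below_setsI|exact: below_setsT].
  move=> A hA.
  have : <<s gens live (fun j w => coord j (X w)) >> A.
    apply: sigma_below_sets hA => j [lj _].
    exact: (@smeas_gen _ _ _ live (fun j w => coord j (X w))).
  by apply: sigma_sub_measurable; exact: gens_measurable.
have ind : indep2 Qx <<s below_sets (fun w => com_trajectory (Z' w)) >>
                     <<s below_sets (fun w => fluct (Z' w)) >>.
  apply: indep2C; apply: indep2_sigma; [exact: pi_below|exact: pi_below|].
  move=> _ _ [s ->] [s' ->]; apply: eq_trans (hx s s') _.
  by congr (_ * _)%E; apply/esym; exact: law.
split.
- move=> t t0; apply: indep2S ind.
    apply: sigma_gen_sub => k _.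
    (* [com_trajectory] ignores the label, and label 0 is alive at all times. *)
    have lj : live (t, 0%N, k) by split => //=; rewrite expn_gt0.
    apply: (@smeas_dyadic_live _ _ _ (fun w => com_trajectory (Z' w)) _ rC _ (t, 0%N, k) lj).
    by move=> j dj; exact: smeas_below_sets.
  apply: sigma_gen_sub => -[i k] /= it.
  have lj : live (t, i, k) by split.
  apply: (@smeas_dyadic_live _ _ _ (fun w => fluct (Z' w)) _ rF _ (t, i, k) lj).
  by move=> j dj; exact: smeas_below_sets.
- split => //.
  (* The unconditioned fluctuations, on the original space and with the original noise, serve as the
     driven copy required by the weak formulation. *)
  exists dT, T, P, B, (fun w => fluct (Z w)); split; first exact: fluct_driven.
  apply: (@same_law_below _ _ _ _ _ _ Qx P) => //.
    by apply: random_fluct.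
  move=> w; apply: fluct_right_continuous; exact: right_continuous_interacting_BBM hZ _.
Qed.

End conditional_law.

Theorem theorem14 (R : realType) (d : nat) (hd : (0 < d)%N)
    (gamma : R) (hgamma : gamma != 0)
    (dT : measure_display) (T : measurableType dT) (P : probability T R)
    (B : noise R d T) (Z : T -> trajectory R d)
    (hZ : interacting_BBM gamma P B Z) :
  exists N : {RV P >-> d.-tuple R},
  [/\ {ae P, forall w, forall k : 'I_d,
         center_of_mass (Z w) t k @[t --> +oo] --> tnth (N w) k},
      is_normal P N,
      exists (dT' : measure_display) (T' : measurableType dT')
             (Q : R.-pker (d.-tuple R) ~> T') (Z' : T' -> trajectory R d),
        conditional_process Z N Q Z' &
      forall (dT' : measure_display) (T' : measurableType dT')
             (Q : R.-pker (d.-tuple R) ~> T') (Z' : T' -> trajectory R d),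
        conditional_process Z N Q Z' ->
        {ae distribution P N, forall x,
           let Y := fun w => fluct (Z' w) in
           (forall t : R, 0 <= t ->
              (forall w i k, (i < nb_particles t)%N ->
                 Z' w t i k = center_of_mass (Z' w) t k + Y w t i k) /\
              indep2 (Q x)
                (sigma_gen [set: 'I_d] (fun k w => center_of_mass (Z' w) t k))
                (sigma_gen [set p : nat * 'I_d | (p.1 < nb_particles t)%N]
                   (fun p w => Y w t p.1 p.2))) /\
           is_branching_OU gamma (Q x) Y}].
Proof.
pose N : {RV P >-> d.-tuple R} := HB.pack (com_limit_tuple Z)
  (isMeasurableFun.Build _ _ _ _ (com_limit_tuple Z) (measurable_com_limit_tuple hZ)).
have NE : (N : T -> d.-tuple R) = com_limit_tuple Z by [].
exists N; split.
- exact: ae_cvg_com_limit hZ.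
- exact: is_normal_com_limit hZ.
- do 4 eexists; exact: conditional_process_shifted_BBM hZ _ NE.
move=> dT' T' Q Z' cZ.
apply: filterS (conditional_decomposition hZ NE cZ) => x [ind ou]; split=> [t t0|]; last exact: ou.
split; last exact: ind.
by move=> w i k _; rewrite /fluct addrC subrK.
Qed.
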